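(* Let $\xi^\circ$ be a diffuse random measure on $\mathbb R^d$. Then $(X^\circ,\xi^\circ)$ is mass-stationary if and only if $(X^\circ,\xi^\circ)$ is distributionally invariant under preserving shifts against any stationary independent background. Moreover, $(X^\circ,\xi^\circ)$ is mass-stationary if and only if $$\theta_{\pi_r^{(n)}(Y^{(n)},\,\xi^\circ)}(Y^{(n)},X^\circ,\xi^\circ)\overset{D}{=}(Y^{(n)},X^\circ,\xi^\circ)\quad\text{under }\mathbf P^\circ$$ for all $n\in\mathbb N$ and $r\in[0,1)$, where $Y^{(n)}$ and $\pi_r^{(n)}$ are the specific stationary independent backgrounds and preserving shifts defined in the context.
   Context: Setting. $(\Omega,\mathcal F,\mathbf P^\circ)$ is a measure space (not necessarily a probability space; extended if further randomization is needed). $\lambda$ is Lebesgue measure on $\mathbb R^d$. For a measure $\mu$ and a set $A$ with $0<\mu(A)<\infty$, $\mu(\cdot\mid A):=\mu(\cdot\cap A)/\mu(A)$. The symbol $\overset{D}{=}$ denotes equality of distributions (under $\mathbf P^\circ$). $(E,\mathcal E)$ is a measurable space on which the additive group $\mathbb R^d$ acts by maps $\theta_t$, such that $(t,x)\mapsto\theta_tx$ is measurable. $X^\circ$ is a random element in $(E,\mathcal E)$ and $\xi^\circ$ is a random (locally finite) measure on $\mathbb R^d$ having $0$ in its support $\mathbf P^\circ$-a.e. For a measure, $\theta_t\xi(B):=\xi(B+t)$ for Borel $B\subseteq\mathbb R^d$; shifts act componentwise on tuples. The distribution of $(X^\circ,\xi^\circ)$ under $\mathbf P^\circ$ is $\sigma$-finite.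 $\xi^\circ$ is diffuse if $\xi^\circ(\{t\})=0$ for all $t\in\mathbb R^d$. Mass-stationarity: $(X^\circ,\xi^\circ)$ is mass-stationary (under $\mathbf P^\circ$) if for all bounded Borel $C\subset\mathbb R^d$ with $\lambda(C)>0$ and $\lambda(\partial C)=0$, $$(\theta_{V_C}(X^\circ,\xi^\circ),V_C+U_C)\overset{D}{=}((X^\circ,\xi^\circ),U_C),$$ where the conditional distribution of $U_C$ given $(X^\circ,\xi^\circ)$ is uniform on $C$ and the conditional distribution of $V_C$ given $((X^\circ,\xi^\circ),U_C)$ is $\xi^\circ(\cdot\mid C-U_C)$, with $C-x:=\{y-x:y\in C\}$. Backgrounds: a stationary independent background is a random element $Y^\circ$ in a measurable space on which $\mathbb R^d$ acts measurably (possibly obtained by extending the underlying space), which is stationary ($\theta_tY^\circ\overset{D}{=}Y^\circ$ for all $t$) and independent of $(X^\circ,\xi^\circ)$; independence means that the joint distribution of $Y^\circ$ and $(X^\circ,\xi^\circ)$ is the product of a shift-invariant probability measure (the law of $Y^\circ$) and the $\sigma$-finite distribution of $(X^\circ,\xi^\circ)$. Preserving shifts: let $\pi$ be a measurable map taking $(Y^\circ,\xi^\circ)$ to a location $\pi(Y^\circ,\xi^\circ)\in\mathbb R^d$, with induced allocation rule $\tau(s):=s+\pi(\theta_s(Y^\circ,\xi^\circ))$, $s\in\mathbb R^d$. $\pi$ is a preserving shift if for each fixed value of $(Y^\circ,\xi^\circ)$, $\xi^\circ(\{s\in\mathbb R^d:\tau(s)\in B\})=\xi^\circ(B)$ for all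 Borel $B\subseteq\mathbb R^d$. $(X^\circ,\xi^\circ)$ is distributionally invariant under preserving shifts against any stationary independent background if for all stationary independent backgrounds $Y^\circ$ and all preserving shifts $\pi$, $$\theta_{\pi(Y^\circ,\xi^\circ)}(Y^\circ,X^\circ,\xi^\circ)\overset{D}{=}(Y^\circ,X^\circ,\xi^\circ).$$ The specific $Y^{(n)}$ and $\pi_r^{(n)}$: fix $n\in\mathbb N$ and a Borel isomorphism $\varphi:[0,n)^d\to[0,1)$. For a diffuse probability measure $\mu$ on $[0,n)^d$ let $F_\mu(x):=\mu(\varphi\le x)$, $x\in[0,1)$, let $F_\mu^{-1}$ be its (left- or right-continuous) generalized inverse, and for $r\in[0,1)$ define $\psi_r^\mu:[0,n)^d\to[0,n)^d$ by $$\psi_r^\mu:=\varphi^{-1}\big(F_\mu^{-1}(F_\mu(\varphi)+r \bmod 1)\big).$$ Let $Y^{(n)}=(Y^{(n)}_s)_{s\in\mathbb R^d}$ be the random field (with $\theta_tY^{(n)}=(Y^{(n)}_{t+s})_{s}$) defined as follows: $Y^{(n)}_0$ is independent of $(X^\circ,\xi^\circ)$ and uniform on $[0,n)^d$, and $Y^{(n)}_s$ is the vector to $s$ from the lexicographically lowest corner of that box $k-Y^{(n)}_0+[0,n)^d$, $k\in n\mathbb Z^d$, in which $s$ lies. Put $$\pi_r^{(n)}(Y^{(n)},\xi^\circ):=\psi_r^{\mu}(Y^{(n)}_0)-Y^{(n)}_0\quad\text{with}\quad\mu=(\theta_{-Y^{(n)}_0}\xi^\circ)(\cdot\mid[0,n)^d)$$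 (and $\pi_r^{(n)}:=0$ when $\theta_{-Y^{(n)}_0}\xi^\circ([0,n)^d)=0$). *)

(* Defs.v *)
(* MathComp-Analysis; R^d is 'rV[R]_d with R : realType. *)
From HB Require Import structures.
From mathcomp Require Import all_boot all_order all_algebra.
From mathcomp Require Import all_classical all_reals all_analysis.
From mathcomp Require Import measurable_realfun.

Set Implicit Arguments.
Unset Strict Implicit.
Unset Printing Implicit Defensive.

Import Order.TTheory GRing.Theory Num.Theory.
Import numFieldNormedType.Exports.

Local Open Scope classical_set_scope.
Local Open Scope ring_scope.

Definition mx_borel_display : measure_display. Proof. by constructor. Qed.

(* Matrices carry the Borel sigma-algebra of their topology. *)
Section mx_borel.
Context (R : realType) (m n : nat).

Definition mx_borel : set_system 'M[R]_(m, n) :=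
  <<s [set U : set 'M[R]_(m, n) | open U] >>.

Let mx_borel0 : mx_borel set0. Proof. exact: sigma_algebra0. Qed.

Let mx_borelC A : mx_borel A -> mx_borel (~` A).
Proof. exact: sigma_algebraC. Qed.

Let mx_borel_bigcup (F : (set 'M[R]_(m, n))^nat) :
  (forall i, mx_borel (F i)) -> mx_borel (\bigcup_i F i).
Proof. exact: sigma_algebra_bigcup. Qed.

HB.instance Definition _ := @isMeasurable.Build mx_borel_display 'M[R]_(m, n)
  mx_borel mx_borel0 mx_borelC mx_borel_bigcup.

Lemma mx_continuous_measurable (f : 'M[R]_(m, n) -> 'M[R]_(m, n)) :
  continuous f -> measurable_fun [set: 'M[R]_(m, n)] f.
Proof.
move=> cf; apply: (measurability [set U : set 'M[R]_(m, n) | open U]) => //=.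
move=> _ [U oU <-]; rewrite setTI; apply: sub_gen_smallest.
by apply: open_comp => // x _; exact: cf.
Qed.

Lemma mx_subr_measurable (t : 'M[R]_(m, n)) :
  measurable_fun [set: 'M[R]_(m, n)] (fun x => x - t).
Proof.
by apply: mx_continuous_measurable => x; exact: (cvgB cvg_id (cvg_cst t)).
Qed.

End mx_borel.

(* Lebesgue measure on R^d, as the d-fold product of the one-dimensional one. *)
Fixpoint lebesgue_rV (R : realType) (d : nat) : set 'rV[R]_d -> \bar R :=
  match d return set 'rV[R]_d -> \bar R with
  | 0 => dirac (0 : 'rV[R]_0)
  | d'.+1 => pushforward ((@lebesgue_measure R) \x (@lebesgue_rV R d'))%E
      (fun p : R * 'rV[R]_d' => row_mx p.1%:M p.2 : 'rV[R]_(1 + d'))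
  end.

Lemma lebesgue_rV0 (R : realType) d : @lebesgue_rV R d set0 = 0%E.
Proof.
elim: d => [|d IH] /=; first by rewrite measure0.
rewrite /pushforward preimage_set0 /product_measure1 integral0_eq// => x _ /=.
by rewrite xsection0.
Qed.

Lemma lebesgue_rV_box (R : realType) d (a b : 'rV[R]_d) : (forall i, a 0 i <= b 0 i) ->
  lebesgue_rV [set x | forall i, a 0 i <= x 0 i < b 0 i] = (\prod_i (b 0 i - a 0 i))%:E.
Proof.
elim: d a b => [|d IH] a b ab /=.
  rewrite big_ord0 diracE mem_set//; by case.
rewrite /pushforward /product_measure1.
pose a' := \row_(i < d) a 0 (lift ord0 i); pose b' := \row_(i < d) b 0 (lift ord0 i).
transitivity (\int[@lebesgue_measure R]_x ((\prod_i (b' 0 i - a' 0 i))%:E * (\1_(`[a 0 0, b 0 0[%classic) x)%:E))%E.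
  apply: eq_integral => x _ /=.
  have [xab|xab] := boolP (x \in `[a 0 0, b 0 0[%classic).
    rewrite indicE xab mule1 -IH; last by move=> i; rewrite !mxE.
    congr (lebesgue_rV _); apply/seteqP; split => y /=.
      move/xsectionP => /= H i; have := H (lift ord0 i).
      rewrite !mxE; case: splitP => [j /= |j /= ij].
        by rewrite /bump /= ord1.
      by move: ij; rewrite /bump/= !add1n => -[] /val_inj ->.
    move=> H; apply/xsectionP => /= i; rewrite !mxE.
    case: splitP => j /= ij.
      have -> : i = ord0 by apply/val_inj; rewrite /= ij ord1.
      by move: xab; rewrite inE /= in_itv /= ord1 mxE eqxx mulr1n.
    have -> : i = lift ord0 j by apply/val_inj; rewrite /= ij.
    by have := H j; rewrite !mxE.
  rewrite indicE (negbTE xab) mule0 -[RHS](@lebesgue_rV0 R d).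
  congr (lebesgue_rV _); apply/seteqP; split => y //=.
  move/xsectionP => /= /(_ ord0); rewrite !mxE; case: splitP => // j _.
  rewrite ord1 mxE eqxx mulr1n => H; exfalso.
  by have : x \in `[a 0 0, b 0 0[%classic by [rewrite inE /= in_itv];
    rewrite (negbTE xab).
rewrite ge0_integralZl//=; first last.
- by rewrite lee_fin; apply: prodr_ge0 => i _; rewrite !mxE subr_ge0.
- by apply/measurable_EFinP; exact: measurable_indic.
rewrite integral_indic// setIT.
rewrite [X in (_ * X)%E](_ : _ = (b 0 0 - a 0 0)%:E); last first.
  have := lebesgue_measure_itv `[a 0 0, b 0 0[; rewrite /= lte_fin => ->.
  case: ltP => h; first by rewrite EFinB.
  have -> : b 0 0 = a 0 0 by apply/eqP; rewrite eq_le h ab.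
  by rewrite subrr.
rewrite -EFinM big_ord_recl mulrC; congr (_ * _)%:E.
by apply: eq_bigr => i _; rewrite !mxE.
Qed.

Definition cond_measure (T : Type) (R : realType) (mu : set T -> \bar R)
  (A B : set T) : \bar R := (mu (B `&` A) / mu A)%E.

Section locally_finite_measures.
Context (R : realType) (d : nat).

Record lf_measure := LFMeasure {
  lf_val :> {measure set 'rV[R]_d -> \bar R} ;
  lf_fin : forall B : set 'rV[R]_d, measurable B -> bounded_set B -> (lf_val B < +oo)%E }.

Let mzero_lf : lf_measure.
Proof.
by exists (mzero : {measure set 'rV[R]_d -> \bar R}) => B _ _; rewrite /= ltry.
Qed.

HB.instance Definition _ := gen_eqMixin lf_measure.
HB.instance Definition _ := gen_choiceMixin lf_measure.
HB.instance Definition _ := isPointed.Build lf_measure mzero_lf.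

(* Generated by the evaluations xi |-> xi B, B Borel. *)
Definition lf_sigma_algebra : set_system lf_measure :=
  <<s \bigcup_(B in measurable)
        preimage_set_system setT (fun xi : lf_measure => xi B)
          (measurable : set (set \bar R)) >>.

Let lf_sigma_algebra0 : lf_sigma_algebra set0.
Proof. exact: sigma_algebra0. Qed.

Let lf_sigma_algebraC A : lf_sigma_algebra A -> lf_sigma_algebra (~` A).
Proof. exact: sigma_algebraC. Qed.

Let lf_sigma_algebra_bigcup (F : (set lf_measure)^nat) :
  (forall i, lf_sigma_algebra (F i)) -> lf_sigma_algebra (\bigcup_i F i).
Proof. exact: sigma_algebra_bigcup. Qed.

Definition lf_display : measure_display. Proof. by constructor. Qed.

HB.instance Definition _ := @isMeasurable.Build lf_display lf_measure
  lf_sigma_algebra lf_sigma_algebra0 lf_sigma_algebraC lf_sigma_algebra_bigcup.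

(* (theta_t xi) B = xi (B + t): x lies in B + t iff x - t lies in B. *)
Section shift.
Variables (t : 'rV[R]_d) (xi : lf_measure).

Let shifted : {measure set 'rV[R]_d -> \bar R}.
Proof.
by refine (pushforward xi (fun x => x - t)); exact: mx_subr_measurable.
Defined.

Let shifted_fin (B : set 'rV[R]_d) : measurable B -> bounded_set B -> (shifted B < +oo)%E.
Proof.
move=> mB [M [Mreal BM]]; apply: lf_fin.
  by rewrite -[X in measurable X]setTI; exact: mx_subr_measurable.
exists (M + 1 + `|t|); split; first exact: num_real.
move=> N MN x /= Bxt; rewrite -(subrK t x).
apply: le_trans (ler_normD _ _) _.
apply: le_trans (ltW MN); rewrite lerD2r.
by apply: BM Bxt; rewrite ltrDl.
Qed.

Definition lf_shift : lf_measure := @LFMeasure shifted shifted_fin.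

End shift.

Lemma lf_shiftE t (xi : lf_measure) (B : set 'rV[R]_d) :
  lf_shift t xi B = xi [set x | B (x - t)].
Proof. by []. Qed.

Definition msupport (xi : lf_measure) : set 'rV[R]_d :=
  [set x | forall U, open U -> U x -> (0 < xi U)%E].

Definition diffuse (xi : lf_measure) : Prop := forall t, xi [set t] = 0%E.

End locally_finite_measures.

Definition eq_dist d (O : measurableType d) (R : realType)
  (P : set O -> \bar R) d' (T : measurableType d') (Z W : O -> T) : Prop :=
  forall A, measurable A -> pushforward P Z A = pushforward P W A.

(* K is a version of the conditional distribution of W given Z under P. *)
Definition cond_dist d (O : measurableType d) (R : realType)
  (P : set O -> \bar R) d1 (T1 : measurableType d1) d2 (T2 : measurableType d2)
  (Z : O -> T1) (W : O -> T2) (K : T1 -> set T2 -> \bar R) : Prop :=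
  forall A B, measurable A -> measurable B ->
    P (Z @^-1` A `&` W @^-1` B) = (\int[P]_(w in Z @^-1` A) K (Z w) B)%E.

(* The joint distribution of Y and Z under P is Q \x (distribution of Z); P may
   be infinite, in which case Q is not pushforward P Y. *)
Definition independent_with_law d (O : measurableType d) (R : realType)
  (P : set O -> \bar R) d1 (T1 : measurableType d1) d2 (T2 : measurableType d2)
  (Y : O -> T1) (Z : O -> T2) (Q : set T1 -> \bar R) : Prop :=
  forall A, measurable A ->
    pushforward P (fun w => (Y w, Z w)) A = (Q \x pushforward P Z)%E A.

(* Random elements on O are read on the extension O' through composition
   with p. *)
Definition extension d (O : measurableType d) d' (O' : measurableType d')
  (R : realType) (P : set O -> \bar R) (P' : set O' -> \bar R) (p : O' -> O) :
  Prop :=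
  measurable_fun setT p /\ forall A, measurable A -> pushforward P' p A = P A.

Definition measurable_action (R : realType) (d : nat) dE (E : measurableType dE)
  (theta : 'rV[R]_d -> E -> E) : Prop :=
  [/\ forall x, theta 0 x = x,
      forall s t x, theta (s + t) x = theta s (theta t x) &
      measurable_fun [set: 'rV[R]_d * E] (fun z => theta z.1 z.2)].

Section invariance.
Context (R : realType) (d : nat) dO (O : measurableType dO)
  (P : {measure set O -> \bar R}) dE (E : measurableType dE)
  (theta : 'rV[R]_d -> E -> E) (X : O -> E) (xi : O -> lf_measure R d).

(* (U_C, V_C) lives on an extension of the space; its joint distribution with
   (X, xi) does not depend on the extension, so all of them are allowed. *)
Definition mass_stationary : Prop :=
  forall C : set 'rV[R]_d, measurable C -> bounded_set C ->
    (0 < lebesgue_rV C)%E -> lebesgue_rV (closure C `\` interior C) = 0%E ->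
  forall dO' (O' : measurableType dO') (P' : {measure set O' -> \bar R})
    (p : O' -> O) (U V : O' -> 'rV[R]_d),
    extension P P' p -> measurable_fun setT U -> measurable_fun setT V ->
    cond_dist P' (fun w => (X (p w), xi (p w))) U
      (fun=> cond_measure (@lebesgue_rV R d) C) ->
    cond_dist P' (fun w => (X (p w), xi (p w), U w)) V
      (fun z => cond_measure z.1.2 [set y - z.2 | y in C]) ->
    eq_dist P'
      (fun w => (theta (V w) (X (p w)), lf_shift (V w) (xi (p w)), V w + U w))
      (fun w => (X (p w), xi (p w), U w)).

Definition stationary_independent_background dO' (O' : measurableType dO')
  (P' : set O' -> \bar R) (p : O' -> O) dS (S : measurableType dS)
  (thetaS : 'rV[R]_d -> S -> S) (Y : O' -> S) : Prop :=
  [/\ extension P P' p, measurable_action thetaS, measurable_fun setT Y &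
      exists Q : probability S R,
        (forall t A, measurable A -> Q (thetaS t @^-1` A) = Q A) /\
        independent_with_law P' Y (fun w => (X (p w), xi (p w))) Q].

Definition preserving dS (S : measurableType dS)
  (thetaS : 'rV[R]_d -> S -> S) (pi : S * lf_measure R d -> 'rV[R]_d)
  (y : S) (m : lf_measure R d) : Prop :=
  let tau s := s + pi (thetaS s y, lf_shift s m) in
  forall B, measurable B -> m (tau @^-1` B) = m B.

Definition invariant_under_preserving_shifts : Prop :=
  forall dO' (O' : measurableType dO') (P' : {measure set O' -> \bar R})
    (p : O' -> O) dS (S : measurableType dS) (thetaS : 'rV[R]_d -> S -> S)
    (Y : O' -> S) (pi : S * lf_measure R d -> 'rV[R]_d),
    stationary_independent_background P' p thetaS Y ->
    measurable_fun setT pi ->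
    (forall w, preserving thetaS pi (Y w) (xi (p w))) ->
    let t w := pi (Y w, xi (p w)) in
    eq_dist P'
      (fun w => (thetaS (t w) (Y w), theta (t w) (X (p w)),
                 lf_shift (t w) (xi (p w))))
      (fun w => (Y w, X (p w), xi (p w))).

End invariance.

Section box_shift.
Context (R : realType) (d : nat).

(* [0, n)^d *)
Definition box (n : nat) : set 'rV[R]_d :=
  [set x | forall i, 0 <= x 0 i < n%:R].

Definition borel_isomorphism d1 (T1 : measurableType d1) d2
  (T2 : measurableType d2) (A : set T1) (B : set T2) (f : T1 -> T2)
  (g : T2 -> T1) : Prop :=
  [/\ {homo f : x / A x >-> B x}, {homo g : y / B y >-> A y},
      forall x, A x -> g (f x) = x, forall y, B y -> f (g y) = y &
      measurable_fun A f /\ measurable_fun B g].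

Definition cdf_along (n : nat) (phi : 'rV[R]_d -> R)
  (mu : set 'rV[R]_d -> \bar R) (x : R) : R :=
  fine (mu (box n `&` [set y | phi y <= x])).

(* Generalized inverse on [0, 1) of a distribution function F on [0, 1):
   right-continuous if rc, left-continuous otherwise. *)
Definition gen_inverse (rc : bool) (F : R -> R) (u : R) : R :=
  inf [set x | 0 <= x < 1 /\ (if rc then u < F x else u <= F x)].

Definition mod1 (x : R) : R := x - (Num.floor x)%:~R.

Definition psi (n : nat) (phi : 'rV[R]_d -> R) (phi_inv : R -> 'rV[R]_d)
  (rc : bool) (r : R) (mu : set 'rV[R]_d -> \bar R) (x : 'rV[R]_d) : 'rV[R]_d :=
  let F := cdf_along n phi mu in
  phi_inv (gen_inverse rc F (mod1 (F (phi x) + r))).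

(* Fields (Y_s)_{s in R^d}, with the product (cylinder) sigma-algebra. *)
Definition field_cylinders : set_system ('rV[R]_d -> 'rV[R]_d) :=
  \bigcup_(s in setT)
    preimage_set_system setT (fun y : 'rV[R]_d -> 'rV[R]_d => y s) measurable.

Definition random_field := g_sigma_algebraType field_cylinders.

Definition field_shift (t : 'rV[R]_d) (y : random_field) : random_field :=
  fun s => y (t + s).

(* y_s is the vector to s from the lexicographically lowest corner k - y_0 of
   that box k - y_0 + [0, n)^d, k in nZ^d, in which s lies. *)
Definition box_field (n : nat) (y : random_field) : Prop :=
  forall s, exists k : 'I_d -> int,
    let corner := (\row_i (n%:Z * k i)%:~R) - y 0 in
    box n (s - corner) /\ y s = s - corner.

Definition box_shift (n : nat) (phi : 'rV[R]_d -> R) (phi_inv : R -> 'rV[R]_d)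
  (rc : bool) (r : R) (y : random_field) (m : lf_measure R d) : 'rV[R]_d :=
  let m' := lf_shift (- y 0) m in
  if m' (box n) == 0%E then 0
  else psi n phi phi_inv rc r (cond_measure m' (box n)) (y 0) - y 0.

Definition box_background (n : nat) dO (O : measurableType dO)
  (P : {measure set O -> \bar R}) dE (E : measurableType dE) (X : O -> E)
  (xi : O -> lf_measure R d) dO' (O' : measurableType dO')
  (P' : set O' -> \bar R) (p : O' -> O) (Y : O' -> random_field) : Prop :=
  [/\ extension P P' p, measurable_fun setT Y, forall w, box_field n (Y w) &
      independent_with_law P' (fun w => Y w 0) (fun w => (X (p w), xi (p w)))
        (cond_measure (@lebesgue_rV R d) (box n))].

Definition box_shift_invariant (n : nat) (phi : 'rV[R]_d -> R)
  (phi_inv : R -> 'rV[R]_d) (rc : bool) (r : R) dO (O : measurableType dO)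
  (P : {measure set O -> \bar R}) dE (E : measurableType dE)
  (theta : 'rV[R]_d -> E -> E) (X : O -> E) (xi : O -> lf_measure R d) : Prop :=
  forall dO' (O' : measurableType dO') (P' : {measure set O' -> \bar R})
    (p : O' -> O) (Y : O' -> random_field),
    box_background n P X xi P' p Y ->
    let t w := box_shift n phi phi_inv rc r (Y w) (xi (p w)) in
    eq_dist P'
      (fun w => (field_shift (t w) (Y w), theta (t w) (X (p w)),
                 lf_shift (t w) (xi (p w))))
      (fun w => (Y w, X (p w), xi (p w))).

End box_shift.

(* Main.v *)
(* The bridge between the two notions is an exchange formula for the law Q of
   z = (X, xi),
     \int Q(dz) \int xi_z(dt) f (theta_t z, - t) = \int Q(dz) \int xi_z(dt) f (z, t),
   here called [mecke]. It yields mass-stationarity for every window C by Fubini.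
   It passes to the product with a stationary independent background, and two
   applications of it, separated by the invariance of xi under tau, show that a
   preserving shift does not change Q on the sets where xi charges a fixed ball.

   Conversely, mass-stationarity for the window C says that resampling the
   location of the origin inside a uniformly placed copy of C, according to xi,
   preserves Q. Such a resampling is a conditional expectation, so it is
   self-adjoint, and for the boxes C = [0, n)^d this symmetry localizes to the
   exchange formula. For these boxes the resampling is obtained from the shifts
   pi_r^(n): when r is uniform on [0, 1), psi_r^mu sends every point to a point
   of law mu. *)
Require Import Defs.
From HB Require Import structures.
From mathcomp Require Import all_boot all_order all_algebra.
From mathcomp Require Import all_classical all_reals all_analysis.
From mathcomp Require Import measurable_realfun.
From mathcomp Require Import lra ring.

Set Implicit Arguments.
Unset Strict Implicit.
Unset Printing Implicit Defensive.

Import Order.TTheory GRing.Theory Num.Theory.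
Import numFieldNormedType.Exports.

Local Open Scope classical_set_scope.
Local Open Scope ring_scope.

(** The law [Q] of the pair (X, xi) is only sigma-finite, so conditional expectations are not taken
    as such: resampling is expressed by the unnormalised integral [window], and each step is an
    identity between integrals of nonnegative functions. The factor 1 / xi (C - u) is harmless
    because 0 lies in the support of xi and the boundary of C is null. Two mismatches shape the
    second half. A preserving shift must preserve xi at every value, while xi is diffuse only almost
    everywhere; the shift is therefore 0 on measures with atoms, and the set of diffuse measures
    must be shown measurable. The first equivalence supplies no Borel isomorphism; an injective code
    of the box with measurable left inverse is enough for the quantile shifts, and interleaved
    digits give one. The field Y^(n) is a function of its value at 0, on which shifts act as
    translations of a torus. This replaces a background of functions by one with values in R^d. *)

Section sigma_finite_pack.
Context dT (T : measurableType dT) (R : realType) (m : {measure set T -> \bar R}).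

(** The phantom argument lets a measure that is sigma-finite by hypothesis carry the canonical
    structure that Tonelli's theorem asks for. *)
Definition sf_measure of sigma_finite setT m : set T -> \bar R := m.

Variable sm : sigma_finite setT m.

HB.instance Definition _ := Measure.on (sf_measure sm).
HB.instance Definition _ := Measure_isSigmaFinite.Build _ _ _ (sf_measure sm) sm.

End sigma_finite_pack.

Lemma measurable_preim dT (T : measurableType dT) dU (U : measurableType dU)
  (f : T -> U) (A : set U) :
  measurable_fun setT f -> measurable A -> measurable (f @^-1` A).
Proof. by move=> mf mA; rewrite -[X in measurable X]setTI; exact: mf. Qed.

(** Countable additivity, with [I] enumerated by [pickle]. It is made for piecewise translations:
    the two sets are cut by different labels, and pieces with the same label are compared. *)
Lemma measure_eq_partition (R : realType) (I : countType) dT (T : measurableType dT)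
    dU (U : measurableType dU) (mu : {measure set T -> \bar R})
    (nu : {measure set U -> \bar R}) (f : T -> I) (g : U -> I) (A : set T) (B : set U) :
  (forall i, measurable (f @^-1` [set i])) -> (forall i, measurable (g @^-1` [set i])) ->
  measurable A -> measurable B ->
  (forall i, mu (A `&` f @^-1` [set i]) = nu (B `&` g @^-1` [set i])) -> mu A = nu B.
Proof.
have sum dV (V : measurableType dV) (m : {measure set V -> \bar R}) (h : V -> I) C :
    (forall i, measurable (h @^-1` [set i])) -> measurable C ->
    m C = (\sum_(0 <= n <oo | n \in [set: nat])
      if @pickle_inv I n is Some i then m (C `&` h @^-1` [set i]) else 0)%E.
  move=> mh mC.
  pose F n := if @pickle_inv I n is Some i then C `&` h @^-1` [set i] else set0.
  rewrite [in LHS](_ : C = \bigcup_n F n); last first.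
    apply/seteqP; split => [x Cx|x [n _]]; last by rewrite /F; case: pickle_inv => // i [].
    by exists (pickle (h x)) => //; rewrite /F pickleK_inv.
  rewrite measure_bigcup//.
  - by apply: eq_eseriesr => n _; rewrite /F; case: pickle_inv => //; rewrite measure0.
  - by move=> n _; rewrite /F; case: pickle_inv => // i; exact: measurableI.
  - apply/trivIsetP => i j _ _ ij; apply/seteqP; split => // x []; rewrite /F.
    case Ei : (pickle_inv i) => [k|//] [_ hk]; case Ej : (pickle_inv j) => [l|//] [_ hl].
    have := @pickle_invK I i; have := @pickle_invK I j; rewrite Ei Ej/= => jE iE.
    by move/eqP: ij; apply; rewrite -iE -jE -hk -hl.
move=> mf mg mA mB AB; rewrite (sum _ _ mu f)// (sum _ _ nu g)//.
by apply: eq_eseriesr => n _; case: pickle_inv.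
Qed.

Lemma xsection_set (T U : Type) (A : set (T * U)) x : xsection A x = [set y | A (x, y)].
Proof. by apply/funext => y; apply/propext; exact: xsectionP. Qed.

Section packed_pushforward.
Context (R : realType) dT (T : measurableType dT) dU (U : measurableType dU).
Variables (mu : {measure set T -> \bar R}) (f : T -> U) (mf : measurable_fun setT f).

(** Closed with [Defined], so that later steps can replace its values by measures of preimages by
    conversion. *)
Definition pushm : {measure set U -> \bar R}.
Proof. by refine (pushforward mu f); exact: mf. Defined.

Lemma pushmE A : pushm A = mu (f @^-1` A).
Proof. by []. Qed.

Lemma integral_pushm (g : U -> \bar R) : measurable_fun setT g -> (forall x, 0 <= g x)%E ->
  (\int[pushm]_x g x = \int[mu]_x g (f x))%E.
Proof. by move=> mg g0; exact: (ge0_integral_pushforward mf mu measurableT mg). Qed.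

End packed_pushforward.

Lemma measure0_bigcup_countable (R : realType) (I : countType) dT (T : measurableType dT)
    (mu : {measure set T -> \bar R}) (F : I -> set T) :
  (forall i, measurable (F i)) -> (forall i, mu (F i) = 0%E) -> mu (\bigcup_i F i) = 0%E.
Proof.
move=> mF F0; pose G n := if @pickle_inv I n is Some i then F i else set0.
have -> : \bigcup_i F i = \bigcup_n G n.
  apply/seteqP; split => x [i _ Fx].
    by exists (pickle i) => //; rewrite /G pickleK_inv.
  by move: Fx; rewrite /G; case: pickle_inv => // j Fj; exists j.
have mG n : measurable (G n) by rewrite /G; case: pickle_inv.
apply: measure_negligible; first exact: bigcup_measurable.
apply: negligible_bigcup => n; exists (G n); split => //.
by rewrite /G; case: pickle_inv => [i|]; rewrite ?F0 ?measure0.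
Qed.

Lemma measurable_invr (R : realType) : measurable_fun [set: R] (@GRing.inv R).
Proof.
rewrite -(setvU [set (0 : R)]); apply/measurable_funU => //; first exact: measurableC.
split; last exact: measurable_fun_set1.
apply: open_continuous_measurable_fun; first exact: closed_openC.
move=> x; rewrite inE => /eqP x0; exact: inv_continuous.
Qed.

(** * Lebesgue measure on R^d *)

Section rV_borel.
Context (R : realType).

Lemma measurable_open_rV d (U : set 'rV[R]_d) : open U -> measurable U.
Proof. by move=> oU; apply: sub_gen_smallest. Qed.

Lemma measurable_coord d (i : 'I_d) :
  measurable_fun [set: 'rV[R]_d] (fun x => x 0 i : R).
Proof.
apply: (measurability (@RGenOpens.G R)); first exact: RGenOpens.measurableE.
move=> _ [_ [a [b ->] <-]]; rewrite setTI; apply: measurable_open_rV.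
by apply: open_comp; [move=> x _; exact: coord_continuous|exact: interval_open].
Qed.

Definition cube d (q : 'rV[R]_d) (r : R) := [set x : 'rV[R]_d | forall i, `|x 0 i - q 0 i| < r].

Definition rat_cube d (p : 'rV[rat]_d * rat) := cube (map_mx ratr p.1) (ratr p.2).

(** The Borel sets of ['rV[R]_d] are generated by its topology; a countable base of cubes is what
    reduces measurability of vector-valued maps to coordinates. *)
Lemma open_rat_cubes d (U : set 'rV[R]_d) : open U ->
  U = \bigcup_(p in [set p | rat_cube p `<=` U]) rat_cube p.
Proof.
move=> oU; apply/seteqP; split => [x Ux|x [p /=]]; last exact.
have /nbhs_ballP[e /= e0 xeU] : nbhs x U by exact: open_nbhs_nbhs.
(* Below [e / 2]: [x] and any [y] of the cube are both within [r] of the centre, hence within [e] of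
   each other. *)
have [r] := rat_in_itvoo (divr_gt0 e0 (ltr0n R 2)); rewrite in_itv/= => /andP[r0 re].
have rat_near i : exists q : rat, `|x 0 i - ratr q| < ratr r.
  have /rat_in_itvoo[q] : x 0 i < x 0 i + ratr r by rewrite ltrDl.
  rewrite in_itv/= => /andP[xq qx]; exists q.
  by rewrite distrC ger0_norm ?subr_ge0 1?ltW// ltrBlDl.
have [q qE] := choice rat_near.
exists (\row_i q i, r) => /= [y yq|i]; last by rewrite !mxE.
apply: xeU; split => // i j; rewrite ord1.
have := yq j; have := qE j; rewrite !mxE distrC => h1 h2.
rewrite /ball/= distrC -(subrK (ratr (q j)) (y 0 j)) -addrA.
by rewrite (le_lt_trans (ler_normD _ _))// (splitr e) ltrD// (lt_trans _ re).
Qed.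

Lemma measurable_fun_rV dT (T : measurableType dT) d (D : set T) (f : T -> 'rV[R]_d) :
  (forall i, measurable_fun D (fun x => f x 0 i : R)) -> measurable_fun D f.
Proof.
move=> mf mD; apply: (measurability [set U : set 'rV[R]_d | open U]) => //=.
move=> _ [U oU <-]; rewrite (open_rat_cubes oU) preimage_bigcup setI_bigcupr.
rewrite bigcup_mkcond; apply: countable_bigcupT_measurable => // p.
case: ifPn => // _; pose q := map_mx (@ratr R) p.1.
rewrite (_ : _ `&` _ = D `\` \bigcup_(i in [set: 'I_d])
    (D `&` (fun x => f x 0 i : R) @^-1` [set z : R | ~~ (`|z - q 0 i| < ratr p.2)])); last first.
  apply/seteqP; split => x /= [Dx H]; split => //.
    by case=> i _ [_]; rewrite /= (H i).
  by move=> i; apply: contrapT => /negP xi; apply: H; exists i.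
apply: measurableD => //; apply: countable_bigcupT_measurable => // i.
apply: mf => //.
have -> : [set z : R | ~~ (`|z - q 0 i| < ratr p.2)] = ~` `](q 0 i - ratr p.2), (q 0 i + ratr p.2)[.
  by apply/seteqP; split => z /=; rewrite in_itv/= -ltr_distl => /negP.
exact: measurableC.
Qed.

Lemma measurable_fun_rVP dT (T : measurableType dT) d (D : set T) (f : T -> 'rV[R]_d) :
  measurable_fun D f <-> forall i, measurable_fun D (fun x => f x 0 i : R).
Proof.
split=> [mf i|]; last exact: measurable_fun_rV.
exact: (measurableT_comp (measurable_coord i) mf).
Qed.

Lemma measurable_funD_rV dT (T : measurableType dT) d (D : set T) (f g : T -> 'rV[R]_d) :
  measurable_fun D f -> measurable_fun D g -> measurable_fun D (fun x => f x + g x).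
Proof.
move=> /measurable_fun_rVP mf /measurable_fun_rVP mg; apply: measurable_fun_rV => i.
rewrite [X in measurable_fun _ X](_ : _ = (fun x => f x 0 i) \+ (fun x => g x 0 i)).
  exact: measurable_funD.
by apply/funext => x; rewrite mxE.
Qed.

Lemma measurable_funN_rV dT (T : measurableType dT) d (D : set T) (f : T -> 'rV[R]_d) :
  measurable_fun D f -> measurable_fun D (fun x => - f x).
Proof.
move=> /measurable_fun_rVP mf; apply: measurable_fun_rV => i.
rewrite [X in measurable_fun _ X](_ : _ = -%R \o (fun x => f x 0 i)).
  exact: measurableT_comp.
by apply/funext => x; rewrite mxE.
Qed.

Lemma measurable_funB_rV dT (T : measurableType dT) d (D : set T) (f g : T -> 'rV[R]_d) :
  measurable_fun D f -> measurable_fun D g -> measurable_fun D (fun x => f x - g x).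
Proof. by move=> mf mg; apply: measurable_funD_rV => //; exact: measurable_funN_rV. Qed.

Lemma measurable_row_mx d :
  measurable_fun [set: R * 'rV[R]_d] (fun p => row_mx p.1%:M p.2 : 'rV[R]_(1 + d)).
Proof.
apply: measurable_fun_rV => i; case: (split_ordP i) => j ->.
  rewrite [X in measurable_fun _ X](_ : _ = fst)//.
  by apply/funext => x; rewrite row_mxEl ord1 mxE eqxx mulr1n.
rewrite [X in measurable_fun _ X](_ : _ = (fun x : 'rV[R]_d => x 0 j) \o snd).
  by apply: measurableT_comp => //; exact: measurable_coord.
by apply/funext => x; rewrite row_mxEr.
Qed.

Lemma coord_le_norm d (x : 'rV[R]_d) i : `|x 0 i| <= `|x|.
Proof.
rewrite {2}/Num.norm/= mx_normrE.
exact: (le_bigmax _ (fun ij : 'I_1 * 'I_d => `|x ij.1 ij.2|) (0, i)).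
Qed.

Lemma bounded_setP d (B : set 'rV[R]_d) : bounded_set B <->
  exists2 K : R, 0 < K & forall x, B x -> forall i, `|x 0 i| <= K.
Proof.
split=> [[M [Mr BM]]|[K K0 BK]].
  exists (`|M| + 1); first by rewrite ltr_wpDl.
  move=> x Bx i; apply: le_trans (BM (`|M| + 1) _ x Bx); last first.
    by rewrite (le_lt_trans (ler_norm _))// ltrDl.
  exact: coord_le_norm.
exists K; split; first exact: num_real.
move=> L KL x Bx; rewrite /Num.norm/= mx_normrE.
apply: bigmax_le => [|[j i] _]/=; first by rewrite ltW// (lt_trans K0).
by rewrite ord1 (le_trans (BK _ Bx i))// ltW.
Qed.
End rV_borel.

Section lebesgue_rV_measure.
Context (R : realType).

Definition rv_box d (a b : 'rV[R]_d) := [set x : 'rV[R]_d | forall i, a 0 i <= x 0 i < b 0 i].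

Lemma measurable_rv_box d (a b : 'rV[R]_d) : measurable (rv_box a b).
Proof.
rewrite (_ : rv_box a b = ~` \bigcup_(i in [set: 'I_d])
    ((fun x : 'rV[R]_d => x 0 i : R) @^-1` (~` `[a 0 i, b 0 i[))).
  apply: measurableC; apply: countable_bigcupT_measurable => // i.
  rewrite -[X in measurable X]setTI; apply: measurable_coord => //.
  exact: measurableC.
apply/seteqP; split => x /= H.
  by case=> i _ /=; rewrite in_itv/= H.
by move=> i; apply: contrapT => xi; apply: H; exists i => //=; rewrite in_itv.
Qed.

Lemma bigcup_rv_box d : \bigcup_n rv_box (const_mx (- n%:R)) (const_mx n%:R) = [set: 'rV[R]_d].
Proof.
apply/seteqP; split=> // x _.
exists (Num.bound `|x|) => // i; rewrite !mxE.
have : `|x 0 i| < (Num.bound `|x|)%:R by rewrite (le_lt_trans (coord_le_norm x i))// archi_boundP.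
by rewrite ltr_norml => /andP[/ltW-> ->].
Qed.

Lemma bounded_rv_box d (a b : 'rV[R]_d) : bounded_set (rv_box a b).
Proof.
apply/bounded_setP; exists (1 + `|a| + `|b|); first by rewrite -addrA ltr_pwDl// addr_ge0.
move=> x xab i; have /andP[ax xb] := xab i.
have := normr_ge0 a; have := normr_ge0 b; have := coord_le_norm a i; have := coord_le_norm b i.
rewrite !ler_norml => /andP[_ bb] /andP[aa _] a0 b0; apply/andP; split; lra.
Qed.

(** [lebesgue_rV] is a bare set function, and the product in its recursion is a measure because the
    lower-dimensional factor is sigma-finite; the induction therefore carries both properties. *)
Lemma lebesgue_rV_existence d : exists M : {measure set 'rV[R]_d -> \bar R},
  sigma_finite setT M /\ (M : set _ -> _) = @lebesgue_rV R d.
Proof.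
elim: d => [|d [M [sM ME]]].
  exists (dirac (0 : 'rV[R]_0)); split => //; apply: fin_num_fun_sigma_finite => //.
  by rewrite measure0.
pose M' : {sigma_finite_measure set 'rV[R]_d -> \bar R} := sf_measure sM.
have M'E : (M' : set _ -> _) = @lebesgue_rV R d by rewrite -ME.
have : exists N : {measure set 'rV[R]_(1 + d) -> \bar R}, (N : set _ -> _) = @lebesgue_rV R d.+1.
  unshelve eexists (pushforward (@lebesgue_measure R \x M')%E
      (fun p : R * 'rV[R]_d => row_mx p.1%:M p.2 : 'rV[R]_(1 + d))).
    exact: measurable_row_mx.
  by rewrite /= -M'E.
case=> N NE; exists N; split => //.
exists (fun n => rv_box (const_mx (- n%:R)) (const_mx n%:R)); first by rewrite bigcup_rv_box.
move=> n; split; first exact: measurable_rv_box.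
rewrite NE /rv_box (@lebesgue_rV_box R d.+1); first by rewrite ltry.
by move=> i; rewrite !mxE (@le_trans _ _ 0)// oppr_le0.
Qed.
End lebesgue_rV_measure.

(** * Rotations of the line and translations of the torus *)

Section rotation.
Context (R : realType).
Implicit Types (c t x : R) (A : set R).

(** The residue of [x] modulo [c], in [[0, c)] when [c > 0]. *)
Definition fpart c x : R := x - c * (Num.floor (x / c))%:~R.

(* Rotation by t within each cell [kc, (k+1)c) of the line. *)
Definition rot c t x : R := c * (Num.floor (x / c))%:~R + fpart c (x + t).

Lemma measurable_floor : measurable_fun [set: R] (fun x => (Num.floor x)%:~R : R).
Proof. by apply: nondecreasing_measurable => // x y xy; rewrite ler_int le_floor. Qed.

Lemma measurable_floor_div c : measurable_fun [set: R] (fun x => (Num.floor (x / c))%:~R : R).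
Proof.
apply: (measurableT_comp measurable_floor).
by apply: measurable_funM => //; exact: measurable_id.
Qed.

Lemma measurable_fpart c : measurable_fun [set: R] (fpart c).
Proof.
apply: measurable_funB; first exact: measurable_id.
by apply: measurable_funM => //; exact: measurable_floor_div.
Qed.

Lemma fpart_itv c x : 0 < c -> 0 <= fpart c x < c.
Proof.
move=> c0; have /andP[] := floor_itv (x / c); rewrite intrD1 ler_pdivlMr// ltr_pdivrMr//.
by rewrite mulrDl mul1r /fpart subr_ge0 mulrC ltrBlDl => -> ->.
Qed.

Lemma fpart_id c x : 0 < c -> 0 <= x < c -> fpart c x = x.
Proof.
move=> c0 /andP[x0 xc]; rewrite /fpart (_ : Num.floor _ = 0) ?mulr0 ?subr0//.
by apply: floor_def; rewrite add0r divr_ge0 ?(ltW c0)//= ltr_pdivrMr ?mul1r.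
Qed.

Lemma fpart_period c x (k : int) : 0 < c -> fpart c (x + c * k%:~R) = fpart c x.
Proof.
move=> c0; rewrite /fpart mulrDl mulrAC divff ?gt_eqF// mul1r floorDrz ?intr_int//.
by rewrite intrKfloor intrD; ring.
Qed.

Lemma fpartD c x t : 0 < c -> fpart c (fpart c x + t) = fpart c (x + t).
Proof.
move=> c0; rewrite -(@fpart_period _ (x + t) (- Num.floor (x / c)))//.
by congr fpart; rewrite {1}/fpart intrN; ring.
Qed.

Lemma floor_rot c t x : 0 < c -> Num.floor (rot c t x / c) = Num.floor (x / c).
Proof.
move=> c0; apply: floor_def; have /andP[f0 fc] := fpart_itv (x + t) c0.
rewrite /rot intrD1 ler_pdivlMr// ltr_pdivrMr// mulrDl mul1r [_%:~R * c]mulrC.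
by rewrite lerDl f0 ltrD2l.
Qed.

Lemma fpart_rot c t x : 0 < c -> fpart c (rot c t x) = fpart c (x + t).
Proof. by move=> c0; rewrite {1}/fpart floor_rot// /rot addrC addKr. Qed.

Lemma rot_fpart c t x : rot c t x = x - fpart c x + fpart c (x + t).
Proof. by congr (_ + _); rewrite /fpart; ring. Qed.

Lemma rot0 c x : rot c 0 x = x.
Proof. by rewrite rot_fpart addr0 subrK. Qed.

Lemma rotD c s t x : 0 < c -> rot c (s + t) x = rot c s (rot c t x).
Proof.
move=> c0; rewrite {2}/rot floor_rot// -fpartD// fpart_rot// fpartD//.
by rewrite /rot; congr (_ + fpart c _); ring.
Qed.

Lemma measurable_rot2 c : measurable_fun [set: R * R] (fun z => rot c z.1 z.2).
Proof.
apply: measurable_funD.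
  apply: measurable_funM => //.
  exact: (measurableT_comp (measurable_floor_div c) measurable_snd).
apply: (measurableT_comp (measurable_fpart c)).
by apply: measurable_funD.
Qed.

Lemma measurable_rot c t : measurable_fun [set: R] (rot c t).
Proof.
exact: (measurableT_comp (measurable_rot2 c) (pair1_measurable t)).
Qed.

Lemma lebesgue_measureD t A : measurable A ->
  lebesgue_measure [set x | A (x + t)] = lebesgue_measure A.
Proof.
move=> mA; have mt : measurable_fun [set: R] (+%R^~ t).
  by apply: measurable_funD => //; exact: measurable_id.
apply/esym; rewrite -[RHS]/(pushforward lebesgue_measure (+%R^~ t : _ -> measurableTypeR R) A).
apply: lebesgue_measure_unique => //= _ [[a b]/= _ <-]; rewrite /pushforward.
rewrite (_ : _ @^-1` _ = `](a - t), (b - t)]%classic); last first.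
  by apply/seteqP; split => x /=; rewrite !in_itv/= ltrBlDr lerBrDr.
by rewrite !lebesgue_measure_itv/= !lte_fin ltrD2r -!EFinB opprB addrA subrK.
Qed.

(** Where the label [j t] is constant, [rot c t] is a translation, and on the image its inverse
    [rot c (- t)] has the opposite label. So the pieces of source and target match, and each keeps
    its length. *)
Lemma lebesgue_measure_rot c t A : 0 < c -> measurable A ->
  lebesgue_measure (rot c t @^-1` A) = lebesgue_measure A.
Proof.
move=> c0 mA.
(* The signed number of cell boundaries passed on the way from [x] to [x + t]. *)
pose j t (x : R) := Num.floor ((x + t) / c) - Num.floor (x / c).
have mj s i : measurable (j s @^-1` [set i]).
  have mf : measurable_fun [set: R] (fun x : R => (j s x)%:~R : R).
    under eq_fun do rewrite intrB.
    apply: measurable_funB; last exact: measurable_floor_div.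
    apply: (measurableT_comp (measurable_floor_div c)).
    by apply: measurable_funD => //; exact: measurable_id.
  rewrite (_ : _ @^-1` _ = (fun x : R => (j s x)%:~R : R) @^-1` [set i%:~R]).
    exact: measurable_preim.
  by apply/seteqP; split => x /= [] => [->//|/eqP]; rewrite eqr_int => /eqP.
have rE s x : rot c s x = x + (s - c * (j s x)%:~R).
  by rewrite /rot /fpart /j intrB; ring.
have jE s x : j (- s) (rot c s x) = - j s x.
  rewrite /j floor_rot// rE.
  rewrite (_ : (_ - s) / c = x / c + (- j s x)%:~R); last first.
    by rewrite intrN; field; rewrite gt_eqF.
  by rewrite floorDrz ?intr_int// intrKfloor /j; ring.
have rK x : rot c t (rot c (- t) x) = x by rewrite -rotD// subrr rot0.
have mjN i : measurable ((fun x => - j (- t) x) @^-1` [set i]).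
  rewrite (_ : _ @^-1` _ = j (- t) @^-1` [set - i])//.
  by apply/seteqP; split => x /= => [<-|->]; rewrite opprK.
apply: (@measure_eq_partition R int _ _ _ _ lebesgue_measure lebesgue_measure (j t)
  (fun x => - j (- t) x)) => //.
- exact: mj.
- exact: (measurable_preim (@measurable_rot c t) mA).
move=> i; rewrite -[RHS](@lebesgue_measureD (t - c * i%:~R)); last first.
  exact: measurableI.
congr lebesgue_measure; apply/seteqP; split => x /= [].
  by move=> + ji; rewrite rE ji => ?; split => //; rewrite -ji -rE jE opprK.
set y := x + _ => Ay ji.
have <- : rot c (- t) y = x.
  by rewrite rE -(opprK (j _ _)) ji /y intrN; ring.
by rewrite rK; split => //; rewrite -ji -jE opprK.
Qed.

End rotation.

Section lebesgue_rV_instance.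
Context (R : realType) (d : nat).

Let lebesgue_rV_ge0 A : (0 <= @lebesgue_rV R d A)%E.
Proof. by have [M [_ <-]] := lebesgue_rV_existence R d; exact: measure_ge0. Qed.

Let lebesgue_rV_sigma_additive : semi_sigma_additive (@lebesgue_rV R d).
Proof. by have [M [_ <-]] := lebesgue_rV_existence R d; exact: measure_semi_sigma_additive. Qed.

HB.instance Definition _ := isMeasure.Build _ _ _ (@lebesgue_rV R d)
  (@lebesgue_rV0 R d) lebesgue_rV_ge0 lebesgue_rV_sigma_additive.

Let lebesgue_rV_sigma_finite : sigma_finite setT (@lebesgue_rV R d).
Proof. by have [M [sM <-]] := lebesgue_rV_existence R d. Qed.

HB.instance Definition _ := Measure_isSigmaFinite.Build _ _ _ (@lebesgue_rV R d)
  lebesgue_rV_sigma_finite.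

End lebesgue_rV_instance.

Section lebesgue_rV_theory.
Context (R : realType).

Lemma lebesgue_rVS d (A : set 'rV[R]_(1 + d)) :
  (@lebesgue_rV R d.+1 A =
   \int[lebesgue_measure]_x @lebesgue_rV R d [set y | A (row_mx x%:M y)])%E.
Proof.
rewrite /= /pushforward /product_measure1; apply: eq_integral => x _.
by rewrite /= xsection_set.
Qed.

Lemma measurable_section_row_mx d (A : set 'rV[R]_(1 + d)) (x : R) : measurable A ->
  measurable [set y : 'rV[R]_d | A (row_mx x%:M y)].
Proof.
move=> mA; apply: (measurable_preim _ mA).
exact: (measurableT_comp (@measurable_row_mx R d) (pair1_measurable x)).
Qed.

Lemma measurable_lebesgue_section d (A : set 'rV[R]_(1 + d)) : measurable A ->
  measurable_fun [set: R] (fun x : R => @lebesgue_rV R d [set y | A (row_mx x%:M y)]).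
Proof.
move=> mA; have := @measurable_fun_xsection _ _ R _ R (@lebesgue_rV R d)
   _ (measurable_preim (@measurable_row_mx R d) mA).
congr (measurable_fun _); apply/funext => x /=.
by rewrite xsection_set.
Qed.

Lemma ge0_integral_preserving (f : R -> R) (g : R -> \bar R) :
  measurable_fun setT f ->
  (forall B : set R, measurable B -> lebesgue_measure (f @^-1` B) = lebesgue_measure B) ->
  measurable_fun setT g -> (forall x, 0 <= g x)%E ->
  (\int[lebesgue_measure]_x g (f x) = \int[lebesgue_measure]_x g x)%E.
Proof.
move=> mf fE mg g0.
rewrite -(@ge0_integral_pushforward _ _ (measurableTypeR R) (measurableTypeR R) R f mf
  lebesgue_measure setT)//.
by apply: eq_measure_integral => //= B mB _; exact: fE.
Qed.

(** Common source of translation and torus invariance. With the first coordinate peeled off, the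
    inner measure is unchanged by induction and the outer integral because [f ord0] preserves
    length. *)
Lemma lebesgue_rV_map d (f : 'I_d -> R -> R) (A : set 'rV[R]_d) :
  (forall i, measurable_fun setT (f i)) ->
  (forall i (B : set R), measurable B -> lebesgue_measure (f i @^-1` B) = lebesgue_measure B) ->
  measurable A ->
  lebesgue_rV [set x : 'rV[R]_d | A (\row_i f i (x 0 i))] = lebesgue_rV A.
Proof.
elim: d f A => [|d IH] f A mf fE mA.
  by congr lebesgue_rV; apply/seteqP; split => x /=; congr A; apply/rowP; case.
pose f' i := f (lift ord0 i).
have rowE x y : \row_i f i ((row_mx x%:M y : 'rV[R]_(1 + d)) 0 i) =
    row_mx (f ord0 x)%:M (\row_i f' i (y 0 i)) :> 'rV[R]_(1 + d).
  apply/rowP => i; rewrite mxE; case: (split_ordP i) => j ->.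
    by rewrite !row_mxEl !mxE ord1/= !mulr1n; congr f; apply/val_inj.
  by rewrite !row_mxEr mxE; congr f; apply/val_inj.
rewrite !(@lebesgue_rVS d).
transitivity (\int[lebesgue_measure]_x
    (fun x => @lebesgue_rV R d [set y | A (row_mx x%:M y)]) (f ord0 x))%E.
  apply: eq_integral => x _ /=.
  rewrite -[RHS](IH f' _ (fun i => mf _) (fun i => fE _) (measurable_section_row_mx (f ord0 x) mA)).
  by congr lebesgue_rV; apply/seteqP; split => y /=; rewrite rowE.
exact: (ge0_integral_preserving (mf ord0) (fE ord0) (measurable_lebesgue_section mA)).
Qed.

Lemma lebesgue_rVD d (t : 'rV[R]_d) (A : set 'rV[R]_d) : measurable A ->
  lebesgue_rV [set x | A (x + t)] = lebesgue_rV A.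
Proof.
move=> mA; rewrite -[RHS](@lebesgue_rV_map d (fun i x => x + t 0 i))//.
- congr lebesgue_rV; apply/seteqP; split => x /=; congr A; apply/rowP => i; by rewrite !mxE.
- by move=> i; apply: measurable_funD => //; exact: measurable_id.
- by move=> i B mB; rewrite -[RHS](lebesgue_measureD (t 0 i)).
Qed.

(** Translation by [t] modulo [c], performed inside each cell of the grid; on [box n] with [c = n]
    it is the usual action on the torus. *)
Definition torus (c : R) d (t x : 'rV[R]_d) : 'rV[R]_d := \row_i rot c (t 0 i) (x 0 i).

Lemma lebesgue_rV_torus d (c : R) (t : 'rV[R]_d) (A : set 'rV[R]_d) : 0 < c -> measurable A ->
  lebesgue_rV (torus c t @^-1` A) = lebesgue_rV A.
Proof.
move=> c0 mA; rewrite -[RHS](@lebesgue_rV_map d (fun i => rot c (t 0 i)))//.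
- by move=> i; exact: measurable_rot.
- by move=> i B mB; rewrite lebesgue_measure_rot.
Qed.

Lemma lebesgue_rV_hyperplane d (i : 'I_d) (c : R) :
  lebesgue_rV [set x : 'rV[R]_d | x 0 i = c] = 0%E.
Proof.
elim: d i => [[]//|d IH i]; rewrite (@lebesgue_rVS d).
case: (@split_ordP 1 d i) => j ->.
  have rowE x (y : 'rV[R]_d) : (row_mx x%:M y : 'rV[R]_(1 + d)) 0 (lshift d j) = x.
    by rewrite row_mxEl ord1 mxE mulr1n.
  transitivity (\int[@lebesgue_measure R]_x (lebesgue_rV [set: 'rV[R]_d] * (\1_[set c] x)%:E))%E.
    apply: eq_integral => x _; rewrite indicE; have [xc|xc] := boolP (x \in [set c]).
      rewrite mule1; congr lebesgue_rV; apply/seteqP; split => // y _.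
      by move: xc; rewrite inE /= rowE.
    rewrite mule0 -[RHS](@lebesgue_rV0 R d); congr lebesgue_rV; apply/seteqP; split => // y /=.
    by rewrite rowE => xE; move: xc; rewrite notin_setE/= xE.
  rewrite ge0_integralZl//; first by rewrite integral_indic// setIT [X in (_ * X)%E](lebesgue_measure_set1 c) mule0.
  by apply/measurable_EFinP; exact: measurable_indic.
have rowE x (y : 'rV[R]_d) : (row_mx x%:M y : 'rV[R]_(1 + d)) 0 (rshift 1 j) = y 0 j.
  by rewrite row_mxEr.
apply: integral0_eq => x _; rewrite -[RHS](IH j); congr lebesgue_rV.
by apply/seteqP; split => y /=; rewrite rowE.
Qed.

Lemma lebesgue_rV_bounded d (B : set 'rV[R]_d) : measurable B -> bounded_set B ->
  (lebesgue_rV B < +oo)%E.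
Proof.
move=> mB /bounded_setP[K K0 BK].
apply: (@le_lt_trans _ _ (lebesgue_rV (rv_box (const_mx (- K)) (const_mx (K + 1)) : set 'rV[R]_d))).
  apply: le_measure; rewrite ?inE//; first exact: measurable_rv_box.
  move=> x /BK xK i; rewrite !mxE; have := xK i; rewrite ler_norml => /andP[-> h]/=.
  by rewrite (le_lt_trans h)// ltrDl.
rewrite lebesgue_rV_box ?ltry// => i; rewrite !mxE.
by rewrite (@le_trans _ _ 0)// ?oppr_le0 ?addr_ge0// ltW.
Qed.

End lebesgue_rV_theory.

Section boxes.
Context (R : realType) (d : nat).

Lemma box_rv_box n : @box R d n = rv_box 0 (const_mx n%:R).
Proof. by apply/seteqP; split => x xn i; have := xn i; rewrite !mxE. Qed.

Lemma measurable_box n : measurable (@box R d n).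
Proof. by rewrite box_rv_box; exact: measurable_rv_box. Qed.

Lemma bounded_box n : bounded_set (@box R d n).
Proof. by rewrite box_rv_box; exact: bounded_rv_box. Qed.

Lemma lebesgue_box_gt0 n : (0 < n)%N -> (0 < lebesgue_rV (@box R d n))%E.
Proof.
move=> n0; rewrite box_rv_box lebesgue_rV_box; last by move=> i; rewrite !mxE.
by rewrite lte_fin; apply: prodr_gt0 => i _; rewrite !mxE subr0 ltr0n.
Qed.

(** The closure lies in the closed box, and a point of the closed box off the faces [x 0 i = 0] and
    [x 0 i = n] is interior. The faces lie in null hyperplanes. *)
Lemma lebesgue_box_boundary n :
  lebesgue_rV (closure (@box R d n) `\` interior (@box R d n)) = 0%E.
Proof.
pose H i (c : R) := [set x : 'rV[R]_d | x 0 i = c].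
have mH i c : measurable (H i c).
  rewrite (_ : H i c = (fun x : 'rV[R]_d => x 0 i : R) @^-1` [set c])//.
  by apply: measurable_preim => //; exact: measurable_coord.
pose N := \bigcup_(i in [set: 'I_d]) (H i 0 `|` H i n%:R).
have mN : measurable N.
  by apply: countable_bigcupT_measurable => // i; exact: measurableU.
have N0 : lebesgue_rV N = 0%E.
  apply: measure0_bigcup_countable => i; first exact: measurableU.
  by rewrite measureU0 ?lebesgue_rV_hyperplane//; exact: lebesgue_rV_hyperplane.
apply: (subset_measure0 _ mN _ N0).
  apply: measurableD; last by apply: measurable_open_rV; exact: open_interior.
  rewrite -[X in measurable X]setCK; apply: measurableC; apply: measurable_open_rV.
  exact/closed_openC/closed_closure.
move=> x [cx ix].
have cxi i : 0 <= x 0 i <= n%:R.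
  have : closed ((fun x : 'rV[R]_d => x 0 i) @^-1` `[0, n%:R]%classic).
    by apply: closed_comp; [move=> y _; exact: coord_continuous|exact: interval_closed].
  move/closure_id => cE; have : closure ((fun x : 'rV[R]_d => x 0 i) @^-1` `[0, n%:R]%classic) x.
    apply: closure_subset cx => y /(_ i) /andP[y0 yn]; rewrite /= in_itv/= y0/=.
    exact: ltW.
  by rewrite -cE /= in_itv.
apply: contrapT => Nx; apply: ix.
pose I i := (fun x : 'rV[R]_d => x 0 i) @^-1` `]0, n%:R[%classic.
have xI i : I i x.
  rewrite /I/= in_itv/=; have /andP[x0 xn] := cxi i; rewrite !lt_neqAle x0 xn !andbT.
  apply/andP; split; apply/eqP => xE; apply: Nx; exists i => //; [left|right] => //.
(* The distance to the nearest face; the default 1 keeps it positive when there is no coordinate. *)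
pose e := \big[Num.min/1]_i Num.min (x 0 i) (n%:R - x 0 i).
have e0 : 0 < e.
  apply/bigmin_gtP; split => // i _; rewrite lt_min subr_gt0.
  by have := xI i; rewrite /I/= in_itv.
apply/nbhs_ballP; exists e => //= y [_ xy] i; have := xy 0 i.
have : e <= Num.min (x 0 i) (n%:R - x 0 i) by exact: bigmin_le_cond.
rewrite le_min /ball/= => /andP[ex exn]; rewrite ltr_distlC => /andP[h1 h2].
by apply/andP; split; lra.
Qed.

End boxes.

Lemma integral_lebesgue_rVD (R : realType) d (t : 'rV[R]_d) (f : 'rV[R]_d -> \bar R) :
  measurable_fun setT f -> (forall x, 0 <= f x)%E ->
  (\int[@lebesgue_rV R d]_x f (x + t)%R = \int[@lebesgue_rV R d]_x f x)%E.
Proof.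
move=> mf f0; have mt : measurable_fun [set: 'rV[R]_d] (fun x => x + t).
  by apply: measurable_funD_rV => //; exact: measurable_id.
transitivity (\int[pushm (@lebesgue_rV R d) mt]_x f x)%E; first by rewrite integral_pushm.
by apply: eq_measure_integral => A mA _; exact: lebesgue_rVD.
Qed.

Section symmetric_box.
Context (R : realType) (d : nat).

(** Intersecting a half-open box with its reflection makes it invariant under [v -> - v], the map
    that the exchange formula applies to locations. *)
Definition sbox n : set 'rV[R]_d :=
  [set v | rv_box (const_mx (- n%:R)) (const_mx n%:R) v /\
           rv_box (const_mx (- n%:R)) (const_mx n%:R) (- v)].

Lemma measurable_sbox n : measurable (sbox n).
Proof.
have mN : measurable_fun [set: 'rV[R]_d] (fun v => - v).
  by apply: measurable_funN_rV; exact: measurable_id.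
apply: measurableI; first exact: measurable_rv_box.
exact: (measurable_preim mN (measurable_rv_box _ _)).
Qed.

Lemma bounded_sbox n : bounded_set (sbox n).
Proof.
have /bounded_setP[K K0 bK] := @bounded_rv_box R d (const_mx (- n%:R)) (const_mx n%:R).
by apply/bounded_setP; exists K => // v [/bK].
Qed.

Lemma subset_sbox a b : (a <= b)%N -> sbox a `<=` sbox b.
Proof.
have sub w : (a <= b)%N -> rv_box (const_mx (- a%:R)) (const_mx a%:R) w ->
    rv_box (const_mx (- b%:R)) (const_mx b%:R) (w : 'rV[R]_d).
  move=> ab aw i; have /andP[h1 h2] := aw i; move: h1 h2; rewrite !mxE => h1 h2.
  by rewrite (le_trans _ h1) ?lerN2 ?ler_nat//= (lt_le_trans h2)// ler_nat.
by move=> ab v [h1 h2]; split; exact: sub.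
Qed.

Lemma bigcup_sbox : \bigcup_n sbox n = setT.
Proof.
apply/seteqP; split => // v _; exists (Num.bound `|v|).+1 => //.
have vb i : `|v 0 i| < (Num.bound `|v|).+1%:R.
  rewrite (le_lt_trans (coord_le_norm v i))// (lt_le_trans (archi_boundP _))// ler_nat//.
by split => i; rewrite !mxE; have := vb i; rewrite ltr_norml => /andP[h1 h2];
  apply/andP; split; lra.
Qed.

End symmetric_box.

(** * Kernels of locally finite measures *)

Section lf_measurability.
Context (R : realType) (d : nat).
Notation rV := 'rV[R]_d.
Notation lf := (lf_measure R d).

Lemma measurable_lf_eval (B : set rV) : measurable B ->
  measurable_fun setT (fun xi : lf => xi B).
Proof.
move=> mB _ Y mY; rewrite setTI; apply: sub_gen_smallest; exists B => //.
by exists Y => //; rewrite setTI.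
Qed.

Lemma measurable_fun_lf dT (T : measurableType dT) (f : T -> lf) :
  (forall B, measurable B -> measurable_fun setT (fun x => f x B)) ->
  measurable_fun setT f.
Proof.
move=> mf; apply: (measurability (\bigcup_(B in measurable)
  preimage_set_system setT (fun xi : lf => xi B) (measurable : set (set \bar R)))) => //.
move=> _ [_ [B mB [Y mY <-]] <-]; rewrite !setTI -comp_preimage.
by have := mf B mB measurableT Y mY; rewrite setTI.
Qed.

Section kernel_of_lf.
Context dT (T : measurableType dT) (k : T -> lf).

Definition lf_kernel of measurable_fun setT k : T -> {measure set rV -> \bar R} :=
  fun x => k x.

Hypothesis mk : measurable_fun setT k.

Let lf_kernel_measurable U : measurable U ->
  measurable_fun [set: T] ((lf_kernel mk) ^~ U).
Proof. by move=> mU; exact: (measurableT_comp (measurable_lf_eval mU) mk). Qed.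

HB.instance Definition _ := isKernel.Build _ _ _ _ _ (lf_kernel mk) lf_kernel_measurable.

(** The section lemma for kernels asks for bounded masses, which a locally finite measure has on
    bounded sets only. It is applied to the restrictions to the boxes [K n], with a bound depending
    on [x], and followed by a monotone limit. *)
Lemma measurable_lf_xsection (A : set (T * rV)) : measurable A ->
  measurable_fun setT (fun x => k x (xsection A x)).
Proof.
move=> mA.
pose K n : set rV := rv_box (const_mx (- n%:R)) (const_mx n%:R).
have mK n : measurable (K n) by exact: measurable_rv_box.
pose f n x := mrestr (k x) (mK n) (xsection A x).
apply: (@emeasurable_fun_cvg _ _ _ _ f) => [n|x _].
  have kK x : exists M : R, forall U, measurable U -> (mrestr (lf_kernel mk x) (mK n) U < M%:E)%E.
    exists (fine (k x (K n)) + 1) => U mU.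
    have Kfin : (k x (K n) < +oo)%E by apply: lf_fin => //; exact: bounded_rv_box.
    rewrite (@le_lt_trans _ _ (k x (K n)))//.
      by rewrite /mrestr/= le_measure// ?inE//; exact: measurableI.
    by rewrite EFinD fineK ?ge0_fin_numE// lteDl// ge0_fin_numE.
  by have [_] := measurable_prod_subset_xsection_kernel kK mA.
have mxA : measurable (xsection A x) by exact: measurable_xsection.
rewrite (_ : k x (xsection A x) = k x (\bigcup_n (xsection A x `&` K n))); last first.
  by rewrite -setI_bigcupr bigcup_rv_box setIT.
apply: nondecreasing_cvg_mu.
- by move=> n; exact: measurableI.
- by apply: bigcup_measurable => n _; exact: measurableI.
- move=> m n mn; apply/subsetPset; apply: setIS => y yK i; have := yK i; rewrite !mxE.
  move=> /andP[h1 h2]; rewrite (le_trans _ h1) ?lerN2 ?ler_nat//.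
  by rewrite (lt_le_trans h2)// ler_nat.
Qed.

Import HBNNSimple.

Lemma measurable_lf_integral (f : T * rV -> \bar R) : measurable_fun setT f ->
  (forall z, 0 <= f z)%E -> measurable_fun setT (fun x => \int[k x]_y f (x, y))%E.
Proof.
move=> mf f0; pose f_ := nnsfun_approx measurableT mf.
apply: (@measurable_fun_xsection_integral _ _ _ _ _ f (lf_kernel mk) f_).
- by move=> a b ab; exact/nd_nnsfun_approx.
- by move=> z; exact/cvg_nnsfun_approx.
- by move=> n r; exact: measurable_lf_xsection.
Qed.

End kernel_of_lf.

(** * Composition of a measure with a kernel *)

Section semidirect.
Context dT (T : measurableType dT) (Q : {measure set T -> \bar R}) (k : T -> lf).

(* The measure Q(dx) k(x, dy) on T * R^d. *)
Definition semi of measurable_fun setT k : set (T * rV) -> \bar R :=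
  fun A => (\int[Q]_x k x (xsection A x))%E.

Hypothesis mk : measurable_fun setT k.

Let semi0 : semi mk set0 = 0%E.
Proof. by rewrite /semi integral0_eq// => x _; rewrite xsection0. Qed.

Let semi_ge0 A : (0 <= semi mk A)%E.
Proof. by apply: integral_ge0 => x _; exact: measure_ge0. Qed.

Let semi_sigma_additive : semi_sigma_additive (semi mk).
Proof.
move=> F mF tF mUF; rewrite [X in _ --> X](_ : _ =
    (\sum_(n <oo) semi mk (F n))%E); last first.
  rewrite /semi -integral_nneseries//; last by move=> n; exact: measurable_lf_xsection.
  apply: eq_integral => x _; rewrite xsection_bigcup measure_bigcup//.
  - by apply: eq_eseriesl => n; rewrite in_setT.
  - by move=> n _; exact: measurable_xsection.
  - exact: trivIset_xsection.
by apply/cvg_closeP; split; [apply: is_cvg_nneseries|rewrite closeE].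
Qed.

HB.instance Definition _ := isMeasure.Build _ _ _ (semi mk) semi0 semi_ge0 semi_sigma_additive.

Lemma semi_setX (A : set T) (B : set rV) :
  semi mk (A `*` B) = (\int[Q]_(x in A) k x B)%E.
Proof.
rewrite [RHS]integral_mkcond; apply: eq_integral => x _; rewrite patchE.
have [xA|xA] := boolP (x \in A); first by rewrite in_xsectionX.
by rewrite notin_xsectionX// measure0.
Qed.

Import HBNNSimple.

(** By definition for indicators, by linearity for simple functions ([sfunE]), then by monotone
    convergence at each of the integration levels. *)
Lemma integral_semi (f : T * rV -> \bar R) : measurable_fun setT f ->
  (forall z, 0 <= f z)%E ->
  (\int[semi mk]_z f z = \int[Q]_x \int[k x]_y f (x, y))%E.
Proof.
move=> mf f0; pose f_ := nnsfun_approx measurableT mf.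
have sfunE (g : {nnsfun T * rV >-> R}) :
    (\int[semi mk]_z (g z)%:E = \int[Q]_x \int[k x]_y (g (x, y))%:E)%E.
  have mgr r : measurable (g @^-1` [set r]) by [].
  transitivity (\sum_(r \in range g) r%:E * semi mk (g @^-1` [set r]))%E.
    by rewrite integralT_nnsfun sintegralE.
  transitivity (\int[Q]_x \sum_(r \in range g) r%:E * k x (xsection (g @^-1` [set r]) x))%E.
    rewrite ge0_integral_fsum//.
    - apply: eq_fsbigr => r _; have [r0|r0] := leP 0 r.
        by rewrite ge0_integralZl//; exact: measurable_lf_xsection.
      rewrite preimage_nnfun0// measure0 mule0 integral0_eq// => x _.
      by rewrite xsection0 measure0 mule0.
    - by move=> r; apply: measurable_funeM; exact: measurable_lf_xsection.
    - move=> r x _; have [r0|r0] := leP 0 r; first by rewrite mule_ge0.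
      by rewrite preimage_nnfun0// xsection0 measure0 mule0.
  apply: eq_integral => x _.
  rewrite [RHS](eq_integral (fun y => \sum_(r \in range g) (r * \1_(g @^-1` [set r]) (x, y))%:E)%E); last first.
    by move=> y _; rewrite fsumEFin// -fimfunE.
  rewrite ge0_integral_fsum//.
  - apply: eq_fsbigr => r _.
    rewrite (eq_integral (fun y => (r * \1_(xsection (g @^-1` [set r]) x) y)%:E)); last first.
      by move=> y _; rewrite !indicE mem_xsection.
    rewrite (integralZl_indic _ (fun r => xsection (g @^-1` [set r]) x))//.
      by rewrite integral_indic ?setIT//; exact: measurable_xsection.
      by move=> r0; rewrite preimage_nnfun0// xsection0.
    exact: measurable_xsection.
  - move=> r; apply/measurable_EFinP; apply: measurable_funM => //.
    exact: (measurableT_comp (measurable_indic (mgr r)) (pair1_measurable x)).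
  - by move=> r y _; rewrite nnfun_muleindic_ge0.
transitivity (\int[semi mk]_z (lim ((f_ n z)%:E @[n --> \oo])))%E.
  by apply/eq_integral => z _; apply/esym/cvg_lim => //=; exact: cvg_nnsfun_approx.
have mf_ n x : measurable_fun setT (fun y => (f_ n (x, y))%:E).
  exact/measurable_EFinP/measurableT_comp.
have nd_ x y a b : (a <= b)%N -> ((f_ a (x, y))%:E <= (f_ b (x, y))%:E)%E.
  by move=> ab; rewrite lee_fin; exact/lefP/nd_nnsfun_approx.
rewrite monotone_convergence//; last 3 first.
- by move=> n; exact/measurable_EFinP.
- by move=> n z _; rewrite lee_fin.
- by move=> [x y] _ a b; exact: nd_.
under eq_fun do rewrite sfunE.
rewrite -monotone_convergence//; last 3 first.
- by move=> n; apply: (@measurable_lf_integral _ _ _ mk (EFin \o f_ n)) => [|z]; [exact/measurable_EFinP|rewrite lee_fin].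
- by move=> n x _; apply: integral_ge0 => y _; rewrite lee_fin.
- move=> x _ a b ab; apply: ge0_le_integral => //.
  + by move=> y _; rewrite lee_fin.
  + by move=> y _; exact: nd_.
apply: eq_integral => x _; rewrite -monotone_convergence//; last 2 first.
- by move=> n y _; rewrite lee_fin.
- by move=> y _ a b; exact: nd_.
by apply: eq_integral => y _; apply/cvg_lim => //; exact: cvg_nnsfun_approx.
Qed.

End semidirect.
End lf_measurability.

Section lf_operations.
Context (R : realType) (d : nat).
Notation rV := 'rV[R]_d.
Notation lf := (lf_measure R d).
Implicit Types (xi eta : lf) (s t : rV).

Lemma lf_ext xi eta : (forall B, xi B = eta B) -> xi = eta.
Proof.
case: xi eta => [m mfin] [m' m'fin] /= mm'.
have mE : m = m' by apply: eq_measure; apply/funext.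
by move: m'fin; rewrite -mE => m'fin; congr LFMeasure; exact: Prop_irrelevance.
Qed.

Lemma lf_shift0 xi : lf_shift 0 xi = xi.
Proof.
apply: lf_ext => B; rewrite lf_shiftE; congr (lf_val xi _).
by apply/seteqP; split => x /=; rewrite subr0.
Qed.

Lemma lf_shiftD s t xi : lf_shift (s + t) xi = lf_shift s (lf_shift t xi).
Proof.
apply: lf_ext => B; rewrite !lf_shiftE; congr (lf_val xi _).
by apply/seteqP; split => x /=; rewrite opprD addrCA addrC.
Qed.

Lemma measurable_lf_shift dT (T : measurableType dT) (f : T -> rV) (k : T -> lf) :
  measurable_fun setT f -> measurable_fun setT k ->
  measurable_fun setT (fun x => lf_shift (f x) (k x)).
Proof.
move=> mf mk; apply: measurable_fun_lf => B mB.
pose A := (fun z : T * rV => z.2 - f z.1) @^-1` B.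
have mA : measurable A.
  apply: (measurable_preim _ mB); apply: measurable_funB_rV => //.
  exact: (measurableT_comp mf measurable_fst).
have := measurable_lf_xsection mk mA; congr (measurable_fun _).
by apply/funext => x; rewrite xsection_set.
Qed.

Lemma measurable_lf_shift_action : measurable_action (@lf_shift R d).
Proof.
split; [exact: lf_shift0|exact: lf_shiftD|].
exact: measurable_lf_shift.
Qed.

Lemma integral_lf_shift t xi (f : rV -> \bar R) : measurable_fun setT f ->
  (forall x, 0 <= f x)%E -> (\int[lf_shift t xi]_x f x = \int[xi]_x f (x - t)%R)%E.
Proof.
move=> mf f0.
rewrite -(@ge0_integral_pushforward _ _ _ _ R _ (mx_subr_measurable t) xi setT)//.
Qed.

Lemma lf_sigma_finite xi : sigma_finite setT xi.
Proof.
exists (fun n => rv_box (const_mx (- n%:R)) (const_mx n%:R)); first by rewrite bigcup_rv_box.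
move=> n; split; first exact: measurable_rv_box.
by apply: lf_fin; [exact: measurable_rv_box|exact: bounded_rv_box].
Qed.

Lemma lf_fubini dT (T : measurableType dT) (nu : {measure set T -> \bar R}) xi
    (f : T * rV -> \bar R) : sigma_finite setT nu ->
  measurable_fun setT f -> (forall z, 0 <= f z)%E ->
  (\int[nu]_x \int[xi]_y f (x, y) = \int[xi]_y \int[nu]_x f (x, y))%E.
Proof.
move=> snu mf f0.
exact: (@fubini_tonelli _ _ _ _ _ (sf_measure snu) (sf_measure (lf_sigma_finite xi)) f).
Qed.

Definition lebesgue_lf : lf := LFMeasure (@lebesgue_rV_bounded R d).

Section restriction.
Variables (c : {nonneg R}) (xi : lf) (A : set rV).
Hypothesis mA : measurable A.

Let restr_fin (B : set rV) : measurable B -> bounded_set B ->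
  (mscale c (mrestr xi mA) B < +oo)%E.
Proof.
move=> mB bB; rewrite /mscale/= lte_mul_pinfty ?lee_fin// /mrestr.
rewrite (@le_lt_trans _ _ (xi B))//; last exact: lf_fin.
by rewrite le_measure// ?inE//; exact: measurableI.
Qed.

Definition lf_restr : lf := LFMeasure restr_fin.

Lemma lf_restrE B : lf_restr B = (c%:num%:E * xi (B `&` A))%E.
Proof. by []. Qed.

Lemma integral_lf_restr (f : rV -> \bar R) : measurable_fun setT f ->
  (forall x, 0 <= f x)%E ->
  (\int[lf_restr]_x f x = c%:num%:E * \int[xi]_(x in A) f x)%E.
Proof.
move=> mf f0; rewrite /= ge0_integral_mscale//; congr *%E.
rewrite -(setUv A) ge0_integral_setU//.
- rewrite [X in (_ + X)%E](_ : _ = 0%E); last first.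
    have A0 : mrestr xi mA (~` A) = 0%E by rewrite /mrestr setICl measure0.
    exact: (null_set_integral (measurableC mA) (measurable_funTS mf) A0).
  rewrite adde0; apply: eq_measure_integral => B mB BA.
  by rewrite /= /mrestr (setIidl BA).
- exact: measurableC.
- exact: measurable_funTS.
- exact/disj_setPCl.
Qed.

End restriction.

Definition inv_nng (x : R) : {nonneg R} := NngNum (normr_ge0 x^-1).

(** The conditional measure bundled as a locally finite measure, so that it can serve as a kernel.
    At mass 0 it is the zero measure, as the inverse of 0 is 0. *)
Definition lf_cond xi (A : set rV) (mA : measurable A) : lf :=
  lf_restr (inv_nng (fine (xi A))) xi mA.

Lemma lf_condE xi (A B : set rV) (mA : measurable A) : bounded_set A -> measurable B ->
  lf_cond xi mA B = cond_measure xi A B.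
Proof.
move=> bA mB; rewrite /lf_cond lf_restrE/= /cond_measure.
have Afin : xi A \is a fin_num by rewrite ge0_fin_numE//; exact: lf_fin.
have [A0|A0] := eqVneq (xi A) 0%E.
  rewrite A0/= invr0 normr0 mul0e (_ : xi (B `&` A) = 0%E) ?mul0e//.
  by apply: (subset_measure0 _ mA _ A0); [exact: measurableI|exact: subIsetr].
rewrite muleC; congr *%E; rewrite -[in RHS](fineK Afin) inver ger0_norm ?invr_ge0 ?fine_ge0//.
by rewrite fine_eq0// (negbTE A0).
Qed.

End lf_operations.

(** * The exchange formula and windows *)

Lemma measurable_indic_comp (R : realType) dT (T : measurableType dT) dU (U : measurableType dU)
  (A : set U) (h : T -> U) : measurable A -> measurable_fun setT h ->
  measurable_fun setT (fun x => (\1_A (h x) : R)%:E).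
Proof.
by move=> mA mh; apply/measurable_EFinP; exact: (measurableT_comp (measurable_indic mA) mh).
Qed.

Section flow.
Context (R : realType) (d : nat) dS (S : measurableType dS).
Notation rV := 'rV[R]_d.
Notation lf := (lf_measure R d).
Notation lam := (@lebesgue_rV R d).
Variables (theta : rV -> S -> S) (m : S -> lf).
Hypotheses (htheta : measurable_action theta) (mm : measurable_fun setT m)
  (mE : forall t z, m (theta t z) = lf_shift t (m z)).
Variable Q : {measure set S -> \bar R}.
Hypothesis sQ : sigma_finite setT Q.

Local Notation ind A x := ((\1_A x)%:E : \bar R).

Lemma measurable_theta dT (T : measurableType dT) (f : T -> rV) (g : T -> S) :
  measurable_fun setT f -> measurable_fun setT g ->
  measurable_fun setT (fun x => theta (f x) (g x)).
Proof.
case: htheta => _ _ mt mf mg.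
exact: (measurableT_comp mt (measurable_fun_pair mf mg)).
Qed.

(** An involution: the origin moves to the point [p.2], from which the former origin is seen at
    [- p.2]. *)
Definition iota (p : S * rV) : S * rV := (theta p.2 p.1, - p.2).

Lemma measurable_iota : measurable_fun setT iota.
Proof.
apply: measurable_fun_pair; first exact: measurable_theta.
exact: measurable_funN_rV.
Qed.

Definition mecke := forall B, measurable B -> semi Q mm (iota @^-1` B) = semi Q mm B.

Lemma mecke_integral (g : S * rV -> \bar R) : mecke ->
  measurable_fun setT g -> (forall p, 0 <= g p)%E ->
  (\int[Q]_z \int[m z]_t g (theta t z, - t)%R = \int[Q]_z \int[m z]_t g (z, t))%E.
Proof.
move=> Mk mg g0.
transitivity (\int[semi Q mm]_p (g \o iota) p)%E.
  rewrite integral_semi// => [|z]; last exact: g0.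
  exact: (measurableT_comp mg measurable_iota).
rewrite -[RHS]integral_semi//.
transitivity (\int[pushm (semi Q mm) measurable_iota]_p g p)%E; first by rewrite integral_pushm.
by apply: eq_measure_integral => B mB _; exact: Mk.
Qed.

Let QL := semi Q (measurable_cst (lebesgue_lf R d)).

Lemma integral_QL (g : S * rV -> \bar R) :
  measurable_fun setT g -> (forall p, 0 <= g p)%E ->
  (\int[QL]_p g p = \int[Q]_z \int[lam]_u g (z, u))%E.
Proof. by move=> mg g0; rewrite integral_semi. Qed.

Lemma integral_flow_swap (G : (S * rV) * rV -> \bar R) :
  measurable_fun setT G -> (forall p, 0 <= G p)%E ->
  (\int[Q]_z \int[m z]_v \int[lam]_u G ((z, v), u) =
   \int[QL]_p \int[m p.1]_v G ((p.1, v), p.2))%E.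
Proof.
move=> mG G0.
transitivity (\int[Q]_z \int[lam]_u \int[m z]_v G ((z, v), u))%E.
  apply: eq_integral => z _.
  rewrite (lf_fubini (nu := m z) (lebesgue_lf R d) (f := fun q => G ((z, q.1), q.2)))//.
    exact: lf_sigma_finite.
  apply: (measurableT_comp mG); apply: measurable_fun_pair => //.
  exact: measurable_fun_pair.
rewrite integral_QL//.
- apply: (measurable_lf_integral (measurableT_comp mm measurable_fst)
    (f := fun q => G ((q.1.1, q.2), q.1.2))) => //.
  apply: (measurableT_comp mG); apply: measurable_fun_pair; last first.
    exact: (measurableT_comp measurable_snd measurable_fst).
  apply: measurable_fun_pair => //.
  exact: (measurableT_comp measurable_fst measurable_fst).
- by move=> p; exact: integral_ge0.
Qed.

Section window.
Variable C : set rV.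
Hypothesis mC : measurable C.

(* Unnormalised mean of f after moving to a point of law m (. | C - u). *)
Definition window (f : S * rV -> \bar R) (p : S * rV) : \bar R :=
  (\int[m p.1]_v (ind C (p.2 + v)%R * f (theta v p.1, p.2 + v)%R))%E.

Lemma window_ge0 (f : S * rV -> \bar R) p : (forall q, 0 <= f q)%E -> (0 <= window f p)%E.
Proof. by move=> f0; apply: integral_ge0 => v _; rewrite mule_ge0// lee_fin. Qed.

Lemma measurable_window (f : S * rV -> \bar R) : measurable_fun setT f -> (forall q, 0 <= f q)%E ->
  measurable_fun setT (window f).
Proof.
move=> mf f0; rewrite /window.
apply: (measurable_lf_integral (measurableT_comp mm measurable_fst)
  (f := fun q : (S * rV) * rV => (ind C (q.1.2 + q.2)%R * f (theta q.2 q.1.1, q.1.2 + q.2)%R)%E)); last first.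
  by move=> z; rewrite mule_ge0// lee_fin.
have m12 : measurable_fun [set: (S * rV) * rV] (fun q => q.1.2 + q.2).
  apply: measurable_funD_rV => //.
  exact: (measurableT_comp measurable_snd measurable_fst).
apply: emeasurable_funM; first exact: measurable_indic_comp.
apply: (measurableT_comp mf); apply: measurable_fun_pair => //.
apply: measurable_theta => //; exact: (measurableT_comp measurable_fst measurable_fst).
Qed.

Lemma measurable_window_integrand (f : S * rV -> \bar R) (p : S * rV) : measurable_fun setT f ->
  measurable_fun setT (fun v => (ind C (p.2 + v)%R * f (theta v p.1, p.2 + v)%R)%E).
Proof.
move=> mf; have mD : measurable_fun [set: rV] (fun v => p.2 + v).
  by apply: measurable_funD_rV => //; exact: measurable_id.
apply: emeasurable_funM; first exact: measurable_indic_comp.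
apply: (measurableT_comp mf); apply: measurable_fun_pair => //.
by apply: measurable_theta => //; exact: measurable_id.
Qed.

(** In [(z, u)] the origin of [z] sits at the location [u]. Moving the origin to [v] and recording
    [u + v] describes the same configuration, and [window] integrates over all points of [C],
    whichever point is the origin. *)
Lemma window_shift (f : S * rV -> \bar R) z u v : measurable_fun setT f -> (forall q, 0 <= f q)%E ->
  window f (theta v z, u + v) = window f (z, u).
Proof.
move=> mf f0; rewrite /window/= mE integral_lf_shift; first last.
- by move=> x; rewrite mule_ge0// lee_fin.
- exact: (@measurable_window_integrand f (theta v z, u + v)).
apply: eq_integral => x _; case: htheta => _ thetaD _.
by rewrite -thetaD subrK (_ : u + v + (x - v) = u + x)// addrACA subrr addr0.
Qed.

(** The pull-out rule of conditional expectations: by [window_shift], [window k] is constant along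
    the moves over which [window f] integrates. *)
Lemma window_mul_window (f k : S * rV -> \bar R) p : measurable_fun setT f -> (forall q, 0 <= f q)%E ->
  measurable_fun setT k -> (forall q, 0 <= k q)%E ->
  window (fun q => f q * window k q)%E p = (window f p * window k p)%E.
Proof.
move=> mf f0 mk k0; rewrite {1}/window.
rewrite -ge0_integralZr//; first last.
- exact: window_ge0.
- by move=> v _; rewrite mule_ge0// lee_fin.
- exact: measurable_window_integrand.
by apply: eq_integral => v _; rewrite window_shift// -?muleA -?surjective_pairing.
Qed.

Lemma mul_window (a b : \bar R) (f : S * rV -> \bar R) p : (0 <= a)%E -> (0 <= b)%E ->
  measurable_fun setT f -> (forall q, 0 <= f q)%E ->
  (a * (b * window f p) =
   \int[m p.1]_v (a * (b * (ind C (p.2 + v)%R * f (theta v p.1, p.2 + v)%R))))%E.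
Proof.
move=> a0 b0 mf f0; have mw := measurable_window_integrand p mf.
have w0 v : (0 <= ind C (p.2 + v)%R * f (theta v p.1, p.2 + v)%R)%E.
  by rewrite mule_ge0// lee_fin.
rewrite [RHS]ge0_integralZl//.
- by rewrite ge0_integralZl.
- exact: measurable_funeM.
- by move=> v _; rewrite mule_ge0.
Qed.

Definition window_mass (p : S * rV) := m p.1 [set v | C (p.2 + v)].

Lemma window_massE p : window_mass p = window (cst 1%E) p.
Proof.
rewrite /window; under eq_integral do rewrite mule1.
rewrite (eq_integral (fun v => ind [set v | C (p.2 + v)] v)).
  rewrite integral_indic ?setIT//.
  apply: (measurable_preim _ mC); apply: measurable_funD_rV => //; exact: measurable_id.
by move=> v _; rewrite !indicE.
Qed.

(* 0 at mass 0; the norm makes it nonnegative without side condition. *)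
Definition inv_mass (p : S * rV) : \bar R := (`|(fine (window_mass p))^-1|)%:E.

(** Up to the factor [1 / lam C], the equality of laws that mass-stationarity demands for the window
    [C], tested on nonnegative functions. *)
Definition window_invariant := forall f : S * rV -> \bar R,
  measurable_fun setT f -> (forall q, 0 <= f q)%E ->
  (\int[QL]_p (ind C p.2 * (inv_mass p * window f p)) = \int[QL]_p (ind C p.2 * f p))%E.

(* Resampling a point of the window is a conditional expectation, hence
   self-adjoint. *)
Lemma window_symmetric (f k : S * rV -> \bar R) : window_invariant ->
  measurable_fun setT f -> (forall q, 0 <= f q)%E ->
  measurable_fun setT k -> (forall q, 0 <= k q)%E ->
  (\int[QL]_p (ind C p.2 * (f p * window k p)) =
   \int[QL]_p (ind C p.2 * (k p * window f p)))%E.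
Proof.
move=> wC mf f0 mk k0.
rewrite -(wC (fun p => f p * window k p)%E) -?(wC (fun p => k p * window f p)%E).
- by apply: eq_integral => p _; rewrite !window_mul_window// [(window f p * _)%E]muleC.
- by apply: emeasurable_funM => //; exact: measurable_window.
- by move=> p; rewrite mule_ge0// window_ge0.
- by apply: emeasurable_funM => //; exact: measurable_window.
- by move=> p; rewrite mule_ge0// window_ge0.
Qed.

End window.

Section mecke_of_windows.

(** Triples of a configuration [z] under [Q], a jump [v] under [m z] and a location [u] under
    Lebesgue measure. *)
Let mu3 := semi (semi Q mm) (measurable_cst (lebesgue_lf R d)).

Lemma integral_mu3 (G : (S * rV) * rV -> \bar R) :
  measurable_fun setT G -> (forall p, 0 <= G p)%E ->
  (\int[mu3]_p G p = \int[QL]_p \int[m p.1]_v G ((p.1, v), p.2))%E.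
Proof.
move=> mG G0; rewrite -integral_flow_swap// integral_semi// integral_semi//.
  exact: (measurable_lf_integral (measurable_cst _)).
by move=> p; exact: integral_ge0.
Qed.

Let add3 (p : (S * rV) * rV) : rV := p.2 + p.1.2.

(** [from3] keeps the configuration before the jump and [to3] the one after it, each with its own
    location; the last entry is the location of the other endpoint. *)
Let from3 (p : (S * rV) * rV) : (S * rV) * rV := ((p.1.1, p.2), add3 p).

Let to3 (p : (S * rV) * rV) : (S * rV) * rV := ((theta p.1.2 p.1.1, add3 p), p.2).

Let m12 : measurable_fun setT (fun p : (S * rV) * rV => p.1.2).
Proof. exact: (measurableT_comp measurable_snd measurable_fst). Qed.

Let m11 : measurable_fun setT (fun p : (S * rV) * rV => p.1.1).
Proof. exact: (measurableT_comp measurable_fst measurable_fst). Qed.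

Let measurable_add3 : measurable_fun setT add3.
Proof. exact: measurable_funD_rV. Qed.

Let measurable_from3 : measurable_fun setT from3.
Proof. by apply: measurable_fun_pair => //; exact: measurable_fun_pair. Qed.

Let measurable_to3 : measurable_fun setT to3.
Proof.
by apply: measurable_fun_pair => //; apply: measurable_fun_pair => //; exact: measurable_theta.
Qed.

Variable C : set rV.
Hypotheses (mC : measurable C) (bC : bounded_set C).

Let D3 := snd @^-1` C `&` add3 @^-1` C.

Let mD3 : measurable D3.
Proof. by apply: measurableI; exact: measurable_preim. Qed.

Let mu3E (A : set ((S * rV) * rV)) : measurable A ->
  mu3 A = (\int[QL]_p \int[m p.1]_v (\1_A ((p.1, v), p.2))%:E)%E.
Proof.
move=> mA; rewrite -(@integral_mu3 (fun p => ind A p))//.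
- by rewrite integral_indic// setIT.
- by apply/measurable_EFinP; exact: measurable_indic.
Qed.

(** For test functions that are indicators, [window_symmetric] is the equality of two measures on
    rectangles; uniqueness of measures extends it to all [W]. *)
Lemma window_symmetric_measure (W : set ((S * rV) * rV)) : window_invariant C -> measurable W ->
  mu3 (from3 @^-1` W `&` D3) = mu3 (to3 @^-1` W `&` D3).
Proof.
move=> wC mW.
pose N1 := pushm (mrestr mu3 mD3) measurable_from3.
pose N2 := pushm (mrestr mu3 mD3) measurable_to3.
have [A AT fA] := sQ.
have [k k0 Ck] := iffLR (bounded_setP C) bC.
(* Differences of points of [C] have coordinates in [[- 2 k, 2 k]]; the extra 1 makes up for the
   open right end. *)
pose K : set rV := rv_box (const_mx (- (2 * k))) (const_mx (2 * k + 1)).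
have mK : measurable K by exact: measurable_rv_box.
have bK : bounded_set K by exact: bounded_rv_box.
have CK u v : C u -> C (u + v) -> K v.
  move=> Cu Cuv i; rewrite !mxE; have := Ck _ Cu i; have := Ck _ Cuv i.
  rewrite mxE !ler_norml => /andP[h1 h2] /andP[h3 h4]; apply/andP; split; lra.
(* [A i] bounds [Q], and the truncation bounds the mass of the jumps that stay inside [C]. These
   sets cover [S], and the cylinders over them have finite measure. *)
pose B (ij : nat * nat) : set S := A ij.1 `&` [set z | m z K <= ij.2%:R%:E]%E.
have mB ij : measurable (B ij).
  apply: measurableI; first by have [] := fA ij.1.
  rewrite -[X in measurable X]setTI; apply: emeasurable_fun_infty_c => //.
  exact: (measurableT_comp (measurable_lf_eval mK) mm).
pose g j := if @pickle_inv (nat * nat)%type j is Some ij then (B ij `*` [set: rV]) `*` [set: rV] else set0.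
apply: (@measure_unique _ R _ [set W | exists X : set (S * rV), exists D' : set rV,
  [/\ measurable X, measurable D' & W = X `*` D']] g _ _ _ _ N1 N2) => //.
- rewrite measurable_prod_measurableType; congr (<<s _ >>).
  apply/seteqP; split => [_ [X mX [D' mD' <-]]|_ [X [D' [mX mD' ->]]]]; first by exists X, D'.
  by exists X => //; exists D'.
- move=> _ _ [X [D' [mX mD' ->]]] [Y [E' [mY mE' ->]]].
  by exists (X `&` Y), (D' `&` E'); split; [exact: measurableI|exact: measurableI|rewrite setXI].
- move=> j; rewrite /g; case: pickle_inv => [ij|].
    exists (B ij `*` setT), setT; split => //; exact: measurableX.
  by exists set0, set0; split => //; rewrite setX0.
- apply/seteqP; split => // -[[z u] u'] _.
  have [i _ zi] : (\bigcup_i A i) z by rewrite -AT.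
  have Kfin : (m z K < +oo)%E by exact: lf_fin.
  exists (pickle (i, Num.bound (fine (m z K)))) => //.
  rewrite /g pickleK_inv; split => //; split => //; split => //=.
  rewrite -[X in (X <= _)%E]fineK ?ge0_fin_numE// lee_fin ltW//.
  by rewrite archi_boundP// fine_ge0.
- move=> _ [X [D' [mX mD' ->]]].
  have iD' : measurable_fun [set: S * rV] (fun q => ind D' q.2) by exact: measurable_indic_comp.
  have iX : measurable_fun [set: S * rV] (fun q => ind X q).
    by apply/measurable_EFinP; exact: measurable_indic.
  transitivity (\int[QL]_p (ind C p.2 * (ind X p * window C (fun q => ind D' q.2) p)))%E.
    rewrite -[LHS]/(mu3 (from3 @^-1` (X `*` D') `&` D3)) mu3E; last first.
      by apply: measurableI => //; apply: measurable_preim => //; exact: measurableX.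
    apply: eq_integral => p _; rewrite mul_window//.
    apply: eq_integral => v _; rewrite !indicE -!EFinM -!natrM !mulnb; congr ((nat_of_bool _)%:R%:E).
    apply/idP/idP; rewrite inE.
      move=> [[/= h1 h2] [/= h3 h4]].
      by apply/and4P; split; rewrite inE//; case: p h1 h2 h3 h4.
    move=> /and4P[]; rewrite !inE => h1 h2 h3 h4; split; split => //=.
    by case: p h1 h2 h3 h4.
  rewrite (window_symmetric mC wC iX _ iD' _)//.
  rewrite -[RHS]/(mu3 (to3 @^-1` (X `*` D') `&` D3)) mu3E; last first.
    by apply: measurableI => //; apply: measurable_preim => //; exact: measurableX.
  apply: eq_integral => p _; rewrite mul_window//.
  apply: eq_integral => v _; rewrite !indicE -!EFinM -!natrM !mulnb; congr ((nat_of_bool _)%:R%:E).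
  apply/idP/idP; rewrite inE.
    by move=> /and4P[]; rewrite !inE => h1 h2 h3 h4; split; split.
  by move=> [[/= h1 h2] [/= h3 h4]]; apply/and4P; split; rewrite inE.
move=> j; rewrite -[N1 _]/(mu3 (from3 @^-1` (g j) `&` D3)) /g.
have mu30 : mu3 set0 = 0%E by exact: measure0.
case: pickle_inv => [[i l]|]; last by rewrite preimage_set0 set0I mu30.
apply: (@le_lt_trans _ _ (mu3 ((B (i, l) `*` K) `*` C))).
  apply: le_measure; rewrite ?inE.
  - apply: measurableI => //; apply: measurable_preim => //; apply: measurableX => //.
    exact: measurableX.
  - by apply: measurableX => //; exact: measurableX.
  - by move=> [[z v] u] [/= [[Bz _] _] [/= Cu Cuv]]; split => //; split => //; exact: CK Cuv.
have [mAi Ai] := fA i.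
rewrite [X in (X < _)%E](semi_setX _ (measurable_cst _)) integral_cst//; last by apply: measurableX => //; exact: mB.
rewrite lte_mul_pinfty ?measure_ge0 ?ge0_fin_numE ?lebesgue_rV_bounded//.
rewrite [X in (X < _)%E](semi_setX _ mm) (@le_lt_trans _ _ (\int[Q]_(x in B (i, l)) l%:R%:E)%E)//.
  apply: ge0_le_integral => //; last by move=> z [].
  exact: measurable_funTS (measurableT_comp (measurable_lf_eval mK) mm).
rewrite integral_cst// lte_mul_pinfty// ?lee_fin//.
rewrite (@le_lt_trans _ _ (Q (A i)))// le_measure// ?inE//.
by move=> z [].
Qed.

End mecke_of_windows.

Lemma mecke_of_windows :
  (forall n, (0 < n)%N -> window_invariant (@box R d n)) -> mecke.
Proof.
move=> wi B mB.
(* Pairs (u, u + v) with u in the unit cube D and v in V K stay inside the box C,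
   so the symmetry of C gives the formula on B `&` V K, as lam D = 1. *)
pose I K : set rV := rv_box (const_mx (- K%:R)) (const_mx K%:R).
pose V K : set (S * rV) := [set p | @sbox R d K p.2].
have mV K : measurable (V K) by exact: (measurable_preim measurable_snd (measurable_sbox K)).
have VT : \bigcup_K V K = setT.
  apply/seteqP; split => // -[z v] _.
  by have := @bigcup_sbox R d => /seteqP[_ /(_ v Logic.I)] [K _ Kv]; exists K.
have mI := @measurable_iota.
have VE K : semi Q mm (iota @^-1` (B `&` V K)) = semi Q mm (B `&` V K).
  pose D : set rV := rv_box (const_mx K%:R) (const_mx K.+1%:R).
  have mD : measurable D by exact: measurable_rv_box.
  have D1 : lam D = 1%E.
    rewrite lebesgue_rV_box; last by move=> i; rewrite !mxE ler_nat.
    by rewrite big1// => i _; rewrite !mxE -natr1 addrAC subrr add0r.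
  pose C := @box R d (K + K).+1.
  (* At [from3] the pair tested here is [(z, v)], at [to3] it is [(theta v z, - v)], that is
     [iota (z, v)]. The location tested against [D] in [W] is [u] before and [u + v] after the
     jump. *)
  pose A := (fun p : (S * rV) * rV => (p.1.1, p.2 - p.1.2)) @^-1` (B `&` V K).
  pose W := A `&` (fun p : (S * rV) * rV => p.1.2) @^-1` D.
  have m12 : measurable_fun setT (fun p : (S * rV) * rV => p.1.2).
    exact: (measurableT_comp measurable_snd measurable_fst).
  have m11 : measurable_fun setT (fun p : (S * rV) * rV => p.1.1).
    exact: (measurableT_comp measurable_fst measurable_fst).
  have mBV : measurable (B `&` V K) by exact: measurableI.
  have mW : measurable W.
    apply: measurableI; apply: measurable_preim => //.
    by apply: measurable_fun_pair => //; exact: measurable_funB_rV.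
  have := window_symmetric_measure (measurable_box _) (@bounded_box _ _ _) (wi (K + K).+1 isT) mW.
  set mu3 := semi (semi Q mm) _.
  have CI u v : D u -> I K v -> C (u + v).
    move=> Du Iv i; have := Du i; have := Iv i; rewrite !mxE => /andP[h1 h2] /andP[h3 h4].
    rewrite -(addn1 (K + K)) !natrD; rewrite -natr1 in h4; apply/andP; split; lra.
  have D0 u : D u -> C u.
    by move=> Du i; have := Du i; rewrite !mxE => /andP[h3 h4];
      rewrite -natr1 in h4; rewrite -(addn1 (K + K)) !natrD;
      have := ler0n R K; move=> K0; apply/andP; split; lra.
  rewrite (_ : _ `&` _ = (B `&` V K) `*` D); last first.
    apply/seteqP; split => [[[z v] u]/=|[[z v] u]/= [[Bz Vz] Du]].
      by rewrite /W /A /= addrAC subrr add0r => -[[]].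
    rewrite /W /A /= addrAC subrr add0r; split; split => //; first exact: D0.
    by apply: CI => //; case: Vz.
  rewrite [X in X = _](semi_setX _ (measurable_cst _)) integral_cst//.
  rewrite [X in (X * _)%E](_ : _ = 1%E)// mul1e => ->.
  rewrite /mu3 {1}/semi.
  transitivity (\int[semi Q mm]_p ind (iota @^-1` (B `&` V K)) p)%E.
    rewrite integral_indic ?setIT//; exact: measurable_preim.
  apply: eq_integral => -[z v] _; rewrite indicE xsection_set.
  have [|zv] := boolP ((z, v) \in iota @^-1` (B `&` V K)).
    (* The admissible [u] form the translate of [D] by [- v], of measure 1 by translation
       invariance. *)
    rewrite inE => -[Bzv [/= Iv INv]]; rewrite -[LHS]D1 -[LHS](lebesgue_rVD v)//.
    congr (lam _); apply/seteqP; split => u /=.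
      move=> Duv; rewrite /W/A/= opprD addrA subrr add0r; split; split => //; last exact: D0.
      by rewrite -(addrK v u); exact: CI.
    by case=> [[]].
  rewrite -[LHS](@lebesgue_rV0 R d); congr (lam _); apply/seteqP; split => // u /=.
  rewrite /W/A/= opprD addrA subrr add0r => -[[h _] _].
  by move: zv; rewrite notin_setE.
(* The bound [K] on the location is removed by continuity from below on both sides. *)
have lim f : measurable_fun setT f ->
    semi Q mm (f @^-1` (B `&` V K)) @[K --> \oo] --> semi Q mm (f @^-1` B).
  move=> mf; rewrite -[in X in _ --> X](setIT B) -VT setI_bigcupr preimage_bigcup.
  apply: (nondecreasing_cvg_mu (mu := semi Q mm) (F := fun K => f @^-1` (B `&` V K))).
  - by move=> K; apply: measurable_preim => //; exact: measurableI.
  - by apply: bigcup_measurable => K _; apply: measurable_preim => //; exact: measurableI.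
  by move=> K L KL; apply/subsetPset => p [Bp Vp]; split => //; exact: subset_sbox Vp.
have := lim _ mI; under eq_fun do rewrite VE; move=> h.
exact: (cvg_unique _ h (lim _ (@measurable_id _ _ setT))).
Qed.

Lemma window_mass_ge0 (C : set rV) p : (0 <= window_mass C p)%E.
Proof. exact: measure_ge0. Qed.

Lemma measurable_window_mass (C : set rV) : measurable C -> measurable_fun setT (window_mass C).
Proof.
move=> mC; rewrite (_ : window_mass C = window C (cst 1%E)).
  by apply: measurable_window => //; exact: lee01.
by apply/funext => p; rewrite window_massE.
Qed.

Lemma window_mass_lty (C : set rV) p : measurable C -> bounded_set C -> (window_mass C p < +oo)%E.
Proof.
move=> mC /bounded_setP[K K0 CK]; apply: lf_fin.
  apply: (measurable_preim _ mC); apply: measurable_funD_rV => //; exact: measurable_id.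
apply/bounded_setP; exists (K + `|p.2|); first by rewrite ltr_pwDl.
move=> v /CK /(_ _) h i; have := h i; have := coord_le_norm p.2 i.
by rewrite mxE !ler_norml => /andP[h1 h2] /andP[h3 h4]; apply/andP; split; lra.
Qed.

Lemma inv_mass_mul (C : set rV) p : measurable C -> bounded_set C -> window_mass C p != 0%E ->
  (inv_mass C p * window_mass C p = 1)%E.
Proof.
move=> mC bC N0; have Nfin : window_mass C p \is a fin_num.
  by rewrite ge0_fin_numE ?window_mass_ge0// window_mass_lty.
rewrite /inv_mass -[X in (_ * X)%E](fineK Nfin) -EFinM ger0_norm ?invr_ge0 ?fine_ge0//.
by rewrite mulVf// fine_eq0.
Qed.

Lemma measurable_inv_mass (C : set rV) : measurable C -> measurable_fun setT (inv_mass C).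
Proof.
move=> mC; apply/measurable_EFinP; apply: measurableT_comp => //.
apply: (measurableT_comp (@measurable_invr R)).
apply: (measurableT_comp (@fine_measurable R setT measurableT)).
exact: measurable_window_mass.
Qed.

Lemma window_mass_shift (C : set rV) z u v : measurable C ->
  window_mass C (theta v z, u + v) = window_mass C (z, u).
Proof. by move=> mC; rewrite !window_massE// window_shift//; exact: lee01. Qed.

(** Exchanging the origin with the endpoint of the jump turns the resampled integrand into a
    function of the starting point times the indicator that the jump stays in [C]. Integrated over
    the jump, this indicator gives [window_mass], which cancels [inv_mass] off a null set. *)
Lemma windows_of_mecke (C : set rV) : measurable C -> bounded_set C ->
  QL [set p | C p.2 /\ window_mass C p = 0%E] = 0%E -> mecke -> window_invariant C.
Proof.
move=> mC bC N0 Mk f mf f0.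
(* Built so that at the exchanged pair, with location [u + v], it is the resampled integrand; [GE]
   checks this, using that [inv_mass] does not see the change of origin. *)
pose h (q : (S * rV) * rV) : \bar R :=
  (ind C q.2 * (inv_mass C (q.1.1, q.2) * f (q.1.1, q.2)) * ind C (q.2 + q.1.2)%R)%E.
have h0 q : (0 <= h q)%E by rewrite !mule_ge0// ?lee_fin.
have mi := measurable_inv_mass mC.
have mh : measurable_fun setT h.
  have m11 : measurable_fun setT (fun q : (S * rV) * rV => (q.1.1, q.2)).
    apply: measurable_fun_pair => //.
    exact: (measurableT_comp measurable_fst measurable_fst).
  apply: emeasurable_funM.
    apply: emeasurable_funM; first exact: measurable_indic_comp.
    apply: emeasurable_funM.
      exact: (measurableT_comp mi m11).
    exact: (measurableT_comp mf m11).
  apply: measurable_indic_comp => //; apply: measurable_funD_rV => //.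
  exact: (measurableT_comp measurable_snd measurable_fst).
pose g (p : S * rV) := (\int[lam]_u h (p, u))%E.
have g0 p : (0 <= g p)%E by apply: integral_ge0.
have mg : measurable_fun setT g.
  exact: (measurable_lf_integral (measurable_cst (lebesgue_lf R d)) (f := h)).
transitivity (\int[QL]_p \int[m p.1]_v
    ((ind C p.2 * inv_mass C p) * (ind C (p.2 + v)%R * f (theta v p.1, p.2 + v)%R)))%E.
  apply: eq_integral => p _; rewrite muleA.
  rewrite [RHS]ge0_integralZl//.
  - exact: measurable_window_integrand.
  - by move=> v _; rewrite mule_ge0// lee_fin.
  - by rewrite mule_ge0// lee_fin.
pose G (q : (S * rV) * rV) : \bar R := h ((theta q.1.2 q.1.1, - q.1.2), q.2 + q.1.2).
have GE p v : G ((p.1, v), p.2) =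
    ((ind C p.2 * inv_mass C p) * (ind C (p.2 + v)%R * f (theta v p.1, p.2 + v)%R))%E.
  rewrite /G /h/= addrK; case: p => z u /=.
  have -> : inv_mass C (theta v z, u + v) = inv_mass C (z, u).
    by rewrite /inv_mass window_mass_shift.
  by rewrite muleC -[RHS]muleA; congr (_ * _)%E; rewrite muleCA.
have m12 : measurable_fun setT (fun q : (S * rV) * rV => q.1.2).
  exact: (measurableT_comp measurable_snd measurable_fst).
have mG : measurable_fun setT G.
  apply: (measurableT_comp mh); apply: measurable_fun_pair; last exact: measurable_funD_rV.
  exact: (measurableT_comp measurable_iota measurable_fst).
transitivity (\int[QL]_p \int[m p.1]_v G ((p.1, v), p.2))%E.
  by apply: eq_integral => p _; apply: eq_integral => v _; rewrite GE.
rewrite -integral_flow_swap//; last by move=> q; exact: h0.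
(* The substitution of [u] for [u + v] under Lebesgue measure leaves a function of the exchanged
   pair alone. *)
transitivity (\int[Q]_z \int[m z]_v g (theta v z, - v)%R)%E.
  apply: eq_integral => z _; apply: eq_integral => v _.
  rewrite /g /G/= (integral_lebesgue_rVD v (f := fun u => h ((theta v z, - v), u)))//.
  exact: (measurableT_comp mh (pair1_measurable (theta v z, - v))).
rewrite mecke_integral// /g integral_flow_swap//.
transitivity (\int[QL]_p (ind C p.2 * (inv_mass C p * f p) * window_mass C p))%E.
  apply: eq_integral => -[z u] _; rewrite window_massE// /window.
  rewrite -ge0_integralZl//.
  - by apply: eq_integral => v _; rewrite /h /= mule1.
  - exact: (@measurable_window_integrand _ mC (cst 1%E) (z, u)).
  - by move=> v _; rewrite mule_ge0// lee_fin.
  - by rewrite !mule_ge0// lee_fin.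
have mN := measurable_window_mass mC.
have mCf : measurable_fun setT (fun p : S * rV => ind C p.2) by exact: measurable_indic_comp.
apply: ae_eq_integral => //.
- by do 2 apply: emeasurable_funM => //; exact: emeasurable_funM.
- exact: emeasurable_funM.
exists [set p | C p.2 /\ window_mass C p = 0%E]; split => //.
  apply: measurableI; first exact: (measurable_preim measurable_snd mC).
  exact: (measurable_preim mN (emeasurable_set1 0%E)).
move=> p /= pN; apply: contrapT => CN; apply: pN => _.
have [Cp|Cp] := boolP (p.2 \in C); last by rewrite indicE (negbTE Cp) !mul0e.
rewrite -!muleA; congr (_ * _)%E; rewrite muleCA -[RHS]mule1 inv_mass_mul//.
apply/eqP => Np; apply: CN; split => //; by move: Cp; rewrite inE.
Qed.

End flow.

(** * Preserving shifts *)

Section preserving_shifts.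
Context (R : realType) (d : nat) dS (S : measurableType dS).
Notation rV := 'rV[R]_d.
Notation lf := (lf_measure R d).
Variables (theta : rV -> S -> S) (m : S -> lf).
Hypotheses (htheta : measurable_action theta) (mm : measurable_fun setT m)
  (mE : forall t z, m (theta t z) = lf_shift t (m z)).
Context dO (O : measurableType dO) (P : {measure set O -> \bar R}) (Z : O -> S)
  (mZ : measurable_fun setT Z).
Let Q := pushm P mZ.
Hypothesis Mk : mecke theta mm Q.

Local Notation ind A x := ((\1_A x)%:E : \bar R).

Variables (pi : S -> rV) (mpi : measurable_fun setT pi).
Let tau z s := s + pi (theta s z).
Hypothesis pres : forall w B, measurable B -> m (Z w) (tau (Z w) @^-1` B) = m (Z w) B.

Let W z := theta (pi z) z.

Let mW : measurable_fun setT W.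
Proof. by apply: measurable_theta => //; exact: measurable_id. Qed.

Let mtau z : measurable_fun setT (tau z).
Proof.
apply: measurable_funD_rV; first exact: measurable_id.
apply: (measurableT_comp mpi); apply: measurable_theta => //; exact: measurable_id.
Qed.

Let kappa n z := m z (sbox n).

Let mkappa n : measurable_fun setT (kappa n).
Proof. exact: (measurableT_comp (measurable_lf_eval (measurable_sbox n)) mm). Qed.

(* The exchange formula, the invariance of m under tau, and the exchange formula
   once more. *)
Let shift_kappa n (f : S -> \bar R) : measurable_fun setT f -> (forall z, 0 <= f z)%E ->
  (\int[Q]_z (f (W z) * kappa n (W z)) = \int[Q]_z (f z * kappa n z))%E.
Proof.
move=> mf f0; have mB := @measurable_sbox R d n.
have [_ thetaD _] := htheta.
have kE (c : \bar R) z (t : rV) : (0 <= c)%E ->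
    (c * m z [set v | sbox n (v - t)%R] = \int[m z]_v (c * ind (sbox n) (v - t)%R))%E.
  move=> c0; have mt : measurable [set v : rV | sbox n (v - t)%R].
    by apply: (measurable_preim _ mB); apply: measurable_funB_rV => //; exact: measurable_id.
  rewrite ge0_integralZl//; last first.
    apply: measurable_indic_comp => //.
    by apply: measurable_funB_rV => //; exact: measurable_id.
  have := integral_indic (m z) measurableT mt; rewrite setIT => <-.
  by congr *%E; apply: eq_integral.
pose g1 (p : S * rV) := (f (W p.1) * ind (sbox n) (p.2 - pi p.1)%R)%E.
pose F (p : S * rV) := (f (theta p.2 p.1) * ind (sbox n) (- p.2)%R)%E.
have mg1 : measurable_fun setT g1.
  apply: emeasurable_funM; first exact: (measurableT_comp mf (measurableT_comp mW measurable_fst)).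
  apply: measurable_indic_comp => //; apply: measurable_funB_rV => //.
  exact: (measurableT_comp mpi measurable_fst).
have mF : measurable_fun setT F.
  apply: emeasurable_funM; first by apply: (measurableT_comp mf); exact: measurable_theta.
  by apply: measurable_indic_comp => //; exact: measurable_funN_rV.
have F0 p : (0 <= F p)%E by rewrite mule_ge0// lee_fin.
transitivity (\int[Q]_z \int[m z]_t g1 (z, t))%E.
  apply: eq_integral => z _; rewrite /g1/= -(kE (f (W z)) z (pi z))//.
  by rewrite /kappa mE.
rewrite -(mecke_integral htheta Mk mg1); last by move=> p; rewrite mule_ge0// lee_fin.
(* Seen from [t], the shifted origin is at [pi (theta t z)]; measured from the original origin this
   is the allocated point [tau z t]. *)
transitivity (\int[Q]_z \int[m z]_t F (z, tau z t))%E.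
  apply: eq_integral => z _; apply: eq_integral => t _.
  by rewrite /g1 /F /W /tau/= -thetaD opprD [(_ + t)%R]addrC.
transitivity (\int[Q]_z \int[m z]_t F (z, t))%E.
  have mF3 (f' : S * rV -> rV) : measurable_fun setT f' -> measurable_fun setT
      (fun z => \int[m z]_t F (z, f' (z, t)))%E.
    move=> mf'; apply: (measurable_lf_integral mm (f := fun p => F (p.1, f' p))) => //.
    by apply: (measurableT_comp mF); exact: measurable_fun_pair.
  (* [pres] is known at the values of [Z] only, so both integrals are pulled back to [P] before it
     is used. *)
  rewrite (@integral_pushm _ _ _ _ _ _ _ mZ (fun z => \int[m z]_t F (z, tau z t))%E); first last.
  - by move=> z; exact: integral_ge0.
  - apply: (mF3 (fun p => tau p.1 p.2)); apply: measurable_funD_rV => //.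
    by apply: (measurableT_comp mpi); exact: measurable_theta.
  rewrite (@integral_pushm _ _ _ _ _ _ _ mZ (fun z => \int[m z]_t F (z, t))%E); first last.
  - by move=> z; exact: integral_ge0.
  - exact: (mF3 snd).
  apply: eq_integral => w _.
  rewrite -(integral_pushm (m (Z w)) (mtau (Z w)) (g := fun t => F (Z w, t)))//.
    by apply: eq_measure_integral => B mB' _; exact: pres.
  exact: (measurableT_comp mF (pair1_measurable (Z w))).
pose g2 (p : S * rV) := (f p.1 * ind (sbox n) p.2)%E.
transitivity (\int[Q]_z \int[m z]_t g2 (theta t z, - t)%R)%E => //.
have mg2 : measurable_fun setT g2.
  apply: emeasurable_funM; first exact: (measurableT_comp mf measurable_fst).
  exact: measurable_indic_comp.
rewrite (mecke_integral htheta Mk mg2); last by move=> p; rewrite mule_ge0// lee_fin.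
- apply: eq_integral => z _; rewrite /g2/= ge0_integralZl//.
    by rewrite integral_indic ?setIT.
  exact: measurable_indic_comp.
Qed.

Hypothesis mass_neq0 : Q [set z | m z setT = 0%E] = 0%E.

(** [shift_kappa] is applied to the indicator of [A] divided by [kappa n], which is finite because
    [sbox n] is bounded. *)
Let shift_kappa_set n A : measurable A ->
  Q (W @^-1` (A `&` [set z | kappa n z != 0%E])) = Q (A `&` [set z | kappa n z != 0%E]).
Proof.
move=> mA; set E := [set z | _].
have mE' : measurable E.
  rewrite (_ : E = ~` (kappa n @^-1` [set 0%E])); last first.
    by apply/seteqP; split => z /= => [/eqP|h]; [|apply/eqP].
  by apply: measurableC; exact: (measurable_preim (mkappa n) (emeasurable_set1 0%E)).
have mAE : measurable (A `&` E) by exact: measurableI.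
pose f z := (ind A z * `|(fine (kappa n z))^-1|%:E)%E.
have mf : measurable_fun setT f.
  apply: emeasurable_funM; first by apply/measurable_EFinP; exact: measurable_indic.
  apply/measurable_EFinP; apply: measurableT_comp => //.
  apply: (measurableT_comp (@measurable_invr R)).
  exact: (measurableT_comp (@fine_measurable R setT measurableT) (mkappa n)).
have fE z : (f z * kappa n z = ind (A `&` E) z)%E.
  have kfin : kappa n z \is a fin_num.
    by rewrite ge0_fin_numE//; apply: lf_fin; [exact: measurable_sbox|exact: bounded_sbox].
  rewrite /f; have [k0|k0] := eqVneq (kappa n z) 0%E.
    by rewrite k0 mule0 indicE memNset// => -[_]; rewrite /E/= k0 eqxx.
  rewrite -muleA -[X in (_ * (_ * X))%E](fineK kfin) -EFinM ger0_norm ?invr_ge0 ?fine_ge0//.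
  by rewrite mulVf ?fine_eq0// mulr1 !indicE in_setI [z \in E]mem_set// andbT.
have f0 z : (0 <= f z)%E by rewrite mule_ge0// lee_fin.
have QE B : measurable B -> Q B = (\int[Q]_z ind B z)%E.
  by move=> mB; rewrite integral_indic// setIT.
rewrite !QE//; last exact: measurable_preim.
transitivity (\int[Q]_z (f (W z) * kappa n (W z)))%E.
  by apply: eq_integral => z _; rewrite fE.
by rewrite shift_kappa//; apply: eq_integral => z _; rewrite fE.
Qed.

(** [W] does not change the total mass of [m], so the null set where [m] vanishes can be removed
    from both sides. Elsewhere [kappa n] is nonzero for large [n], and continuity from below
    applies. *)
Lemma preserving_shift_invariance A : measurable A -> Q (W @^-1` A) = Q A.
Proof.
move=> mA; pose E := [set z | m z setT != 0%E].
have mE' : measurable E.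
  rewrite (_ : E = ~` ((fun z => m z setT) @^-1` [set 0%E])); last first.
    by apply/seteqP; split => z /= => [/eqP|h]; [|apply/eqP].
  apply: measurableC.
  exact: (measurable_preim (measurableT_comp (measurable_lf_eval measurableT) mm) (emeasurable_set1 0%E)).
have QE B : measurable B -> Q B = Q (B `&` E).
  move=> mB; rewrite -[in LHS](setUIDK B E) measureU0//.
  - exact: measurableI.
  - exact: measurableD.
  - apply: (subset_measure0 _ _ _ mass_neq0); first exact: measurableD.
      rewrite (_ : [set z | _] = ~` E); first exact: measurableC.
      apply/seteqP; split => z /=; rewrite /E/=; first by move=> ->; rewrite eqxx.
      by move=> /negP; rewrite negbK => /eqP.
    by move=> z [_] /negP; rewrite negbK => /eqP.
rewrite QE; last exact: measurable_preim.
rewrite [RHS]QE// (_ : W @^-1` A `&` E = W @^-1` (A `&` E)); last first.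
  apply/seteqP; split => z [Az Ez]; split => //.
    by rewrite /E/= mE lf_shiftE.
  by move: Ez; rewrite /E/= mE lf_shiftE.
have EE : A `&` E = \bigcup_n (A `&` [set z | kappa n z != 0%E]).
  rewrite -setI_bigcupr; congr (_ `&` _); apply/seteqP; split => z.
    move=> Ez; apply: contrapT => h; move/eqP: Ez; apply.
    rewrite -(@bigcup_sbox R d); apply: measure0_bigcup_countable => n; first exact: measurable_sbox.
    by apply/eqP; apply: contrapT => /negP k0; apply: h; exists n.
  move=> [n _ kz]; rewrite /E/=; apply: contra_neq kz => m0.
  by apply: (subset_measure0 (measurable_sbox n) measurableT (@subsetT _ _) m0).
rewrite EE preimage_bigcup.
have mAk n : measurable (A `&` [set z | kappa n z != 0%E]).
  apply: measurableI => //; rewrite (_ : [set z | _] = ~` (kappa n @^-1` [set 0%E])); last first.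
    by apply/seteqP; split => z /= => [/eqP|h]; [|apply/eqP].
  by apply: measurableC; exact: (measurable_preim (mkappa n) (emeasurable_set1 0%E)).
have nd a b : (a <= b)%N -> [set z | kappa a z != 0%E] `<=` [set z | kappa b z != 0%E].
  move=> ab z /=; apply: contra_neq => k0.
  by apply: (subset_measure0 (measurable_sbox a) (measurable_sbox b) (subset_sbox ab) k0).
have h1 : Q (A `&` [set z | kappa n z != 0%E]) @[n --> \oo] -->
    Q (\bigcup_n (A `&` [set z | kappa n z != 0%E])).
  apply: (nondecreasing_cvg_mu (mu := Q) (F := fun n => A `&` [set z | kappa n z != 0%E])) => //.
    exact: bigcup_measurable.
  by move=> a b ab; apply/subsetPset; apply: setIS; exact: nd.
have h2 : Q (W @^-1` (A `&` [set z | kappa n z != 0%E])) @[n --> \oo] -->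
    Q (\bigcup_n (W @^-1` (A `&` [set z | kappa n z != 0%E]))).
  apply: (nondecreasing_cvg_mu (mu := Q) (F := fun n => W @^-1` (A `&` [set z | kappa n z != 0%E]))).
  - by move=> n; exact: measurable_preim.
  - by apply: bigcup_measurable => n _; exact: measurable_preim.
  - by move=> a b ab; apply/subsetPset => z [Az kz]; split => //; exact: nd kz.
move: h2; under eq_fun do rewrite shift_kappa_set//; move=> h2.
exact: (cvg_unique _ h2 h1).
Qed.

End preserving_shifts.

(** * Product with a stationary independent background *)

Section background.
Context (R : realType) (d : nat) dS (S : measurableType dS).
Notation rV := 'rV[R]_d.
Notation lf := (lf_measure R d).
Variables (theta : rV -> S -> S) (m : S -> lf).
Hypotheses (htheta : measurable_action theta) (mm : measurable_fun setT m).
Variable Q : {measure set S -> \bar R}.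
Hypothesis sQ : sigma_finite setT Q.
Context dY (Y : measurableType dY).
Variable (thetaY : rV -> Y -> Y).
Hypothesis hthetaY : measurable_action thetaY.
Variable QY : probability Y R.
Hypothesis stationaryY : forall t A, measurable A -> QY (thetaY t @^-1` A) = QY A.
Variable L : {measure set (Y * S) -> \bar R}.
Hypothesis LE : forall A, measurable A -> L A = (QY \x Q)%E A.

Local Notation ind A x := ((\1_A x)%:E : \bar R).

Definition product_flow (t : rV) (p : Y * S) := (thetaY t p.1, theta t p.2).

Lemma product_flow_action : measurable_action product_flow.
Proof.
case: htheta hthetaY => t0 tD tm [u0 uD um]; split.
- by case=> y z; rewrite /product_flow/= t0 u0.
- by move=> s t [y z]; rewrite /product_flow/= tD uD.
have m12 : measurable_fun [set: rV * (Y * S)] (fun q => q.2.1).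
  exact: (measurableT_comp measurable_fst measurable_snd).
have m22 : measurable_fun [set: rV * (Y * S)] (fun q => q.2.2).
  exact: (measurableT_comp measurable_snd measurable_snd).
apply: measurable_fun_pair.
  exact: (measurableT_comp um (measurable_fun_pair measurable_fst m12)).
exact: (measurableT_comp tm (measurable_fun_pair measurable_fst m22)).
Qed.

Lemma measurable_product_mass : measurable_fun setT (m \o @snd Y S).
Proof. exact: (measurableT_comp mm measurable_snd). Qed.

Let integral_background (H : (Y * S) * rV -> \bar R) :
  measurable_fun setT H -> (forall p, 0 <= H p)%E ->
  (\int[L]_p \int[m p.2]_v H (p, v) = \int[Q]_z \int[m z]_v \int[QY]_y H ((y, z), v))%E.
Proof.
move=> mH H0.
have mG : measurable_fun setT (fun p : Y * S => \int[m p.2]_v H (p, v))%E.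
  exact: (measurable_lf_integral measurable_product_mass).
transitivity (\int[QY \x sf_measure sQ]_p \int[m p.2]_v H (p, v))%E.
  by apply: eq_measure_integral => A mA _; exact: LE.
have G0 p : (0 <= \int[m p.2]_v H (p, v))%E by exact: integral_ge0.
rewrite (fubini_tonelli1 (fun p : Y * S => \int[m p.2]_v H (p, v))%E)//.
rewrite (fubini_tonelli (fun p : Y * S => \int[m p.2]_v H (p, v))%E)//.
apply: eq_integral => z _ /=.
rewrite (lf_fubini (nu := QY) (m z) (f := fun q => H ((q.1, z), q.2)))//.
  exact: sigma_finiteT.
apply: (measurableT_comp mH); apply: measurable_fun_pair => //.
exact: measurable_fun_pair.
Qed.

(** At fixed [z] and [v] the exchange moves [y] by [thetaY v]. When [y] is integrated first,
    stationarity of [QY] removes this shift and the formula for [Q] remains. *)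
Lemma mecke_background : mecke theta mm Q -> mecke product_flow measurable_product_mass L.
Proof.
move=> Mk B mB; have mi := measurable_iota product_flow_action.
have semiE A : measurable A -> semi L measurable_product_mass A =
    (\int[Q]_z \int[m z]_v \int[QY]_y ind A ((y, z), v))%E.
  move=> mA; have iA : measurable_fun setT (fun p : (Y * S) * rV => ind A p).
    by apply/measurable_EFinP; exact: measurable_indic.
  have i0 (p : (Y * S) * rV) : (0 <= ind A p)%E by rewrite lee_fin.
  rewrite -(integral_background iA i0).
  transitivity (\int[semi L measurable_product_mass]_p ind A p)%E.
    by rewrite integral_indic// setIT.
  exact: integral_semi.
rewrite (semiE B mB) (semiE _ (measurable_preim mi mB)).
pose G (p : S * rV) := (\int[QY]_y ind B ((y, p.1), p.2))%E.
have mBp : measurable_fun setT (fun q : Y * (S * rV) => ind B ((q.1, q.2.1), q.2.2)).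
  apply: measurable_indic_comp => //; apply: measurable_fun_pair.
    apply: measurable_fun_pair => //.
    exact: (measurableT_comp measurable_fst measurable_snd).
  exact: (measurableT_comp measurable_snd measurable_snd).
have mG : measurable_fun setT G.
  apply: (@measurable_fun_fubini_tonelli_G _ _ _ _ R QY (fun q : Y * (S * rV) => ind B ((q.1, q.2.1), q.2.2))) => //.
rewrite -[RHS](mecke_integral htheta Mk mG); last first.
  by move=> p; apply: integral_ge0 => y _; rewrite lee_fin.
apply: eq_integral => z _; apply: eq_integral => v _; rewrite /G/=.
have mtv : measurable_fun setT (thetaY v).
  have [_ _ um] := hthetaY; exact: (measurableT_comp um (pair1_measurable v)).
transitivity (\int[pushm QY mtv]_y ind B ((y, theta v z), - v)%R)%E.
  rewrite integral_pushm//.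
  apply: measurable_indic_comp => //; exact: measurable_fun_pair.
by apply: eq_measure_integral => A mA _; exact: stationaryY.
Qed.

End background.

Section mass_stationarity.
Context (R : realType) (d : nat) (dO : measure_display) (O : measurableType dO)
  (P : {measure set O -> \bar R}) (dE : measure_display) (E : measurableType dE).
Notation rV := 'rV[R]_d.
Notation lf := (lf_measure R d).
Variables (theta : rV -> E -> E) (X : O -> E) (xi : O -> lf).
Hypotheses (htheta : measurable_action theta)
  (mX : measurable_fun setT X) (mxi : measurable_fun setT xi).

Definition marked_flow := product_flow (@lf_shift R d) theta.

Lemma marked_flow_action : measurable_action marked_flow.
Proof. exact: (product_flow_action (@measurable_lf_shift_action R d) htheta). Qed.

Definition marked_law := pushm P (measurable_fun_pair mX mxi).

Lemma measurable_mark : measurable_fun setT (snd : E * lf -> lf).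
Proof. exact: measurable_snd. Qed.

Definition mecke_law := mecke marked_flow measurable_mark marked_law.

Hypothesis hsupp : {ae P, forall w, msupport (xi w) 0}.
Hypothesis hsigma : sigma_finite setT (pushforward P (fun w => (X w, xi w))).

Lemma extension_law dO' (O' : measurableType dO') (P' : {measure set O' -> \bar R})
    (p : O' -> O) A : extension P P' p -> measurable A ->
  P' ((fun w => (X (p w), xi (p w))) @^-1` A) = marked_law A.
Proof.
move=> [mp pP] mA; rewrite -[RHS]pP//.
exact: (measurable_preim (measurable_fun_pair mX mxi) mA).
Qed.

Lemma measurable_mass0 dT (T : measurableType dT) (k : T -> lf) :
  measurable_fun setT k -> measurable [set z | k z setT = 0%E].
Proof.
move=> mk; exact: (measurable_preim (measurableT_comp (measurable_lf_eval measurableT) mk)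
  (emeasurable_set1 0%E)).
Qed.

Lemma marked_law_mass_neq0 : marked_law [set z : E * lf | z.2 setT = 0%E] = 0%E.
Proof.
have m0 : measurable [set z : E * lf | z.2 setT = 0%E].
  exact: measurable_mass0 measurable_mark.
case: hsupp => N [mN N0 suppN]; apply: (subset_measure0 _ mN _ N0).
  exact: (measurable_preim (measurable_fun_pair mX mxi) m0).
move=> w /= w0; apply: suppN => /= /(_ setT openT Logic.I).
by rewrite w0 ltxx.
Qed.

Lemma invariant_of_mecke : mecke_law -> invariant_under_preserving_shifts P theta X xi.
Proof.
move=> Mk dO' O' P' p dS S thetaS Y pi [ext actS mY [QS [stat indep]]] mpi pres t A mA.
have [mp _] := ext.
have mZ : measurable_fun setT (fun w => (X (p w), xi (p w))).
  exact: (measurableT_comp (measurable_fun_pair mX mxi) mp).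
pose L := pushm P' (measurable_fun_pair mY mZ).
have LE B : measurable B -> L B = (QS \x marked_law)%E B.
  move=> mB; rewrite -[LHS]/(pushforward P' _ B) indep//.
  by apply: eq_integral => y _; exact: (extension_law ext (measurable_xsection y mB)).
have MkL := mecke_background marked_flow_action hsigma actS stat LE Mk.
have mpi' : measurable_fun setT (fun s : S * (E * lf) => pi (s.1, s.2.2)).
  apply: (measurableT_comp mpi); apply: measurable_fun_pair => //.
  exact: (measurableT_comp measurable_snd measurable_snd).
have L0 : L [set z : S * (E * lf) | z.2.2 setT = 0%E] = 0%E.
  rewrite -[RHS]marked_law_mass_neq0.
  exact: (extension_law ext (measurable_mass0 measurable_mark)).
pose A' := (fun s : S * (E * lf) => (s.1, s.2.1, s.2.2)) @^-1` A.
have mA' : measurable A'.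
  apply: (measurable_preim _ mA).
  apply: measurable_fun_pair; last exact: (measurableT_comp measurable_snd measurable_snd).
  by apply: measurable_fun_pair => //; exact: (measurableT_comp measurable_fst measurable_snd).
exact: (preserving_shift_invariance (product_flow_action marked_flow_action actS)
  (fun _ _ => erefl) MkL mpi' pres L0 mA').
Qed.

End mass_stationarity.

(** * Mass-stationarity *)

Lemma sigma_finite_cover (R : realType) dT (T : measurableType dT) (mu : {measure set T -> \bar R}) :
  sigma_finite setT mu -> exists F : (set T)^nat,
    [/\ \bigcup_j F j = setT, forall j, measurable (F j) & forall j, (mu (F j) < +oo)%E].
Proof. by move=> [F FT Ffin]; exists F; split => // j; have [] := Ffin j. Qed.

Section conditional_law.
Context (R : realType) (d : nat) dO (O : measurableType dO) (P : {measure set O -> \bar R})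
  dS (S : measurableType dS).
Notation rV := 'rV[R]_d.
Notation lf := (lf_measure R d).
Variables (Z : O -> S) (W : O -> rV) (k : S -> lf).
Hypotheses (mZ : measurable_fun setT Z) (mW : measurable_fun setT W)
  (mk : measurable_fun setT k).

(** [cond_dist] speaks of rectangles only. Uniqueness of measures extends it to all [D], since the
    cylinder over a set of finite measure for the law of [Z] has finite joint measure. *)
Lemma cond_dist_law (K : S -> set rV -> \bar R) D : sigma_finite setT (pushm P mZ) ->
  (forall z B, measurable B -> K z B = k z B) -> cond_dist P Z W K -> measurable D ->
  P ((fun w => (Z w, W w)) @^-1` D) = semi (pushm P mZ) mk D.
Proof.
move=> sZ KE cW mD; have [F [FT mF Ffin]] := sigma_finite_cover sZ.
apply: (@measure_unique _ R _ [set A `*` B | A in measurable & B in measurable]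
  (fun j => F j `*` setT) _ _ _ _ (pushm P (measurable_fun_pair mZ mW)) (semi (pushm P mZ) mk)) => //.
- by rewrite measurable_prod_measurableType.
- move=> _ _ [A mA [B mB <-]] [A' mA' [B' mB' <-]].
  exists (A `&` A'); first exact: measurableI.
  by exists (B `&` B'); [exact: measurableI|rewrite setXI].
- by move=> j; exists (F j) => //; exists setT.
- by rewrite -setX_bigcupl FT setXTT.
- move=> _ [A mA [B mB <-]]; rewrite [RHS]semi_setX.
  rewrite -[LHS]/(P (Z @^-1` A `&` W @^-1` B)) cW//.
  rewrite (@ge0_integral_pushforward _ _ _ _ R Z mZ P A)//.
  - by apply: eq_integral => w _; exact: KE.
  - by apply: measurable_funTS; exact: (measurableT_comp (measurable_lf_eval mB) mk).
- move=> j; rewrite -[X in (X < _)%E]/(P (Z @^-1` F j `&` W @^-1` setT)) setIT.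
  exact: Ffin.
Qed.

End conditional_law.

Section window_law.
Context (R : realType) (d : nat) (dO : measure_display) (O : measurableType dO)
  (P : {measure set O -> \bar R}) (dE : measure_display) (E : measurableType dE).
Notation rV := 'rV[R]_d.
Notation lf := (lf_measure R d).
Notation lam := (@lebesgue_rV R d).
Notation S := (E * lf)%type.
Local Notation ind A x := ((\1_A x)%:E : \bar R).
Variables (theta : rV -> E -> E) (X : O -> E) (xi : O -> lf).
Hypotheses (htheta : measurable_action theta)
  (mX : measurable_fun setT X) (mxi : measurable_fun setT xi).
Hypothesis hsigma : sigma_finite setT (pushforward P (fun w => (X w, xi w))).

Let Q := marked_law P mX mxi.
Let QL := semi Q (measurable_cst (lebesgue_lf R d)).
Let flow := marked_flow theta.
Let mass : S -> lf := snd.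

Variable C : set rV.
Hypotheses (mC : measurable C) (bC : bounded_set C).

Lemma measurable_window_set u : measurable [set v : rV | C (u + v)].
Proof.
apply: (measurable_preim _ mC); apply: measurable_funD_rV => //; exact: measurable_id.
Qed.

Lemma bounded_window_set u : bounded_set [set v : rV | C (u + v)].
Proof.
move: bC => /bounded_setP[K K0 CK].
apply/bounded_setP; exists (K + `|u|); first by rewrite ltr_pwDl.
move=> v /CK /(_ _) h i; have := h i; have := coord_le_norm u i.
by rewrite mxE !ler_norml => /andP[h1 h2] /andP[h3 h4]; apply/andP; split; lra.
Qed.

Lemma window_set_image u : [set y - u | y in C] = [set v : rV | C (u + v)].
Proof.
apply/seteqP; split => [_ [y Cy <-]/=|v /= Cv]; first by rewrite addrC subrK.
by exists (u + v) => //; rewrite addrAC subrr add0r.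
Qed.

Definition window_kernel (p : S * rV) : lf := lf_cond p.1.2 (measurable_window_set p.2).

Lemma window_kernelE p B : measurable B ->
  window_kernel p B = cond_measure p.1.2 [set y - p.2 | y in C] B.
Proof. by move=> mB; rewrite window_set_image lf_condE//; exact: bounded_window_set. Qed.

Lemma integral_window_kernel p (f : rV -> \bar R) : measurable_fun setT f ->
  (forall v, 0 <= f v)%E ->
  (\int[window_kernel p]_v f v =
   inv_mass mass C p * \int[p.1.2]_v (ind C (p.2 + v)%R * f v))%E.
Proof.
move=> mf f0; rewrite integral_lf_restr//; congr *%E.
rewrite integral_mkcond; apply: eq_integral => v _; rewrite patchE indicE.
have [Cv|Cv] := boolP (v \in [set v | C (p.2 + v)]).
  by rewrite mem_set ?mul1e//; move: Cv; rewrite inE.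
by rewrite memNset ?mul0e//; move: Cv; rewrite notin_setE.
Qed.

Lemma measurable_window_kernel : measurable_fun setT window_kernel.
Proof.
apply: measurable_fun_lf => B mB.
have m12 : measurable_fun setT (fun p : S * rV => p.1.2).
  exact: (measurableT_comp measurable_snd measurable_fst).
apply: emeasurable_funM.
  exact: (measurable_inv_mass (marked_flow_action htheta) (@measurable_mark _ _ _ E) mC).
pose A := [set q : (S * rV) * rV | B q.2 /\ C (q.1.2 + q.2)].
have mA : measurable A.
  apply: measurableI; first exact: (measurable_preim measurable_snd mB).
  apply: (measurable_preim _ mC); apply: measurable_funD_rV => //.
  exact: (measurableT_comp measurable_snd measurable_fst).
have := measurable_lf_xsection m12 mA; congr (measurable_fun _).
by apply/funext => p; rewrite xsection_set.
Qed.

Let cl : lf := lf_cond (lebesgue_lf R d) mC.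
Let QU := semi Q (measurable_cst cl).
Definition jump (q : (S * rV) * rV) : S * rV := (flow q.2 q.1.1, q.2 + q.1.2).

Lemma measurable_jump : measurable_fun setT jump.
Proof.
apply: measurable_fun_pair.
  apply: (measurable_theta (marked_flow_action htheta)) => //.
  exact: (measurableT_comp measurable_fst measurable_fst).
apply: measurable_funD_rV => //; exact: (measurableT_comp measurable_snd measurable_fst).
Qed.

Let N := pushm (semi QU measurable_window_kernel) measurable_jump.

Hypothesis C_gt0 : (0 < lam C)%E.

Let lamC_fin : lam C \is a fin_num.
Proof. by rewrite ge0_fin_numE//; exact: lebesgue_rV_bounded. Qed.

Lemma cond_lebesgueT : cl setT = 1%E.
Proof.
rewrite /cl lf_restrE setTI/= -[X in (_ * X)%E](fineK lamC_fin) -EFinM.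
rewrite ger0_norm ?invr_ge0 ?fine_ge0// mulVf// fine_eq0//.
by rewrite gt_eqF.
Qed.

Let c : R := `|(fine (lam C))^-1|.

Let c_gt0 : 0 < c.
Proof. by rewrite normr_gt0 invr_eq0 fine_eq0// gt_eqF. Qed.

Let integral_QU (g : S * rV -> \bar R) : measurable_fun setT g -> (forall p, 0 <= g p)%E ->
  (\int[QU]_p g p = c%:E * \int[QL]_p (ind C p.2 * g p))%E.
Proof.
move=> mg g0; rewrite integral_semi//.
have mCg : measurable_fun setT (fun p : S * rV => ind C p.2 * g p)%E.
  by apply: emeasurable_funM => //; exact: measurable_indic_comp.
have Cg0 (p : S * rV) : (0 <= ind C p.2 * g p)%E by rewrite mule_ge0// lee_fin.
rewrite integral_semi//.
rewrite -ge0_integralZl//; last 3 first.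
- exact: (measurable_lf_integral (measurable_cst (lebesgue_lf R d)) mCg Cg0).
- by move=> z _; apply: integral_ge0 => u _; exact: Cg0.
- by rewrite lee_fin ltW.
apply: eq_integral => z _.
rewrite integral_lf_restr//; last exact: (measurableT_comp mg (pair1_measurable z)).
congr *%E; rewrite integral_mkcond; apply: eq_integral => u _; rewrite patchE indicE.
by rewrite /=; case: (u \in C); rewrite ?mul1e ?mul0e.
Qed.

Let integral_N (f : S * rV -> \bar R) : measurable_fun setT f -> (forall p, 0 <= f p)%E ->
  (\int[N]_p f p =
   c%:E * \int[QL]_p (ind C p.2 * (inv_mass mass C p * window flow mass C f p)))%E.
Proof.
have mflow := marked_flow_action htheta; have mmark : measurable_fun setT mass by exact: measurable_mark.
move=> mf f0; rewrite integral_pushm// integral_semi//; last first.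
  exact: (measurableT_comp mf measurable_jump).
rewrite -integral_QU; last 2 first.
- by apply: emeasurable_funM; [exact: (measurable_inv_mass mflow mmark mC)|exact: (measurable_window mflow mmark mC)].
- by move=> p; rewrite mule_ge0 ?window_ge0// lee_fin.
apply: eq_integral => p _; rewrite integral_window_kernel//; last first.
  exact: (measurableT_comp mf (measurableT_comp measurable_jump (pair1_measurable p))).
congr *%E; apply: eq_integral => v _ /=; by rewrite /jump/= [v + _]addrC.
Qed.

(** [QU] is the law of the configuration with its uniform location and [N] the law after resampling.
    Both integrate to [c = 1 / lam C] times the sides of [window_invariant], and [c > 0] cancels. *)
Lemma window_law_iff : (forall A, measurable A -> N A = QU A) <->
  window_invariant flow mass Q C.
Proof.
split=> [NQ f mf f0|wi A mA].
  have : (\int[N]_p f p = \int[QU]_p f p)%E.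
    by apply: eq_measure_integral => A mA _; exact: NQ.
  rewrite integral_N// integral_QU//; move: (\int[_]_p _)%E (\int[_]_p _)%E => x y.
  move/(congr1 (fun e => (c^-1%:E * e)%E)); rewrite !muleA -EFinM mulVf ?gt_eqF// !mul1e.
  by [].
have mi : measurable_fun setT (fun p : S * rV => ind A p).
  by apply/measurable_EFinP; exact: measurable_indic.
transitivity (\int[N]_p ind A p)%E; first by rewrite integral_indic// setIT.
by rewrite integral_N// wi// -integral_QU// integral_indic// setIT.
Qed.

(** The joint law of the configuration, [U] and [V] is the same on every extension; this turns
    mass-stationarity for [C] into the left side of [window_law_iff]. *)
Lemma joint_law dO' (O' : measurableType dO') (P' : {measure set O' -> \bar R})
    (p : O' -> O) (U V : O' -> rV) D :
  extension P P' p -> measurable_fun setT U -> measurable_fun setT V ->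
  cond_dist P' (fun w => (X (p w), xi (p w))) U (fun=> cond_measure lam C) ->
  cond_dist P' (fun w => (X (p w), xi (p w), U w)) V
      (fun z => cond_measure z.1.2 [set y - z.2 | y in C]) ->
  (forall A, measurable A -> P' ((fun w => (X (p w), xi (p w), U w)) @^-1` A) = QU A) /\
  (measurable D -> P' ((fun w => (X (p w), xi (p w), U w, V w)) @^-1` D) =
    semi QU measurable_window_kernel D).
Proof.
move=> ext mU mV cU cV; have [mp _] := ext.
have mZ : measurable_fun setT (fun w => (X (p w), xi (p w))).
  exact: (measurableT_comp (measurable_fun_pair mX mxi) mp).
have [F [FT mF Ffin]] := sigma_finite_cover (mu := Q) hsigma.
have sZ : sigma_finite setT (pushm P' mZ).
  exists F; first by rewrite FT.
  by move=> j; split => //; rewrite -[X in (X < _)%E]/(P' _) (extension_law mX mxi ext).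
have UE A : measurable A -> P' ((fun w => (X (p w), xi (p w), U w)) @^-1` A) = QU A.
  move=> mA; rewrite (cond_dist_law mU (measurable_cst cl) sZ _ cU mA)//.
    by apply: eq_measure_integral => B mB _; exact: (extension_law mX mxi ext).
  by move=> z B mB; rewrite /cl lf_condE.
split=> // mD.
have sZU : sigma_finite setT (pushm P' (measurable_fun_pair mZ mU)).
  exists (fun j => F j `*` setT); first by rewrite -setX_bigcupl FT setXTT.
  move=> j; split; first exact: measurableX.
  rewrite -[X in (X < _)%E]/(P' _) UE; last exact: measurableX.
  rewrite [X in (X < _)%E]semi_setX (eq_integral (cst 1%E)); last first.
    by move=> z _; exact: cond_lebesgueT.
  by rewrite integral_cst// mul1e.
rewrite (cond_dist_law mV measurable_window_kernel sZU _ cV mD)//.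
  by apply: eq_measure_integral => B mB _; exact: UE.
by move=> z B mB; rewrite window_kernelE.
Qed.

End window_law.

Section mass_stationary_mecke.
Context (R : realType) (d : nat) (dO : measure_display) (O : measurableType dO)
  (P : {measure set O -> \bar R}) (dE : measure_display) (E : measurableType dE).
Notation rV := 'rV[R]_d.
Notation lf := (lf_measure R d).
Notation lam := (@lebesgue_rV R d).
Notation S := (E * lf)%type.
Variables (theta : rV -> E -> E) (X : O -> E) (xi : O -> lf).
Hypotheses (htheta : measurable_action theta)
  (mX : measurable_fun setT X) (mxi : measurable_fun setT xi).
Hypothesis hsupp : {ae P, forall w, msupport (xi w) 0}.
Hypothesis hsigma : sigma_finite setT (pushforward P (fun w => (X w, xi w))).

Let Q := marked_law P mX mxi.
Let flow := marked_flow theta.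
Let mass : S -> lf := snd.
Let mflow : measurable_action flow := marked_flow_action htheta.
Let mmark : measurable_fun setT mass := @measurable_mark R d _ E.

Section one_window.
Variable C : set rV.
Hypotheses (mC : measurable C) (bC : bounded_set C).
Hypothesis boundary0 : lam (closure C `\` interior C) = 0%E.

Lemma measurable_window_null : measurable [set p : S * rV | C p.2 /\ window_mass mass C p = 0%E].
Proof.
apply: measurableI; first exact: (measurable_preim measurable_snd mC).
exact: (measurable_preim (measurable_window_mass mflow mmark mC) (emeasurable_set1 0%E)).
Qed.

(** If [u] is interior to [C], then [C - u] is a neighbourhood of 0 and is charged by every measure
    with 0 in its support. The other [u] in [C] lie on the null boundary. *)
Lemma window_mass_null :
  semi Q (measurable_cst (lebesgue_lf R d)) [set p | C p.2 /\ window_mass mass C p = 0%E] = 0%E.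
Proof.
have mD := measurable_window_null; set D := [set p | _] in mD *.
pose f z := lam (xsection D z).
have mf : measurable_fun setT f by exact: (measurable_lf_xsection (measurable_cst (lebesgue_lf R d)) mD).
rewrite /semi -[LHS]/(\int[Q]_z f z)%E integral_pushm//.
transitivity (\int[P]_w (cst 0 w))%E; last by rewrite integral0.
apply: ae_eq_integral => //; first exact: (measurableT_comp mf (measurable_fun_pair mX mxi)).
case: hsupp => N [mN N0 suppN]; exists N; split => //; apply: subset_trans suppN => w /= fw.
move=> supp; apply: fw => _ /=; rewrite /f.
have mcl : measurable (closure C `\` interior C).
  apply: measurableD; last by apply: measurable_open_rV; exact: open_interior.
  rewrite -[X in measurable X]setCK; apply: measurableC; apply: measurable_open_rV.
  exact/closed_openC/closed_closure.
apply: (subset_measure0 _ mcl _ boundary0); first exact: measurable_xsection.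
rewrite xsection_set => u [/= Cu Nu]; split; first exact: subset_closure.
move=> iu; pose I := (fun v : rV => v - (- u)) @^-1` interior C.
have : (0 < xi w I)%E.
  apply: supp; last by rewrite /I/= sub0r opprK.
  apply: open_comp; last exact: open_interior.
  by move=> v _; exact: (cvgB cvg_id (cvg_cst (- u))).
have Nu' : xi w [set v | C (u + v)] = 0%E := Nu.
rewrite (subset_measure0 _ (measurable_window_set mC u) _ Nu') ?ltxx//.
  exact: (measurable_preim (mx_subr_measurable _) (measurable_open_rV (@open_interior _ C))).
by move=> v; rewrite /I/= opprK addrC; exact: interior_subset.
Qed.

End one_window.

Lemma mass_stationary_of_mecke : mecke_law P theta mX mxi -> mass_stationary P theta X xi.
Proof.
move=> Mk C mC bC C0 Cb dO' O' P' p U V ext mU mV cU cV A mA.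
have [UE] := joint_law htheta mX mxi hsigma mC bC C0 (jump theta @^-1` A) ext mU mV cU cV.
have wi : window_invariant flow mass Q C.
  exact: (windows_of_mecke mflow (fun _ _ => erefl) mC bC (window_mass_null mC Cb) Mk).
have NQ := iffRL (window_law_iff P htheta mX mxi mC bC C0) wi A mA.
move=> VE; transitivity (P' ((fun w => (X (p w), xi (p w), U w, V w)) @^-1` (jump theta @^-1` A))) => //.
rewrite VE; last exact: (measurable_preim (measurable_jump htheta) mA).
by rewrite -[LHS]/(pushm _ (measurable_jump htheta) A) NQ -UE.
Qed.

(** * An extension that carries the uniform location and the resampled point *)

Section extension.
Variable C : set rV.
Hypotheses (mC : measurable C) (bC : bounded_set C).
Hypothesis boundary0 : lam (closure C `\` interior C) = 0%E.
Hypothesis C_gt0 : (0 < lam C)%E.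

Let cl : lf := lf_cond (lebesgue_lf R d) mC.
Let PU := semi P (measurable_cst cl).
Let ZU (p : O * rV) : S * rV := ((X p.1, xi p.1), p.2).

Let mZU : measurable_fun setT ZU.
Proof.
apply: measurable_fun_pair => //.
exact: (measurableT_comp (measurable_fun_pair mX mxi) measurable_fst).
Qed.

Let k := window_kernel mC \o ZU.

Let mk : measurable_fun setT k.
Proof. exact: (measurableT_comp (measurable_window_kernel htheta mC) mZU). Qed.

(** Mass-stationarity only quantifies over extensions, so its use requires one on which [U] and [V]
    exist. *)
Let P' := semi PU mk.

Lemma uniform_extension_law A : measurable A -> PU (ZU @^-1` A) = semi Q (measurable_cst cl) A.
Proof.
move=> mA; rewrite /PU /semi /Q.
transitivity (\int[P]_w cl (xsection A (X w, xi w)))%E.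
  by apply: eq_integral => w _; rewrite !xsection_set.
symmetry; apply: (integral_pushm P (measurable_fun_pair mX mxi) (g := fun z => cl (xsection A z))) => //.
exact: (measurable_lf_xsection (measurable_cst cl) mA).
Qed.

Let mass0 : measurable [set p | window_mass mass C p = 0%E].
Proof.
exact: (measurable_preim (measurable_window_mass mflow mmark mC) (emeasurable_set1 0%E)).
Qed.

Lemma uniform_window_mass_null :
  semi Q (measurable_cst cl) [set p | window_mass mass C p = 0%E] = 0%E.
Proof.
have mD := measurable_window_null mC; rewrite /semi.
have -> : (fun z => cst cl z (xsection [set p | window_mass mass C p = 0%E] z)) =
    (fun z => (`|(fine (lam C))^-1|)%:E * lam (xsection [set p | C p.2 /\ window_mass mass C p = 0] z))%E.
  apply/funext => z; rewrite !xsection_set.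
  transitivity (`|(fine (lam C))^-1|%:E * lam ([set u | window_mass mass C (z, u) = 0%E] `&` C))%E => //.
  congr (_ * lam _)%E.
  by apply/seteqP; split => u /= [].
rewrite ge0_integralZl//; last exact: (measurable_lf_xsection (measurable_cst (lebesgue_lf R d)) mD).
by rewrite [X in (_ * X)%E](window_mass_null mC boundary0) mule0.
Qed.

Let PU_null : PU (ZU @^-1` [set p | window_mass mass C p = 0%E]) = 0%E.
Proof. by rewrite uniform_extension_law// uniform_window_mass_null. Qed.

(** [k] is the zero measure instead of a probability where the window has no mass. This happens on a
    [PU]-null set, so [P'] still projects to [PU]. *)
Let PU_k A : measurable A -> P' (A `*` setT) = PU A.
Proof.
move=> mA; rewrite /P' semi_setX.
transitivity (\int[PU]_(p in A) cst 1 p)%E; last by rewrite integral_cst// mul1e.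
apply: ae_eq_integral => //.
  by apply: measurable_funTS; exact: (measurableT_comp (measurable_lf_eval measurableT) mk).
exists (ZU @^-1` [set p | window_mass mass C p = 0%E]); split => //.
  exact: (measurable_preim mZU mass0).
move=> p /= kp; apply: contrapT => N0; apply: kp => _.
rewrite /k /= /window_kernel lf_restrE setTI.
exact: (inv_mass_mul (m := mass) (p := ZU p) mC bC (introN eqP N0)).
Qed.

Let p3 (q : (O * rV) * rV) : O := q.1.1.

Let P'_fst A : measurable A -> P' (fst @^-1` A) = PU A.
Proof.
move=> mA; rewrite -PU_k//; congr (P' _); apply/seteqP; split => q //= [].
by [].
Qed.

Lemma uniform_extension_fst A : measurable A -> PU (fst @^-1` A) = P A.
Proof.
move=> mA; transitivity (PU (A `*` setT)).
  by congr (PU _); apply/seteqP; split => q //= [].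
rewrite /PU semi_setX; transitivity (\int[P]_(p in A) cst 1 p)%E.
  by apply: eq_integral => w _; exact: cond_lebesgueT.
by rewrite integral_cst// mul1e.
Qed.

Lemma window_extension : extension P P' p3.
Proof.
have m11 : measurable_fun setT p3 by exact: (measurableT_comp measurable_fst measurable_fst).
split=> // A mA; rewrite -uniform_extension_fst//.
rewrite -P'_fst//; exact: (measurable_preim measurable_fst mA).
Qed.

Lemma window_extension_U : cond_dist P' (fun q => (X (p3 q), xi (p3 q))) (snd \o fst) (fun=> cond_measure lam C).
Proof.
move=> A B mA mB; pose A' := (fun w => (X w, xi w)) @^-1` A.
have mA' : measurable A' by exact: (measurable_preim (measurable_fun_pair mX mxi) mA).
have mp3 : measurable_fun setT p3 by exact: (measurableT_comp measurable_fst measurable_fst).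
transitivity (PU (A' `*` B)).
  by rewrite -PU_k; [congr (P' _); apply/seteqP; split => q //= []|exact: measurableX].
rewrite integral_cst; last exact: (measurable_preim mp3 mA').
rewrite [X in (_ * X)%E](_ : _ = P A'); last exact: (window_extension.2 _ mA').
rewrite /PU semi_setX (eq_integral (cst (cl B)))// integral_cst//.
by rewrite /cl lf_condE.
Qed.

Lemma window_extension_V : cond_dist P' (fun q => (X (p3 q), xi (p3 q), (snd \o fst) q)) snd
  (fun z => cond_measure z.1.2 [set y - z.2 | y in C]).
Proof.
move=> A B mA mB; pose A' := ZU @^-1` A.
have mA' : measurable A' by exact: (measurable_preim mZU mA).
transitivity (P' (A' `*` B)); first by congr (P' _); apply/seteqP; split => q //= [].
rewrite /P' semi_setX.
transitivity (\int[P']_(q in fst @^-1` A') k q.1 B)%E; last first.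
  by apply: eq_integral => q _; exact: (window_kernelE mC bC (ZU q.1) mB).
rewrite -(@ge0_integral_pushforward _ _ _ _ R fst measurable_fst P' A' (k^~ B))//.
  apply: eq_measure_integral => D mD _; exact/esym/P'_fst.
by apply: measurable_funTS; exact: (measurableT_comp (measurable_lf_eval mB) mk).
Qed.

Lemma window_invariant_of_mass_stationary : mass_stationary P theta X xi ->
  window_invariant flow mass Q C.
Proof.
move=> ms; apply/(window_law_iff P htheta mX mxi mC bC C_gt0) => A mA.
have mU : measurable_fun setT (snd \o fst : (O * rV) * rV -> rV).
  exact: (measurableT_comp measurable_snd measurable_fst).
have mV : measurable_fun setT (snd : (O * rV) * rV -> rV) by [].
have [UE] := joint_law htheta mX mxi hsigma mC bC C_gt0 (jump theta @^-1` A)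
  window_extension mU mV window_extension_U window_extension_V.
move=> /(_ (measurable_preim (measurable_jump htheta) mA))/esym VE.
apply: (etrans VE); rewrite -[RHS]UE//.
exact: (ms C mC bC C_gt0 boundary0 _ _ _ _ _ _ window_extension mU mV
  window_extension_U window_extension_V A mA).
Qed.

End extension.

Lemma mecke_of_boxes : (forall n, (0 < n)%N -> window_invariant flow mass Q (@box R d n)) ->
  mecke_law P theta mX mxi.
Proof. by apply: mecke_of_windows. Qed.

Lemma mass_stationary_mecke : mass_stationary P theta X xi <-> mecke_law P theta mX mxi.
Proof.
split=> [ms|]; last exact: mass_stationary_of_mecke.
apply: mecke_of_boxes => n n0; apply: window_invariant_of_mass_stationary => //.
- exact: measurable_box.
- exact: bounded_box.
- exact: lebesgue_box_boundary.
- exact: lebesgue_box_gt0.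
Qed.

End mass_stationary_mecke.

(** * Quantile shifts of a measure on a box *)

Lemma gen_inverse_itv (R : realType) (rc : bool) (F : R -> R) (u x : R) :
  0 <= x < 1 -> u < F x -> 0 <= gen_inverse rc F u < 1.
Proof.
move=> x01 ux; pose A := [set x | 0 <= x < 1 /\ (if rc then u < F x else u <= F x)].
have Ax : A x by split=> //; case: (rc) => //; exact: ltW.
have A_lb : has_lbound A by exists 0 => y [/andP[]].
apply/andP; split; first by apply: lb_le_inf; [exists x|move=> y [/andP[]]].
by rewrite (le_lt_trans (ge_inf A_lb Ax))//; case/andP: x01.
Qed.

Section generalized_inverse.
Context (R : realType) (rc : bool) (F : R -> R).
Hypotheses (Fmono : {homo F : x y / x <= y}) (F0 : forall x, x <= 0 -> F x = 0)
  (F1 : forall x, 1 <= x -> F x = 1)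
  (Flc : forall x u, u < F x -> exists2 y, y < x & u < F y)
  (Frc : forall x u, (forall y, x < y -> u <= F y) -> u <= F x).

Let A u := [set x | 0 <= x < 1 /\ (if rc then u < F x else u <= F x)].

Let A_lb u : has_lbound (A u).
Proof. by exists 0 => x [/andP[]]. Qed.

Let A_le u x : A u x -> u <= F x.
Proof. by case=> _; case: rc => // /ltW. Qed.

Let A_intro u x : 0 <= u -> u < F x -> x < 1 -> A u x.
Proof.
move=> u0 ux x1; split; last by case: rc => //; exact: ltW.
rewrite x1 andbT leNgt; apply/negP => x0.
by move: ux; rewrite F0 ?(ltW x0)// ltNge u0.
Qed.

Let near1 u : 0 <= u < 1 -> exists2 y, 0 <= y < 1 & u < F y.
Proof.
move=> /andP[u0 u1]; have [|y y1 uy] := @Flc 1 u; first by rewrite F1.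
by exists y => //; case: (A_intro u0 uy y1).
Qed.

Let A_neq0 u : 0 <= u < 1 -> exists y, A u y.
Proof.
move=> u01; have [y /andP[_ y1] uy] := near1 u01; exists y.
by apply: A_intro => //; case/andP: u01.
Qed.

(** By left continuity some [y < x] already has [u < F y], so either version of the infimum is at
    most [y]. If [y >= 1] it is smaller than [y] because its value is below 1. *)
Lemma gen_inverse_lt u x : 0 <= u < 1 -> u < F x -> gen_inverse rc F u < x.
Proof.
move=> u01 /Flc[y yx uy]; have /andP[u0 u1] := u01; have [y1|y1] := ltP y 1.
  by rewrite (le_lt_trans _ yx)//; apply: (ge_inf (A_lb u)); exact: A_intro u0 uy y1.
have [y' y'01 uy'] := near1 u01; have /andP[_ G1] := gen_inverse_itv rc y'01 uy'.
by rewrite (lt_trans G1)// (le_lt_trans y1).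
Qed.

Lemma gen_inverse_lt_le u x : 0 <= u < 1 -> gen_inverse rc F u < x -> u <= F x.
Proof.
move=> /A_neq0 A0 /(inf_lt A0)[a /A_le ua ax].
by rewrite (le_trans ua)// Fmono// ltW.
Qed.

(** [F] cannot exceed [u] at the infimum by [gen_inverse_lt], and cannot be below [u] there by right
    continuity. So for continuous [F] both inverses are right inverses. *)
Lemma gen_inverseK u : 0 <= u < 1 -> F (gen_inverse rc F u) = u.
Proof.
move=> u01; apply/eqP; rewrite eq_le; apply/andP; split.
  by rewrite leNgt; apply/negP => /(gen_inverse_lt u01); rewrite ltxx.
by apply: Frc => y; exact: gen_inverse_lt_le.
Qed.

End generalized_inverse.

(** [F z] is monotone, so rational arguments decide whether the infimum is below [c]. *)
Lemma measurable_gen_inverse (R : realType) (rc : bool) dT (T : measurableType dT) (D : set T)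
    (F : T -> R -> R) (u : T -> R) : (forall x, measurable_fun D (F^~ x)) ->
  (forall z, {homo F z : x y / x <= y}) -> measurable_fun D u ->
  measurable_fun D (fun z => gen_inverse rc (F z) (u z)).
Proof.
move=> mF Fmono mu mD.
have mono z x y : x <= y -> (if rc then u z < F z x else u z <= F z x) ->
    (if rc then u z < F z y else u z <= F z y).
  move=> /(Fmono z); case: rc => a b; [exact: lt_le_trans b a|exact: le_trans b a].
pose E (q : rat) := D `&` [set z | if rc then u z < F z (ratr q) else u z <= F z (ratr q)].
have mE q : measurable (E q).
  have mb : measurable_fun D (fun z => if rc then u z < F z (ratr q) else u z <= F z (ratr q)).
    clear E mono; case: rc; [exact: measurable_fun_ltr|exact: measurable_fun_ler].
  exact: (mb mD [set true]).
pose I (c : R) := \bigcup_(q in [set q : rat | 0 <= (ratr q : R) < 1 /\ (ratr q : R) < c]) E q.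
have mI c : measurable (I c).
  by rewrite /I bigcup_mkcond; apply: countable_bigcupT_measurable => // q; case: ifP.
have IP c z : D z -> I c z <-> exists2 x, 0 <= x < 1 /\ (if rc then u z < F z x else u z <= F z x) & x < c.
  move=> Dz; split=> [[q [q01 qc] [_ /= qz]]|[x [/andP[x0 x1] xz] xc]]; first by exists (ratr q).
  have /rat_in_itvoo[q] : x < Num.min 1 c by rewrite lt_min x1.
  rewrite in_itv/= lt_min => /and3P[xq q1 qc]; exists q.
    by split=> //; rewrite q1 (le_trans x0)// ltW.
  by split=> //=; exact: mono (ltW xq) xz.
apply: (measurability (@RGenInftyO.G R)) => //; first exact: RGenInftyO.measurableE.
move=> _ [_ [c ->] <-].
pose lb (z : T) := [set x : R | 0 <= x < 1 /\ (if rc then u z < F z x else u z <= F z x)].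
have lbP z : has_lbound (lb z) by exists 0 => x [/andP[]].
(* [inf] of the empty set is 0: where no [x] qualifies, the value is below [c] exactly when [0 < c].
   All candidates are below 1, so [I 2] is the set where one exists. *)
rewrite (_ : D `&` _ = I c `|` (if 0 < c then D `\` I 2 else set0)).
  by apply: measurableU => //; case: ifP => // _; exact: measurableD.
apply/seteqP; split => z.
  move=> [Dz]; rewrite /= in_itv/= => Gc.
  have [[x lx]|ne] := pselect (exists x, lb z x).
    left; apply/IP => //; have [a la ac] := inf_lt (ex_intro _ x lx : lb z !=set0) Gc.
    by exists a.
  right; have E0 : lb z = set0 by apply/seteqP; split => // x lx; case: ne; exists x.
  move: Gc; rewrite /gen_inverse -/(lb z) E0 inf0 => ->; split=> //.
  by move/(IP 2 z Dz) => [x lx _]; apply: ne; exists x.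
case=> [Iz|].
  have Dz : D z by case: Iz => q _ [].
  split=> //=; rewrite in_itv/=; have [x lx xc] := iffLR (IP c z Dz) Iz.
  by rewrite (le_lt_trans _ xc)//; exact: (ge_inf (lbP z) lx).
case: ifP => // c0 [Dz nI]; split=> //=; rewrite in_itv/=.
rewrite /gen_inverse -/(lb z) (_ : lb z = set0) ?inf0//.
apply/seteqP; split => // x lx; apply: nI; apply/IP => //; exists x => //.
by case: lx => /andP[_ x1] _; rewrite (lt_trans x1)// ltr1n.
Qed.

Lemma mod1E (R : realType) (x : R) : mod1 x = fpart 1 x.
Proof. by rewrite /mod1 /fpart mul1r divr1. Qed.

(** * Quantile maps of a law on the unit interval *)

Section distribution_function.
Context (R : realType) (rc : bool) (nu : {measure set (measurableTypeR R) -> \bar R}).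
Hypotheses (nuT : nu setT = 1%E) (nuC : nu (~` `[0, 1[%classic) = 0%E).

Let F (x : R) : R := fine (nu `]-oo, x]%classic).

Let nu_le (A : set R) : measurable A -> (nu A <= 1)%E.
Proof. by move=> mA; rewrite -nuT le_measure ?inE. Qed.

Let FE x : (F x)%:E = nu `]-oo, x]%classic.
Proof. by rewrite fineK// ge0_fin_numE// (le_lt_trans (nu_le _)) ?ltry. Qed.

Let Fmono : {homo F : x y / x <= y}.
Proof.
move=> x y xy; rewrite -lee_fin !FE le_measure ?inE//.
by apply: subset_itvl; rewrite bnd_simp.
Qed.

Let F_ge0 x : 0 <= F x. Proof. by rewrite fine_ge0. Qed.

Let F_le1 x : F x <= 1. Proof. by rewrite -lee_fin FE nu_le. Qed.

Let cdf_lc x u : (u%:E < nu `]-oo, x[%classic)%E -> exists2 y, y < x & u < F y.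
Proof.
move=> uF; apply: contrapT => no; move: uF; apply/negP; rewrite -leNgt.
pose G k := `]-oo, (x - k.+1%:R^-1)]%classic : set R.
have mG k : measurable (G k : set (measurableTypeR R)) by exact: measurable_itv.
have GE : `]-oo, x[%classic = \bigcup_k G k.
  apply/seteqP; split => y /=; rewrite in_itv/=.
    by move/ltr_add_invr => [k yk]; exists k => //; rewrite /G/= in_itv/= lerBrDr ltW.
  by move=> [k _]; rewrite /G/= in_itv/= => /le_lt_trans; apply; rewrite gtrBl invr_gt0.
have cv : nu \o G @ \oo --> nu `]-oo, x[%classic.
  rewrite GE; apply: nondecreasing_cvg_mu; [by []|exact: bigcupT_measurable|].
  move=> a b ab; apply/subsetPset; apply: subset_itvl; rewrite bnd_simp lerD2l lerN2.
  by rewrite lef_pV2 ?posrE// ler_nat.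
rewrite -(cvg_lim _ cv)//; apply: lime_le; first exact: cvgP cv.
apply: nearW => k /=; rewrite -FE lee_fin leNgt; apply/negP => uk.
by apply: no; exists (x - k.+1%:R^-1) => //; rewrite gtrBl invr_gt0.
Qed.

Lemma cdf_near1 u : u < 1 -> exists2 x, 0 <= x < 1 & u < F x.
Proof.
move=> u1; have [|y y1 uy] := @cdf_lc 1 u.
  rewrite (_ : nu _ = 1%E)// -nuT -(setUv `]-oo, 1[%classic) measureU0//.
    exact: measurableC.
  apply: (subset_measure0 _ _ _ nuC) => //; [exact: measurableC|exact: measurableC|].
  by move=> x /=; rewrite !in_itv/=; apply: contra_not => /andP[].
exists (Num.max 0 y); first by rewrite le_max lexx/= gt_max ltr01.
by rewrite (lt_le_trans uy)// Fmono// le_max lexx orbT.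
Qed.

Let Frc x u : (forall y, x < y -> u <= F y) -> u <= F x.
Proof.
move=> uF; rewrite -lee_fin FE.
pose G k := `]-oo, (x + k.+1%:R^-1)]%classic : set R.
have mG k : measurable (G k : set (measurableTypeR R)) by exact: measurable_itv.
have GE : `]-oo, x]%classic = \bigcap_k G k by rewrite (itvNycEbigcap false).
have cv : nu \o G @ \oo --> nu `]-oo, x]%classic.
  rewrite GE; apply: nonincreasing_cvg_mu.
  - by rewrite (le_lt_trans (nu_le (mG 0%N))) ?ltry.
  - by [].
  - exact: bigcapT_measurable.
  move=> a b ab; apply/subsetPset; apply: subset_itvl; rewrite bnd_simp lerD2l.
  by rewrite lef_pV2 ?posrE// ler_nat.
rewrite -(cvg_lim _ cv)//; apply: lime_ge; first exact: cvgP cv.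
by apply: nearW => k /=; rewrite -FE lee_fin uF// ltrDl invr_gt0.
Qed.

Hypothesis nu_diffuse : forall x, nu [set x] = 0%E.

Let Fopen x : nu `]-oo, x[%classic = (F x)%:E.
Proof.
by rewrite FE -(@setUitv1 _ _ -oo%O x true)// measureU0// nu_diffuse.
Qed.

Let F0 x : x <= 0 -> F x = 0.
Proof.
move=> x0; apply/EFin_inj; rewrite -Fopen.
apply: (subset_measure0 _ _ _ nuC) => //; first exact: measurableC.
move=> y /=; rewrite !in_itv/= => yx.
by case/andP => y0 _; move: (lt_le_trans yx x0); rewrite ltNge y0.
Qed.

Let F1 x : 1 <= x -> F x = 1.
Proof.
move=> x1; apply/EFin_inj; rewrite -nuT FE.
rewrite -(setUv `]-oo, x]%classic) measureU0//; first exact: measurableC.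
apply: (subset_measure0 _ _ _ nuC) => //; [exact: measurableC|exact: measurableC|].
move=> y /=; rewrite !in_itv/= => yx; apply: contra_not yx => /andP[_ y1].
by rewrite (le_trans (ltW y1)).
Qed.

Let Flc x u : u < F x -> exists2 y, y < x & u < F y.
Proof. by move=> uF; apply: cdf_lc; rewrite Fopen lte_fin. Qed.

Local Notation G := (gen_inverse rc F).

Let mF : measurable_fun [set: R] F.
Proof. exact: nondecreasing_measurable. Qed.

Lemma measurable_quantile : measurable_fun [set: R] G.
Proof.
apply: (@measurable_gen_inverse R rc _ R setT (fun=> F) id) => //.
Qed.

(** Within [[0, 1)], the event [G < x] lies between [[0, F x)] and [[0, F x]], which have the same
    length. So either inverse carries the uniform law to [nu]. *)
Lemma lebesgue_quantile (B : set R) : measurable B ->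
  lebesgue_measure (`[0, 1[%classic `&` G @^-1` B) = nu B.
Proof.
move=> mB; have m01 : measurable (`[0, 1[%classic : set (measurableTypeR R)) by [].
pose mG : measurable_fun setT (G : measurableTypeR R -> measurableTypeR R) := measurable_quantile.
rewrite setIC -[LHS]/(pushm (mrestr lebesgue_measure m01) mG B).
apply: (@measure_unique _ R (measurableTypeR R) (@RGenInftyO.G R)
  (fun k => `]-oo, k%:R[%classic)) => //.
- exact: RGenInftyO.measurableE.
- by move=> _ _ [x ->] [y ->]; exists (Num.min x y); apply/seteqP; split => z /=;
    rewrite !in_itv/= lt_min => /andP.
- by move=> k; exists k%:R.
- apply/seteqP; split => // x _; exists (Num.bound `|x|) => //=; rewrite in_itv/=.
  by rewrite (le_lt_trans (ler_norm x))// archi_boundP.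
- move=> _ [x ->]; rewrite Fopen pushmE /=/mrestr.
  have lebE b : lebesgue_measure [set` Interval (BLeft 0) (BSide b (F x))] = (F x)%:E.
    rewrite lebesgue_measure_itv/= lte_fin sube0; case: ltP => // Fx.
    by congr EFin; apply/eqP; rewrite eq_le F_ge0.
  have mGx : measurable (G @^-1` `]-oo, x[ `&` `[0, 1[%classic : set (measurableTypeR R)).
    apply: measurableI => //; exact: (measurable_preim mG).
  apply/eqP; rewrite eq_le; apply/andP; split.
    rewrite -(lebE false) le_measure ?inE// => u [] /=; rewrite !in_itv/= => Gx u01.
    by have /andP[-> _] := u01; exact: (gen_inverse_lt_le Fmono F0 F1 Flc u01 Gx).
  rewrite -(lebE true) le_measure ?inE// => u /=; rewrite !in_itv/= => /andP[u0 uF].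
  have u01 : 0 <= u < 1 by rewrite u0 (lt_le_trans uF).
  by split=> //; exact: (gen_inverse_lt rc F0 F1 Flc u01 uF).
- move=> k; rewrite pushmE (@le_lt_trans _ _ 1%E) ?ltry// /mrestr.
  rewrite (_ : 1%E = lebesgue_measure (`[0, 1[%classic : set R)); last first.
    by rewrite lebesgue_measure_itv/= lte_fin ltr01 sube0.
  apply: le_measure; rewrite ?inE//.
  apply: measurableI => //; exact: (measurable_preim mG).
Qed.

(** On [[0, 1)] the map is [rot 1 r], which preserves length and keeps every point in its unit
    cell. *)
Let lebesgue_mod1 r (A : set R) : measurable A ->
  lebesgue_measure (`[0, 1[%classic `&` [set u | A (mod1 (u + r))]) =
  lebesgue_measure (`[0, 1[%classic `&` A).
Proof.
move=> mA; have m01A : measurable (`[0, 1[%classic `&` A) by exact: measurableI.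
rewrite -(lebesgue_measure_rot r ltr01 m01A).
congr lebesgue_measure; apply/seteqP; split => u /=.
  move=> [u01 Au]; have u01' : 0 <= u < 1 by rewrite in_itv in u01.
  rewrite rot_fpart fpart_id// subrr add0r -mod1E; split=> //.
  by rewrite in_itv/= mod1E fpart_itv.
rewrite !in_itv/= => -[ru Au].
have u01 : 0 <= u < 1.
  move: (floor_rot r u ltr01); rewrite !divr1 (floor_def (m := 0)) ?add0r// => /esym/eqP.
  by rewrite floor_eq add0r.
move: Au; rewrite rot_fpart fpart_id// subrr add0r -mod1E => Au; split=> //.
Qed.

(** [G] carries the uniform law to [nu], and [F (G u) = u]; through [G] the shift becomes the
    rotation by [r] of [[0, 1)]. *)
Lemma quantile_shift r (B : set R) : measurable B ->
  nu [set x | B (G (mod1 (F x + r)))] = nu B.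
Proof.
move=> mB; set E := (E in nu E).
have mE : measurable E.
  apply: (measurable_preim _ mB); apply: (measurableT_comp measurable_quantile).
  have -> : (fun x => mod1 (F x + r)) = fpart 1 \o (fun x => F x + r).
    by apply/funext => x; rewrite mod1E.
  by apply: measurableT_comp; [exact: measurable_fpart|exact: measurable_funD].
rewrite -lebesgue_quantile// -[RHS]lebesgue_quantile//.
rewrite -[RHS](lebesgue_mod1 r (measurable_preim measurable_quantile mB)).
have FK u : 0 <= u < 1 -> F (G u) = u by exact: (gen_inverseK rc Fmono F0 F1 Flc Frc).
by congr lebesgue_measure; apply/seteqP; split => u /=; rewrite in_itv/= => -[u01];
  rewrite /E/= FK.
Qed.

(** Here [r] is the random variable: [a + r] modulo 1 is uniform for every [a], and [G] turns it
    into a point of law [nu]. *)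
Lemma lebesgue_quantile_shift a (B : set R) : measurable B ->
  lebesgue_measure (`[0, 1[%classic `&` [set r | B (G (mod1 (a + r)))]) = nu B.
Proof.
move=> mB; rewrite -lebesgue_quantile//.
rewrite -(lebesgue_mod1 a (measurable_preim measurable_quantile mB)).
by congr (lebesgue_measure (_ `&` _)); apply/seteqP; split => r /=; rewrite addrC.
Qed.

End distribution_function.

Lemma measurable_set1_rV (R : realType) d (t : 'rV[R]_d) : measurable [set t].
Proof.
rewrite -[X in measurable X]setCK; apply: measurableC; apply: measurable_open_rV.
exact/closed_openC/accessible_closed_set1/hausdorff_accessible/norm_hausdorff.
Qed.

Section resampling_shift.
Context (R : realType) (d n : nat).
Notation rV := 'rV[R]_d.
Notation lf := (lf_measure R d).
Local Notation box := (@box R d n).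

(* What is needed of a Borel isomorphism of [0, n)^d and [0, 1): phi need not
   be onto. *)
Definition box_code (phi : rV -> R) (g : R -> rV) : Prop :=
  [/\ {homo phi : x / box x >-> `[0, 1[%classic x},
      {homo g : x / `[0, 1[%classic x >-> box x},
      forall x, box x -> g (phi x) = x &
      measurable_fun box phi /\ measurable_fun (`[0, 1[%classic : set R) g].

Lemma borel_isomorphism_code phi g :
  borel_isomorphism box (`[0, 1[%classic : set R) phi g -> box_code phi g.
Proof. by case. Qed.

(** [psi] evaluates the measure on Borel sets only, so [cond_measure] can be exchanged for the
    bundled [lf_cond], with which it agrees there. *)
Lemma psi_ext phi g rc r (mu mu' : set rV -> \bar R) x : box_code phi g ->
  (forall A, measurable A -> mu A = mu' A) ->
  psi n phi g rc r mu x = psi n phi g rc r mu' x.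
Proof.
case=> _ _ _ [mphi _] E; rewrite /psi (_ : cdf_along n phi mu = cdf_along n phi mu')//.
apply/funext => y; rewrite /cdf_along E//.
have := mphi (@measurable_box R d n) `]-oo, y]%classic (measurable_itv _).
by congr measurable; apply/seteqP; split => z /= [bz]; rewrite in_itv.
Qed.

Variables (phi : rV -> R) (g : R -> rV) (rc : bool).
Hypothesis code : box_code phi g.

Let mbox : measurable box. Proof. exact: measurable_box. Qed.

(** [phi] is controlled on the box only; extended by 0 it is measurable everywhere, so measures can
    be pushed along it. *)
Let phi0 : rV -> measurableTypeR R := patch (fun=> 0) box phi.

Let phi0E x : box x -> phi0 x = phi x.
Proof. by move=> bx; rewrite /phi0 patchE mem_set. Qed.

Let mphi0 : measurable_fun setT phi0.
Proof. by apply/measurable_restrict => //; rewrite setTI; case: code => _ _ _ []. Qed.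

Let measurable_code_set (B : set R) : measurable B -> measurable (box `&` phi @^-1` B).
Proof. by move=> mB; case: code => _ _ _ [mphi _]; exact: mphi. Qed.

Section one_measure.
Variable mu : {measure set rV -> \bar R}.
Hypothesis mu_box : mu box = 1%E.

Let nu : {measure set (measurableTypeR R) -> \bar R} := pushm (mrestr mu mbox) mphi0.

Let nuE (B : set R) : nu B = mu (box `&` phi @^-1` B).
Proof.
rewrite /nu pushmE /= /mrestr setIC; congr (mu _).
by apply/seteqP; split => x /= [bx]; rewrite phi0E.
Qed.

Let nuT : nu setT = 1%E. Proof. by rewrite nuE preimage_setT setIT. Qed.

Let nuC : nu (~` `[0, 1[%classic) = 0%E.
Proof.
rewrite nuE (_ : _ `&` _ = set0) ?measure0//; apply/seteqP; split => // x [bx].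
by case: code => /(_ x bx) + _ _ _ => px; apply.
Qed.

Let cdfE : cdf_along n phi mu = (fun x => fine (nu `]-oo, x]%classic)).
Proof.
by apply/funext => x; rewrite nuE; congr (fine (mu _)); apply/seteqP; split => y /=;
  rewrite in_itv.
Qed.

Let mod1_itv (x : R) : 0 <= mod1 x < 1.
Proof. by rewrite mod1E fpart_itv. Qed.

Lemma quantile_itv r x :
  0 <= gen_inverse rc (cdf_along n phi mu) (mod1 (cdf_along n phi mu (phi x) + r)) < 1.
Proof.
rewrite cdfE; set u := mod1 _; have /andP[u0 u1] : 0 <= u < 1 by exact: mod1_itv.
have [y y01 uy] := cdf_near1 nuT nuC u1; exact: (gen_inverse_itv rc y01 uy).
Qed.

Lemma psi_box r x : box (psi n phi g rc r mu x).
Proof. by case: code => _ gb _ _; apply: gb; rewrite /= in_itv; exact: quantile_itv. Qed.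

Hypothesis mu_diffuse : forall t, mu [set t] = 0%E.

Let nu_diffuse x : nu [set x] = 0%E.
Proof.
have mx : measurable (box `&` phi @^-1` [set x]) by exact: measurable_code_set.
rewrite nuE; apply: (subset_measure0 mx _ _ (mu_diffuse (g x))).
  exact: measurable_set1_rV.
by move=> y [by_ /= <-]; case: code => _ _ -> .
Qed.

(** Test sets of the box are transported to the line through [g]; the masses agree because
    [g (phi x) = x] on the box. *)
Let nu_code (B : set rV) : measurable B ->
  exists B' : set R, [/\ measurable B', nu B' = mu (box `&` B) &
    forall u, 0 <= u < 1 -> B' u <-> B (g u)].
Proof.
case: code => phib gb gK [_ mg] mB.
exists (`[0, 1[%classic `&` g @^-1` B); split; first exact: mg.
- rewrite nuE; congr (mu _); apply/seteqP; split => x [bx] /=; first by rewrite gK// => -[].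
  by move=> Bx; rewrite gK//; split => //; split=> //; exact: phib.
- by move=> u u01; split=> [[]//|]; split=> //=; rewrite in_itv.
Qed.

Lemma psi_preserving r (B : set rV) : measurable B ->
  mu (box `&` psi n phi g rc r mu @^-1` B) = mu (box `&` B).
Proof.
move=> mB; have [B' [mB' <- B'E]] := nu_code mB.
have <- : nu [set x | B' (gen_inverse rc (cdf_along n phi mu) (mod1 (cdf_along n phi mu x + r)))] = nu B'.
  by rewrite cdfE; exact: quantile_shift.
rewrite nuE.
congr (mu _); apply/seteqP; split => x [bx] h; split=> //; [exact: (iffRL (B'E _ (quantile_itv r x)) h)|exact: (iffLR (B'E _ (quantile_itv r x)) h)].
Qed.

Lemma psi_average x (B : set rV) : measurable B ->
  lebesgue_measure (`[0, 1[%classic `&` [set r | B (psi n phi g rc r mu x)]) = mu (box `&` B).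
Proof.
move=> mB; have [B' [mB' <- B'E]] := nu_code mB.
have <- : lebesgue_measure (`[0, 1[%classic `&`
    [set r | B' (gen_inverse rc (cdf_along n phi mu) (mod1 (cdf_along n phi mu (phi x) + r)))]) = nu B'.
  by rewrite cdfE; exact: lebesgue_quantile_shift.
congr lebesgue_measure; apply/seteqP; split => r [r01] h; split=> //; [exact: (iffRL (B'E _ (quantile_itv r x)) h)|exact: (iffLR (B'E _ (quantile_itv r x)) h)].
Qed.

End one_measure.

Lemma measurable_psi dT (T : measurableType dT) (D : set T) (r : T -> R) (k : T -> lf) (u : T -> rV) :
  measurable_fun setT r -> measurable_fun setT k -> measurable_fun setT u -> measurable D ->
  (forall z, D z -> box (u z) /\ k z box = 1%E) ->
  measurable_fun D (fun z => psi n phi g rc (r z) (k z) (u z)).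
Proof.
move=> mr mk mu mD hD; case: code => phib _ _ [_ mg].
pose F z := cdf_along n phi (k z); pose v z := mod1 (F z (phi (u z)) + r z).
  have mle x : measurable (box `&` [set y | phi y <= x]).
    rewrite (_ : [set y | phi y <= x] = phi @^-1` `]-oo, x]%classic); first exact: measurable_code_set.
    by apply/seteqP; split => y /=; rewrite in_itv.
have mF x : measurable_fun D (F^~ x).
  apply: (measurableT_comp (fine_measurable measurableT)); apply: measurable_funTS.
  exact: (measurableT_comp (measurable_lf_eval (mle x)) mk).
have Fmono z : {homo F z : x y / x <= y}.
  have fin x : k z (box `&` [set y | phi y <= x]) \is a fin_num.
    rewrite ge0_fin_numE// (@le_lt_trans _ _ (k z box))//; last by apply: lf_fin => //; exact: bounded_box.
    by rewrite le_measure ?inE//.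
  move=> x y xy; apply: fine_le => //; apply: le_measure; rewrite ?inE//.
  by move=> w [bw] wx; split=> //; exact: le_trans xy.
have mv : measurable_fun D v.
  have -> : v = fpart 1 \o (fun z => F z (phi (u z)) + r z).
    by apply/funext => z; rewrite /v mod1E.
  apply: (measurableT_comp (measurable_fpart 1)); apply: measurable_funD; last exact: measurable_funTS.
  (* The argument [phi (u z)] of the distribution function varies with [z], so its value is obtained
     as the mass of a section of a measurable set of the product. *)
  pose A := [set q : T * rV | box q.2 /\ phi0 q.2 <= phi0 (u q.1)].
  have mA : measurable A.
    apply: measurableI; first exact: (measurable_preim measurable_snd mbox).
    have mle2 : measurable_fun setT (fun q : T * rV => phi0 q.2 <= phi0 (u q.1) :> R).
      apply: measurable_fun_ler; first exact: (measurableT_comp mphi0 measurable_snd).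
      exact: (measurableT_comp mphi0 (measurableT_comp mu measurable_fst)).
    exact: (measurable_preim mle2 (_ : measurable [set true])).
  have mE : measurable_fun D (fun z => fine (k z (xsection A z))).
    apply: (measurableT_comp (fine_measurable measurableT)); apply: measurable_funTS.
    exact: measurable_lf_xsection.
  apply: (eq_measurable_fun _ _ mE) => z; rewrite inE => /hD[bz _].
  congr (fine (k z _)); rewrite xsection_set.
  have E y : box y -> (phi0 y <= phi0 (u z) :> R) = (phi y <= phi (u z)).
    by move=> by_; rewrite !phi0E.
  apply/seteqP; split => y [by_ h]; split => //; first exact: (etrans (esym (E _ by_)) h).
  exact: (etrans (E _ by_) h).
apply: (@measurable_comp _ _ _ _ _ _ (`[0, 1[%classic : set R) g D
  (fun z => gen_inverse rc (F z) (v z))) => //.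
  by move=> _ [z /hD[bz kz] <-]; rewrite /= in_itv; exact: quantile_itv.
exact: measurable_gen_inverse.
Qed.

End resampling_shift.

(** * Box fields *)

Section box_fields.
Context (R : realType) (d n : nat).
Hypothesis n_gt0 : (0 < n)%N.
Notation rV := 'rV[R]_d.
Local Notation box := (@box R d n).
Implicit Types (t x y : rV).

Let nR_gt0 : 0 < n%:R :> R. Proof. by rewrite ltr0n. Qed.

Lemma torus_action : measurable_action (@torus R n%:R d).
Proof.
split=> [x|s t x|].
- by apply/rowP => i; rewrite !mxE rot0.
- by apply/rowP => i; rewrite !mxE rotD.
apply: measurable_fun_rV => i.
have -> : (fun z : rV * rV => torus n%:R z.1 z.2 0 i : R) =
    (fun z : R * R => rot n%:R z.1 z.2) \o (fun z : rV * rV => (z.1 0 i : R, z.2 0 i : R)).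
  by apply/funext => z; rewrite mxE.
apply: (measurableT_comp (@measurable_rot2 R n%:R)); apply: measurable_fun_pair.
  exact: (measurableT_comp (measurable_coord i) measurable_fst).
exact: (measurableT_comp (measurable_coord i) measurable_snd).
Qed.

Let rot_itv (s x : R) : 0 <= x < n%:R -> rot n%:R s x = fpart n%:R (x + s).
Proof. by move=> x0; rewrite rot_fpart fpart_id// subrr add0r. Qed.

Lemma torus_box t x : box x -> box (torus n%:R t x).
Proof. by move=> bx i; rewrite mxE rot_itv ?fpart_itv//; exact: bx. Qed.

Lemma torus_sub x y : box x -> box y -> torus n%:R (y - x) x = y.
Proof.
move=> bx by_; apply/rowP => i; rewrite !mxE rot_itv; last exact: bx.
by rewrite (addrC (x 0 i)) subrK fpart_id//; exact: by_.
Qed.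

Lemma torus_floor t x : box x -> torus n%:R t x =
  x + t - \row_i (n%:R * (Num.floor ((x 0 i + t 0 i) / n%:R))%:~R).
Proof. by move=> bx; apply/rowP => i; rewrite !mxE rot_itv//; exact: bx. Qed.

(** The only box field with value [x] at 0, for [x] in the box. Shifting the field translates this
    value on the torus. *)
Definition torus_field x : random_field R d := fun s => torus n%:R s x.

Lemma measurable_torus_field : measurable_fun setT torus_field.
Proof.
apply: (measurability (@field_cylinders R d : set_system (random_field R d))) => //.
move=> _ [_ [s _ [B mB <-]] <-]; rewrite setTI setTI.
have [_ _ mt] := torus_action.
exact: (measurable_preim (measurableT_comp mt (pair1_measurable s)) mB).
Qed.

Lemma field_shift_torus t x : field_shift t (torus_field x) = torus_field (torus n%:R t x).
Proof.
apply/funext => s; rewrite /field_shift /torus_field.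
by have [_ tD _] := torus_action; rewrite addrC tD.
Qed.

Lemma torus_field0 x : torus_field x 0 = x.
Proof. by have [t0 _ _] := torus_action; exact: t0. Qed.

Lemma box_field_torus x : box x -> box_field n (torus_field x).
Proof.
move=> bx s; exists (fun i => Num.floor ((x 0 i + s 0 i) / n%:R)) => /=.
rewrite torus_field0; set c := _ - x.
have -> : s - c = torus_field x s.
  rewrite /torus_field torus_floor// /c opprB addrA [s + x]addrC; congr (_ - _).
  by apply/rowP => i; rewrite !mxE intrM.
by split=> //; exact: torus_box.
Qed.

(** [s - corner] is congruent to [y 0 + s] modulo [n] and lies in the box, hence is its residue. *)
Lemma box_fieldP (y : random_field R d) : box_field n y -> box (y 0) /\ y = torus_field (y 0).
Proof.
move=> by_; have y0 : box (y 0) by have [k [h ->]] := by_ 0.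
split=> //; apply/funext => s; have [k [h yE]] := by_ s.
rewrite yE; apply/rowP => i; have c0 := h i; rewrite /torus_field [RHS]mxE rot_itv; last exact: y0.
set c := (s - _) 0 i in c0 *; rewrite -(fpart_id nR_gt0 c0) -[RHS](fpart_period _ (- k i)) ?ltr0n//.
by congr fpart; rewrite /c !mxE !intrM intrN; ring.
Qed.

(** The phantom proof of [0 < n] keeps in the term what makes it a probability, so that this
    structure can be declared on it. *)
Definition uniform_box of (0 < n)%N : set rV -> \bar R := lf_cond (lebesgue_lf R d) (@measurable_box R d n).

HB.instance Definition _ := Measure.on (uniform_box n_gt0).

Let uniform_boxT : uniform_box n_gt0 setT = 1%E.
Proof. exact: (cond_lebesgueT (@measurable_box R d n) (@bounded_box R d n) (lebesgue_box_gt0 R d n_gt0)). Qed.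

HB.instance Definition _ := Measure_isProbability.Build _ _ _ (uniform_box n_gt0) uniform_boxT.

Lemma uniform_boxE : uniform_box n_gt0 = cond_measure (@lebesgue_rV R d) box.
Proof.
have fin : lebesgue_rV box \is a fin_num.
  by rewrite ge0_fin_numE//; apply: lebesgue_rV_bounded; [exact: measurable_box|exact: bounded_box].
apply/funext => A; rewrite /uniform_box /cond_measure lf_restrE muleC; congr *%E.
rewrite -[in RHS](fineK fin) inver fine_eq0// gt_eqF ?lebesgue_box_gt0//=.
by rewrite ger0_norm// invr_ge0 fine_ge0.
Qed.

Lemma uniform_box_torus t A : measurable A ->
  uniform_box n_gt0 (torus n%:R t @^-1` A) = uniform_box n_gt0 A.
Proof.
move=> mA; rewrite /uniform_box !lf_restrE; congr *%E.
have mAb : measurable (A `&` box) by apply: measurableI => //; exact: measurable_box.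
rewrite -[RHS](lebesgue_rV_torus t nR_gt0 mAb); congr lebesgue_rV.
apply/seteqP; split => x [Ax bx]; split => //; first exact: torus_box.
have [t0 tD _] := torus_action.
by rewrite -(t0 x) -(addNr t) tD; exact: torus_box.
Qed.

End box_fields.

Lemma measurable_fun_mem dT (T : measurableType dT) dU (U : measurableType dU) (A : set U)
    (f : T -> U) : measurable A -> measurable_fun setT f ->
  measurable_fun setT (fun z => f z \in A).
Proof.
move=> mA mf; apply: (measurable_fun_bool true); rewrite setTI.
rewrite (_ : _ @^-1` _ = f @^-1` A); first exact: measurable_preim.
by apply/seteqP; split => z; [exact: set_mem|exact: mem_set].
Qed.

(** * Box shifts as measurable functions of a location and a measure *)

Section resampling.
Context (R : realType) (d n : nat).
Notation rV := 'rV[R]_d.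
Notation lf := (lf_measure R d).
Local Notation box := (@box R d n).
Variables (phi : rV -> R) (g : R -> rV) (rc : bool).
Hypothesis code : box_code n phi g.

Let mbox : measurable box. Proof. exact: measurable_box. Qed.

Definition box_measure (q : rV * lf) : lf := lf_shift (- q.1) q.2.

Lemma measurable_box_measure : measurable_fun setT box_measure.
Proof. by apply: measurable_lf_shift => //; exact: measurable_funN_rV. Qed.

Definition box_law (q : rV * lf) : lf := lf_cond (box_measure q) mbox.

Lemma measurable_box_law : measurable_fun setT box_law.
Proof.
apply: measurable_fun_lf => B mB; apply: emeasurable_funM; last first.
  exact: (measurableT_comp (measurable_lf_eval (measurableI _ _ mB mbox)) measurable_box_measure).
apply/measurable_EFinP; apply: measurableT_comp => //.
apply: (measurableT_comp (@measurable_invr R)).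
apply: (measurableT_comp (@fine_measurable R setT measurableT)).
exact: (measurableT_comp (measurable_lf_eval mbox) measurable_box_measure).
Qed.

Lemma box_lawE q B : measurable B ->
  box_law q B = cond_measure (box_measure q) box B.
Proof. by move=> mB; apply: lf_condE => //; exact: bounded_box. Qed.

Lemma box_law_box q : box_measure q box != 0%E -> box_law q box = 1%E.
Proof.
move=> q0; rewrite box_lawE// /cond_measure setIid divee// ge0_fin_numE//.
by apply: lf_fin => //; exact: bounded_box.
Qed.

Lemma box_law_diffuse q t : diffuse q.2 -> box_law q [set t] = 0%E.
Proof.
move=> dq; have mt := measurable_set1_rV t; rewrite box_lawE// /cond_measure.
rewrite (_ : box_measure q _ = 0%E) ?mul0e//.
apply: (subset_measure0 _ mt); [exact: measurableI|exact: subIsetl|].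
rewrite -[LHS]/(q.2 [set x | [set t] (x - - q.1)]).
rewrite (_ : [set x | _] = [set t + - q.1]) ?dq//.
apply/seteqP; split => x /=; rewrite opprK; first by move=> <-; rewrite addrK.
by move=> ->; rewrite subrK.
Qed.

(** The box shift sees the field through its value at 0 only. The two tests confine [psi] to pairs
    where [box_law] has mass 1 and the location is in the box, which gives a measurable function on
    the whole space. *)
Definition resample r (q : rV * lf) : rV :=
  if (q.1 \in box) && (box_measure q box != 0%E)
  then psi n phi g rc r (box_law q) q.1 - q.1 else 0.

Lemma box_shiftE r (y : random_field R d) m : box (y 0) ->
  box_shift n phi g rc r y m = resample r (y 0, m).
Proof.
move=> y0; rewrite /box_shift /resample mem_set//= -/(box_measure (y 0, m)).
case: eqP => // _; congr (_ - _); apply: (psi_ext rc r (y 0) code) => A mA.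
exact: (esym (box_lawE (y 0, m) mA)).
Qed.

Lemma measurable_resample dT (T : measurableType dT) (r : T -> R) (q : T -> rV * lf) :
  measurable_fun setT r -> measurable_fun setT q ->
  measurable_fun setT (fun z => resample (r z) (q z)).
Proof.
move=> mr mq; have mq1 := measurableT_comp measurable_fst mq.
have mm : measurable_fun setT (fun z => box_measure (q z) box).
  exact: (measurableT_comp (measurableT_comp (measurable_lf_eval mbox) measurable_box_measure) mq).
have mc : measurable_fun setT (fun z => ((q z).1 \in box) && (box_measure (q z) box != 0%E)).
  apply: measurable_and; first exact: measurable_fun_mem.
  apply: (measurable_fun_bool true); exact: emeasurable_neq.
apply: measurable_fun_if => //; rewrite setTI; apply: measurable_funB_rV; last exact: measurable_funTS.
apply: (measurable_psi rc code (k := fun z => box_law (q z))) => //.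
- exact: (measurableT_comp measurable_box_law mq).
- exact: (measurable_preim mc).
- by move=> z /= /andP[]; rewrite inE => ? /box_law_box.
Qed.

End resampling.

Section diffuse_measures.
Context (R : realType) (d : nat).
Notation rV := 'rV[R]_d.
Notation lf := (lf_measure R d).

Lemma measurable_diffuse : measurable [set m : lf | diffuse m].
Proof.
have mk : measurable_fun setT (fst : lf * rV -> lf) by [].
pose A := [set q : (lf * rV) * rV | q.2 = q.1.2].
have mA : measurable A.
  rewrite (_ : A = (fun q => q.2 - q.1.2) @^-1` [set 0]).
    apply: (measurable_preim _ (measurable_set1_rV 0)).
    apply: measurable_funB_rV => //; exact: (measurableT_comp measurable_snd measurable_fst).
  by apply/seteqP; split => q /= => [->|/subr0_eq//]; rewrite subrr.
have mf : measurable_fun setT (fun q : lf * rV => q.1 [set q.2]).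
  have := measurable_lf_xsection mk mA; congr (measurable_fun _).
  by apply/funext => q; rewrite xsection_set.
(* I m is the sum of the squared masses of the atoms of m. *)
pose I (m : lf) := (\int[m]_t m [set t])%E.
have mI : measurable_fun setT I.
  by apply: (@measurable_lf_integral R d _ lf id _ (fun q : lf * rV => q.1 [set q.2])).
rewrite (_ : [set m | _] = I @^-1` [set 0%E]); first exact: (measurable_preim mI).
apply/seteqP; split => m /=; first by move=> dm; rewrite /I integral0_eq.
move=> I0 t; apply/eqP; rewrite -measure_le0 leNgt; apply/negP => mt.
have : (m [set t] * m [set t] <= I m)%E.
  have mt1 := measurable_set1_rV t.
  rewrite -(integral_cst m mt1 (m [set t])).
  rewrite (eq_integral (fun s => m [set s])); last by move=> s; rewrite inE => ->.
  apply: ge0_subset_integral => //.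
  exact: (measurableT_comp mf (pair1_measurable m)).
by rewrite I0 leNgt mule_gt0.
Qed.

End diffuse_measures.

Lemma measurable_field_eval (R : realType) d (s : 'rV[R]_d) :
  measurable_fun setT (fun y : random_field R d => y s).
Proof.
move=> _ B mB; rewrite setTI; apply: sub_gen_smallest; exists s => //.
by exists B => //; rewrite setTI.
Qed.

Section box_shift_of_general.
Context (R : realType) (d n : nat).
Hypothesis n_gt0 : (0 < n)%N.
Notation rV := 'rV[R]_d.
Notation lf := (lf_measure R d).
Local Notation box := (@box R d n).
Variables (phi : rV -> R) (g : R -> rV) (rc : bool) (r : R).
Hypothesis code : box_code n phi g.

Let nR_gt0 : 0 < n%:R :> R. Proof. by rewrite ltr0n. Qed.

Let mbox : measurable box. Proof. exact: measurable_box. Qed.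

Lemma diffuse_shift s (m : lf) : diffuse m -> diffuse (lf_shift s m).
Proof.
move=> dm t; rewrite lf_shiftE (_ : [set x | _] = [set t + s])//.
apply/seteqP; split => x /=; first by move=> <-; rewrite subrK.
by move=> ->; rewrite addrK.
Qed.

(* Atoms have to be excluded for the shift to be preserving at every value. *)
Definition diffuse_resample (q : rV * lf) : rV :=
  if q.2 \in [set m | diffuse m] then resample n phi g rc r q else 0.

Lemma measurable_diffuse_resample : measurable_fun setT diffuse_resample.
Proof.
apply: measurable_fun_ifT => //.
  by apply: measurable_fun_mem => //; exact: measurable_diffuse.
exact: measurable_resample.
Qed.

Lemma psi_box_law (q : rV * lf) (B : set rV) : diffuse q.2 -> box_measure q box != 0%E ->
  measurable B ->
  box_measure q (box `&` psi n phi g rc r (box_law n q) @^-1` B) = box_measure q (box `&` B).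
Proof.
move=> dq q0 mB.
have := psi_preserving rc code (box_law_box q0) (fun t => box_law_diffuse n t dq) r mB.
rewrite !lf_restrE ![_ `&` box]setIC !setIA !setIid /=.
move: (box_measure q (_ `&` _)) (box_measure q (_ `&` _)) => a b.
have c0 : fine (box_measure q box) != 0.
  by rewrite fine_eq0// ge0_fin_numE//; apply: lf_fin => //; exact: bounded_box.
move/(congr1 (fun e => (`|(fine (box_measure q box))^-1|^-1%:E * e)%E)).
by rewrite !muleA -!EFinM mulVf ?normr_eq0 ?invr_eq0// !mul1e.
Qed.

(** The boxes of the grid fixed by [y] partition R^d. On each of them [tau] is the quantile shift of
    [m] on that box, which maps the box into itself and preserves [m] there. *)
Lemma diffuse_resample_preserving y m : box y -> preserving (@torus R n%:R d) diffuse_resample y m.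
Proof.
move=> by_ tau B mB.
(* Every shift of a measure with an atom has an atom, so [tau] is then the identity. *)
have [dm|ndm] := pselect (diffuse m); last first.
  rewrite (_ : tau @^-1` B = B)//; apply/seteqP; split => s /=;
    rewrite /tau /diffuse_resample memNset ?addr0//=;
    apply: contra_not ndm => /(diffuse_shift (- s)); by rewrite -lf_shiftD addNr lf_shift0.
(* [k s] is the index of the box that contains [s], and [c i] is the lowest corner of box [i]. *)
pose k (s : rV) : 'rV[int]_d := \row_i Num.floor ((y 0 i + s 0 i) / n%:R).
pose c (i : 'rV[int]_d) : rV := \row_j (n%:R * (i 0 j)%:~R) - y.
have kP s i : k s = i <-> box (s - c i).
  have cE j : (s - c i) 0 j = y 0 j + s 0 j - n%:R * (i 0 j)%:~R.
    by rewrite /c !mxE; ring.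
  split=> [ki j|bs].
    by rewrite cE -ki mxE; exact: fpart_itv.
  apply/rowP => j; rewrite mxE; apply: floor_def.
  have := bs j; rewrite cE ler_pdivlMr// ltr_pdivrMr// intrD1 mulrDl mul1r mulrC.
  by rewrite subr_ge0 ltrBlDl.
have torusE s : torus n%:R s y = s - c (k s).
  rewrite torus_floor// /c opprB addrA [s + y]addrC; congr (_ - _).
  by apply/rowP => j; rewrite !mxE.
have tauE s : tau s = s + resample n phi g rc r (s - c (k s), lf_shift s m).
  by rewrite /tau /diffuse_resample torusE mem_set//; exact: diffuse_shift.
(* Moved to [[0, n)^d], the measure on box [i] is the same from every [s]; hence one quantile map
   serves the whole box. *)
have measE s i : box_measure (s - c i, lf_shift s m) = lf_shift (c i) m.
  by rewrite /box_measure -lf_shiftD opprB subrK.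
have mtau : measurable_fun setT tau.
  have [_ _ mt] := torus_action R d n_gt0; have [_ _ ms] := @measurable_lf_shift_action R d.
  apply: measurable_funD_rV; first exact: measurable_id.
  apply: (measurableT_comp measurable_diffuse_resample); apply: measurable_fun_pair.
    exact: (measurableT_comp mt (pair2_measurable y)).
  exact: (measurableT_comp ms (pair2_measurable m)).
have mk i : measurable (k @^-1` [set i]).
  rewrite (_ : _ @^-1` _ = (fun s => s - c i) @^-1` box).
    exact: (measurable_preim (mx_subr_measurable _)).
  by apply/seteqP; split => s /= /kP.
apply: (measure_eq_partition (I := 'rV[int]_d) mk mk (measurable_preim mtau mB) mB) => i.
have madd : measurable_fun [set: rV] (fun v => v + c i).
  by apply: measurable_funD_rV => //; exact: measurable_id.
pose q := (0 : rV, lf_shift (c i) m).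
have shiftE A : m (A `&` k @^-1` [set i]) = box_measure q (box `&` [set v | A (v + c i)]).
  have -> : box_measure q = lf_shift (c i) m by rewrite /box_measure oppr0 lf_shift0.
  rewrite lf_shiftE; congr (lf_val m _); apply/seteqP; split => s /=.
    by move=> [As /kP bs]; rewrite subrK.
  by rewrite subrK => -[bs As]; split=> //; apply/kP.
rewrite !shiftE.
have [q0|q0] := eqVneq (box_measure q box) 0%E.
  have null A : measurable A -> box_measure q (box `&` A) = 0%E.
    by move=> mA; apply: (subset_measure0 _ mbox _ q0); [exact: measurableI|exact: subIsetl].
  rewrite (null _ (measurable_preim madd (measurable_preim mtau mB))).
  by rewrite (null _ (measurable_preim madd mB)).
rewrite -[RHS](psi_box_law (diffuse_shift (c i) dm : diffuse q.2) q0 (measurable_preim madd mB)).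
have tau_cell v : box v -> tau (v + c i) = psi n phi g rc r (box_law n q) v + c i.
  move=> bv; have ki : k (v + c i) = i by apply/kP; rewrite addrK.
  have qE : box_measure (v, lf_shift (v + c i) m) = box_measure q.
    by have := measE (v + c i) i; rewrite addrK => ->; rewrite /box_measure oppr0 lf_shift0.
  have bv' : (v, lf_shift (v + c i) m).1 \in box by rewrite mem_set.
  rewrite tauE ki addrK /resample bv' qE q0 /box_law qE /=.
  by rewrite addrC addrA subrK.
by congr (lf_val _ _); apply/seteqP; split => v [bv] /=; rewrite tau_cell.
Qed.

Context (dO : measure_display) (O : measurableType dO)
  (P : {measure set O -> \bar R}) (dE : measure_display) (E : measurableType dE).
Variables (theta : rV -> E -> E) (X : O -> E) (xi : O -> lf).
Hypotheses (htheta : measurable_action theta)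
  (mX : measurable_fun setT X) (mxi : measurable_fun setT xi)
  (hdiffuse : {ae P, forall w, diffuse (xi w)}).

(** The general invariance is used for the background [Y_0] on the torus and the shift
    [diffuse_resample], and carried to the field by [torus_field]. As xi is diffuse almost
    everywhere, this shift differs from [box_shift] on a null set only. *)
Lemma box_shift_invariant_of_general :
  invariant_under_preserving_shifts P theta X xi ->
  box_shift_invariant n phi g rc r P theta X xi.
Proof.
move=> inv dO' O' P' p Y [[mp pP] mY bY indep] t A mA.
have bY0 w : box (Y w 0) by have [] := box_fieldP n_gt0 (bY w).
have mY0 : measurable_fun setT (fun w => Y w 0) by exact: (measurableT_comp (measurable_field_eval 0) mY).
have bg : stationary_independent_background P X xi P' p (@torus R n%:R d) (fun w => Y w 0).
  split => //; first exact: torus_action.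
  exists (@uniform_box R d n n_gt0); split; first exact: uniform_box_torus.
  by move=> B mB; have := indep B mB; rewrite -(uniform_boxE R d n_gt0).
have mxp : measurable_fun setT (fun w => xi (p w)) by exact: (measurableT_comp mxi mp).
have mXp : measurable_fun setT (fun w => X (p w)) by exact: (measurableT_comp mX mp).
have YE w : Y w = torus_field n (Y w 0) by have [] := box_fieldP n_gt0 (bY w).
have tE w : t w = resample n phi g rc r (Y w 0, xi (p w)) by exact: box_shiftE.
(* The test set on fields, read as a test on the value at 0. *)
pose A' := (fun z : rV * E * lf => (torus_field n z.1.1, z.1.2, z.2)) @^-1` A.
have mA' : measurable A'.
  apply: (measurable_preim _ mA); apply: measurable_fun_pair => //.
  apply: measurable_fun_pair; last exact: (measurableT_comp measurable_snd measurable_fst).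
  exact: (measurableT_comp (measurable_torus_field n_gt0)
    (measurableT_comp measurable_fst measurable_fst)).
pose W (s : rV * lf -> rV) w := (torus n%:R (s (Y w 0, xi (p w))) (Y w 0),
  theta (s (Y w 0, xi (p w))) (X (p w)), lf_shift (s (Y w 0, xi (p w))) (xi (p w))).
have mW s : measurable_fun setT s -> measurable (W s @^-1` A').
  move=> ms; have ms' : measurable_fun setT (fun w => s (Y w 0, xi (p w))).
    by apply: (measurableT_comp ms); exact: measurable_fun_pair.
  have [_ _ mto] := torus_action R d n_gt0; have [_ _ mth] := htheta.
  apply: (measurable_preim _ mA'); apply: measurable_fun_pair; last exact: measurable_lf_shift.
  apply: measurable_fun_pair; first exact: (measurableT_comp mto (measurable_fun_pair ms' mY0)).
  exact: (measurableT_comp mth (measurable_fun_pair ms' mXp)).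
have mr : measurable_fun setT (resample n phi g rc r) by exact: measurable_resample.
transitivity (P' (W (resample n phi g rc r) @^-1` A')).
  have fE w : field_shift (t w) (Y w) = torus_field n (torus n%:R (t w) (Y w 0)).
    by rewrite {1}(YE w) field_shift_torus.
  by congr (P' _); apply/seteqP; split => w /=; rewrite fE tE.
transitivity (P' (W diffuse_resample @^-1` A')); last first.
  rewrite -[LHS]/(pushforward P' (W diffuse_resample) A').
  rewrite (inv _ _ _ _ _ _ _ _ _ bg measurable_diffuse_resample
    (fun w => diffuse_resample_preserving (xi (p w)) (bY0 w)) A' mA').
  by congr (P' _); apply/seteqP; split => w; rewrite /= /A' /= -YE.
case: hdiffuse => N [mN N0 diffN].
have mpN : measurable (p @^-1` N) by exact: measurable_preim.
have pN0 : P' (p @^-1` N) = 0%E by rewrite -[LHS]/(pushforward P' p N) pP.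
have off B : measurable B -> P' B = P' (B `\` p @^-1` N).
  move=> mB; rewrite (measureDI P' mB mpN) [X in (_ + X)%E](_ : _ = 0%E) ?adde0//.
  exact: (subset_measure0 (measurableI _ _ mB mpN) mpN (@subIsetr _ _ _) pN0).
rewrite (off _ (mW _ mr)) (off _ (mW _ measurable_diffuse_resample)); congr (P' _).
have dE' w : ~ N (p w) -> diffuse_resample (Y w 0, xi (p w)) = resample n phi g rc r (Y w 0, xi (p w)).
  move=> nN; rewrite /diffuse_resample mem_set//=; apply: contrapT => nd; exact/nN/diffN.
by apply/seteqP; split => w /= [h nN]; split=> //; move: h; rewrite /W dE'.
Qed.

End box_shift_of_general.

Lemma integral_indic_comp (R : realType) dT (T : measurableType dT) dU (U : measurableType dU)
    (mu : {measure set T -> \bar R}) (A : set U) (h : T -> U) :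
  measurable A -> measurable_fun setT h ->
  (\int[mu]_x (\1_A (h x))%:E)%E = mu (h @^-1` A).
Proof.
move=> mA mh; have := integral_indic mu measurableT (measurable_preim mh mA).
by rewrite setIT => <-; exact: eq_integral.
Qed.

Lemma semi_cond_eq (R : realType) d dT (T : measurableType dT) (Q : {measure set T -> \bar R})
    (xi : lf_measure R d) (C : set 'rV[R]_d) (mC : measurable C) (A B : set (T * 'rV[R]_d)) :
  (forall q, C q.2 -> A q <-> B q) ->
  semi Q (measurable_cst (lf_cond xi mC)) A = semi Q (measurable_cst (lf_cond xi mC)) B.
Proof.
move=> AB; apply: eq_integral => x _; rewrite !lf_restrE; congr (_ * lf_val xi _)%E.
by rewrite !xsection_set; apply/seteqP; split => y /= [h Cy]; split=> //; exact/AB.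
Qed.

(** * From invariance under box shifts to window invariance *)

Section window_of_box_shift.
Context (R : realType) (d : nat) (dO : measure_display) (O : measurableType dO)
  (P : {measure set O -> \bar R}) (dE : measure_display) (E : measurableType dE).
Notation rV := 'rV[R]_d.
Notation lf := (lf_measure R d).
Notation S := (E * lf)%type.
Variables (theta : rV -> E -> E) (X : O -> E) (xi : O -> lf).
Hypotheses (htheta : measurable_action theta)
  (mX : measurable_fun setT X) (mxi : measurable_fun setT xi).
Hypothesis hsupp : {ae P, forall w, msupport (xi w) 0}.
Hypothesis hsigma : sigma_finite setT (pushforward P (fun w => (X w, xi w))).
Hypothesis hdiffuse : {ae P, forall w, diffuse (xi w)}.
Variables (n : nat) (phi : rV -> R) (g : R -> rV) (rc : bool).
Hypotheses (n_gt0 : (0 < n)%N) (code : box_code n phi g).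
Local Notation box := (@box R d n).

Hypothesis inv : forall r, 0 <= r < 1 -> box_shift_invariant n phi g rc r P theta X xi.

Let Q := marked_law P mX mxi.
Let flow := marked_flow theta.
Let mbox : measurable box. Proof. exact: measurable_box. Qed.
Let cl : lf := lf_cond (lebesgue_lf R d) mbox.
Let PU := semi P (measurable_cst cl).
Let QU := semi Q (measurable_cst cl).
Let Z w : S := (X w, xi w).
(** A background must be a box field at every point, so the uniform location is replaced by 0
    outside the box, where [PU] has no mass. *)
Let y (q : O * rV) : rV := if q.2 \in box then q.2 else 0.
Let Y (q : O * rV) : random_field R d := torus_field n (y q).

Let ybox q : box (y q).
Proof.
rewrite /y; case: ifPn => [/set_mem//|_] i; by rewrite mxE lexx ltr0n.
Qed.

Let yE q : box q.2 -> y q = q.2.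
Proof. by move=> bq; rewrite /y mem_set. Qed.

Let mZ : measurable_fun setT Z. Proof. exact: measurable_fun_pair. Qed.

Let my : measurable_fun setT y.
Proof. by apply: measurable_fun_ifT => //; exact: measurable_fun_mem. Qed.

Let ext : extension P PU fst.
Proof.
split=> // A mA; rewrite -[RHS](uniform_extension_fst P mbox (@bounded_box R d n) (lebesgue_box_gt0 R d n_gt0) mA).
by [].
Qed.

Let bg : box_background n P X xi PU fst Y.
Proof.
split=> //.
- exact: (measurableT_comp (measurable_torus_field n_gt0) my).
- by move=> w; exact: box_field_torus.
move=> A mA.
transitivity (PU ((fun q => (Z q.1, q.2)) @^-1` [set p | A (p.2, p.1)])).
  rewrite -[LHS]/(PU ((fun q => (Y q 0, (X q.1, xi q.1))) @^-1` A)).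
  apply: semi_cond_eq => q bq; have e : Y q 0 = q.2.
    by rewrite -[LHS]/(torus_field n (y q) 0) torus_field0 ?yE.
  by rewrite /preimage /mkset e.
have mA' : measurable [set p : S * rV | A (p.2, p.1)].
  by apply: (measurable_preim _ mA); exact: measurable_fun_pair.
rewrite -(uniform_boxE R d n_gt0).
transitivity (QU [set p : S * rV | A (p.2, p.1)]); first exact: (uniform_extension_law P mX mxi mbox mA').
transitivity (\int[cl]_x \int[Q]_z (\1_A (x, z))%:E)%E.
  rewrite -(lf_fubini (nu := Q) cl (f := fun p => (\1_A (p.2, p.1))%:E))//.
  - apply: eq_integral => z _; rewrite xsection_set.
    exact/esym/(integral_indic_comp cl mA (pair2_measurable z)).
  - by apply: measurable_indic_comp => //; exact: measurable_fun_pair.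
apply: eq_integral => x _ /=.
rewrite (integral_indic_comp Q mA (pair1_measurable x)) -(extension_law mX mxi ext); last first.
  exact: (measurable_preim (pair1_measurable x) mA).
by rewrite xsection_set.
Qed.

Let T r (p : S * rV) : S * rV :=
  let v := resample n phi g rc r (p.2, p.1.2) in (flow v p.1, torus n%:R v p.2).

Let mT : measurable_fun setT (fun q : measurableTypeR R * (S * rV) => T q.1 q.2).
Proof.
have m21 : measurable_fun setT (fun q : measurableTypeR R * (S * rV) => q.2.1).
  exact: (measurableT_comp measurable_fst measurable_snd).
have m22 : measurable_fun setT (fun q : measurableTypeR R * (S * rV) => q.2.2).
  exact: (measurableT_comp measurable_snd measurable_snd).
have mr : measurable_fun setT (fun q : measurableTypeR R * (S * rV) =>
    resample n phi g rc q.1 (q.2.2, q.2.1.2)).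
  apply: (measurable_resample rc code (q := fun q : measurableTypeR R * (S * rV) => (q.2.2, q.2.1.2))).
    exact: measurable_fst.
  apply: measurable_fun_pair => //.
  exact: (measurableT_comp measurable_snd m21).
have [_ _ mt] := torus_action R d n_gt0.
apply: measurable_fun_pair; first exact: (measurable_theta (marked_flow_action htheta)).
exact: (measurableT_comp mt (measurable_fun_pair mr m22)).
Qed.

Let mTr r : measurable_fun setT (T r).
Proof. exact: (measurableT_comp mT (pair1_measurable (r : measurableTypeR R))). Qed.

(** The invariance of the field is tested on sets [D] that look at its value at 0 only, where the
    shift of the field is the torus translation in [T]. *)
Let T_invariant r A : 0 <= r < 1 -> measurable A -> QU (T r @^-1` A) = QU A.
Proof.
move=> r01 mA; pose D := [set q : random_field R d * E * lf | A ((q.1.2, q.2), q.1.1 0)].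
have mD : measurable D.
  apply: (measurable_preim _ mA); apply: measurable_fun_pair.
    apply: measurable_fun_pair => //; exact: (measurableT_comp measurable_snd measurable_fst).
  exact: (measurableT_comp (measurable_field_eval 0) (measurableT_comp measurable_fst measurable_fst)).
have law B : measurable B -> QU B = PU ((fun q => (X q.1, xi q.1, q.2)) @^-1` B).
  by move=> mB; exact: (esym (uniform_extension_law P mX mxi mbox mB)).
rewrite law; last exact: (measurable_preim (mTr r) mA).
rewrite (law A mA).
have Y0 q : box q.2 -> Y q 0 = q.2.
  by move=> bq; rewrite -[LHS]/(torus_field n (y q) 0) torus_field0 ?yE.
transitivity (pushforward PU (fun q => (Y q, X q.1, xi q.1)) D); last first.
  by apply: semi_cond_eq => q bq; rewrite /preimage /mkset /D /= Y0.
rewrite -(inv r01 bg mD); apply/esym/semi_cond_eq => q bq.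
set t := box_shift n phi g rc r (Y q) (xi q.1).
have tE : t = resample n phi g rc r (q.2, xi q.1).
  by rewrite /t (box_shiftE rc code) Y0.
suff e : field_shift t (Y q) 0 = torus n%:R t q.2 by rewrite /preimage /mkset /D /= -/t e tE.
by rewrite /Y field_shift_torus// torus_field0// yE.
Qed.

Let measurable_irregular :
  measurable [set p : S * rV | ~ diffuse p.1.2 \/ window_mass snd box p = 0%E].
Proof.
apply: measurableU.
  have mc := measurableC (@measurable_diffuse R d).
  have m12 : measurable_fun setT (fun p : S * rV => p.1.2).
    exact: (measurableT_comp measurable_snd measurable_fst).
  exact: (measurable_preim m12 mc).
exact: (measurable_preim (measurable_window_mass (marked_flow_action htheta)
  (@measurable_mark R d _ E) mbox) (emeasurable_set1 0%E)).
Qed.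

Let irregular_null : QU [set p : S * rV | ~ diffuse p.1.2 \/ window_mass snd box p = 0%E] = 0%E.
Proof.
have md : measurable [set z : S | ~ diffuse z.2].
  exact: (measurable_preim (measurable_snd : measurable_fun setT (snd : S -> lf)) (measurableC (@measurable_diffuse R d))).
have Qd : Q [set z : S | ~ diffuse z.2] = 0%E.
  case: hdiffuse => N [mN N0 diffN]; apply: (subset_measure0 _ mN _ N0).
    exact: (measurable_preim mZ md).
  by move=> w /= nd; apply: diffN.
have d0 : QU [set p : S * rV | ~ diffuse p.1.2] = 0%E.
  rewrite (_ : [set p | _] = [set z : S | ~ diffuse z.2] `*` setT); last first.
    by apply/seteqP; split => p //= [].
  transitivity (\int[Q]_(z in [set z | ~ diffuse z.2]) cl setT)%E; first exact: semi_setX.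
  exact: (null_set_integral md (measurable_cst _) Qd).
have mm : measurable [set p : S * rV | window_mass snd box p = 0%E].
  exact: (measurable_preim (measurable_window_mass (marked_flow_action htheta)
    (@measurable_mark R d _ E) mbox) (emeasurable_set1 0%E)).
have mp : measurable [set p : S * rV | ~ diffuse p.1.2].
  by rewrite (_ : [set p | _] = [set z : S | ~ diffuse z.2] `*` setT);
    [exact: measurableX|apply/seteqP; split => p //= []].
apply: (etrans (measureU0 mp mm _)) => //.
exact: (uniform_window_mass_null htheta mX mxi hsupp mbox (@lebesgue_box_boundary R d n)).
Qed.

(** By [psi_average], a uniform [r] sends the location [x] of the origin to a point of law
    [box_law]. This law is the window kernel translated by [x], so the jump has the conditional law
    prescribed for [V]. *)
Let average p A : box p.2 -> diffuse p.1.2 -> window_mass snd box p != 0%E -> measurable A ->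
  lebesgue_measure (`[0, 1[%classic `&` [set r | A (T r p)]) =
  window_kernel mbox p [set v | A (jump theta (p, v))].
Proof.
move: p => [z x] /= bx dm mass mA.
have setE : [set v | box (x + v)] = [set s | box (s - - x)].
  by apply/seteqP; split => s /=; rewrite opprK addrC.
have q0 : box_measure (x, z.2) box != 0%E by rewrite -[X in X != _]/(z.2 [set s | box (s - - x)]) -setE.
(* The test in terms of the new location [v], reached by the jump [v - x]. *)
pose B := [set v : rV | A (flow (v - x) z, v)].
have mB : measurable B.
  apply: (measurable_preim _ mA); apply: measurable_fun_pair => //.
  apply: (measurable_theta (marked_flow_action htheta)) => //; exact: mx_subr_measurable.
transitivity (box_law n (x, z.2) (box `&` B)); last first.
  have mE : box_measure (x, z.2) box = z.2 [set v | box (x + v)] by rewrite setE.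
  rewrite /box_law /window_kernel !lf_restrE mE; congr (_ * _)%E.
  rewrite -[LHS]/(z.2 [set s | ((box `&` B) `&` box) (s - - x)]); congr (lf_val z.2 _).
  apply/seteqP; split => s; rewrite /= opprK /B/= addrK /jump/= [x + s]addrC.
    by move=> [[_ As] bs].
  by move=> [As bs].
rewrite -(psi_average rc code (box_law_box q0) (fun t => box_law_diffuse n t (dm : diffuse (x, z.2).2)) x mB).
congr lebesgue_measure; congr (_ `&` _); apply/seteqP; split => r;
  rewrite /T /resample mem_set//= q0/= /B/= torus_sub//; exact: (psi_box rc code (box_law_box q0)).
Qed.

Lemma window_invariant_of_box_shift : window_invariant flow snd Q box.
Proof.
apply/(window_law_iff P htheta mX mxi mbox (@bounded_box R d n) (lebesgue_box_gt0 R d n_gt0)) => A mA.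
have m01 : measurable (`[0, 1[%classic : set (measurableTypeR R)) by [].
pose U := mrestr (@lebesgue_measure R) m01.
have UT : U setT = 1%E.
  by rewrite /U /mrestr setTI lebesgue_measure_itv/= lte_fin ltr01 sube0.
(* Averaged over r, the shifts T r resample the location from box_law. *)
have sU : sigma_finite setT U.
  by exists (fun=> setT) => [|k]; [rewrite bigcup_const|rewrite UT ltry].
have sQU : sigma_finite setT QU.
  have [F [FT mF Ffin]] := sigma_finite_cover (mu := Q) hsigma.
  exists (fun j => F j `*` setT) => [|j]; first by rewrite -setX_bigcupl FT setXTT.
  split; first exact: measurableX.
  rewrite [X in (X < _)%E]semi_setX (eq_integral (cst 1%E)) ?integral_cst ?mul1e//.
  by move=> z _; exact: (cond_lebesgueT mbox (@bounded_box R d n) (lebesgue_box_gt0 R d n_gt0)).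
pose f (p : measurableTypeR R * (S * rV)) : \bar R := (\1_A (T p.1 p.2))%:E.
have mf : measurable_fun setT f by exact: measurable_indic_comp.
have f0 p : (0 <= f p)%E by rewrite lee_fin.
transitivity (\int[QU]_p U [set r | A (T r p)])%E.
  transitivity (\int[QU]_p window_kernel mbox p [set v | A (jump theta (p, v))])%E.
    by apply: eq_integral => p _; rewrite xsection_set.
  apply: ae_eq_integral => //.
  - have := measurable_lf_xsection (measurable_window_kernel htheta mbox)
      (measurable_preim (measurable_jump htheta) mA).
    by congr (measurable_fun _); apply/funext => p; rewrite xsection_set.
  - have := @measurable_fun_fubini_tonelli_G _ _ _ _ R (sf_measure sU) f mf f0.
    congr (measurable_fun _); apply/funext => p.
    exact: (integral_indic_comp U mA (measurableT_comp mT (pair2_measurable p))).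
  have b0 : QU [set p | ~ box p.2] = 0%E.
    by rewrite -[RHS](measure0 QU); apply: semi_cond_eq => p bp; split.
  have mb : measurable [set p : S * rV | ~ box p.2].
    exact: (measurable_preim (measurable_snd : measurable_fun setT (snd : S * rV -> rV)) (measurableC mbox)).
  (* Off this null set the location is in the box, the measure is diffuse and it charges the window,
     as [average] requires. *)
  exists ([set p : S * rV | ~ diffuse p.1.2 \/ window_mass snd box p = 0%E] `|` [set p | ~ box p.2]).
  split; first exact: measurableU.
    by apply: (etrans (measureU0 measurable_irregular mb b0)); exact: irregular_null.
  move=> p /= np; apply: contrapT => reg; apply: np => _.
  have [bp [dp mp]] : box p.2 /\ diffuse p.1.2 /\ window_mass snd box p != 0%E.
    split; first by apply: contrapT => nb; apply: reg; right.
    split; first by apply: contrapT => nb; apply: reg; left; left.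
    by apply/eqP => m0; apply: reg; left; right.
  by rewrite -average// /U /mrestr setIC.
transitivity (\int[QU]_p \int[U]_r f (r, p))%E.
  apply: eq_integral => p _; apply/esym.
  exact: (integral_indic_comp U mA (measurableT_comp mT (pair2_measurable p))).
rewrite -(@fubini_tonelli _ _ _ _ _ (sf_measure sU) (sf_measure sQU) f)//.
transitivity (\int[U]_r (cst (QU A) r))%E; last first.
  by rewrite integral_cst// [X in (_ * X)%E](_ : _ = 1%E) ?mule1.
apply: ae_eq_integral => //.
  exact: (@measurable_fun_fubini_tonelli_F _ _ _ _ R (sf_measure sQU) f mf f0).
exists (~` `[0, 1[%classic); split; first exact: measurableC.
  have U0 : U (~` `[0, 1[%classic) = 0%E by rewrite /U /mrestr setICl measure0.
  exact: U0.
move=> r /= nr; apply: contra_not nr; rewrite in_itv => r01 _.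
by rewrite -(T_invariant r01 mA); exact: (integral_indic_comp QU mA (mTr r)).
Qed.

End window_of_box_shift.

(** * Coding a box by digits *)

Section digits.
Context (R : realType).
Implicit Types (q j : nat) (x : R) (a : nat -> R).

Definition digit q j x : R :=
  (Num.floor (q%:R ^+ j.+1 * x))%:~R - q%:R * (Num.floor (q%:R ^+ j * x))%:~R.

Definition radix_sum q a J : R := \sum_(j < J) a j / q%:R ^+ j.+1.

Definition radix_value q a : R := sup (range (radix_sum q a)).

Lemma radix_sumS q a J : radix_sum q a J.+1 = radix_sum q a J + a J / q%:R ^+ J.+1.
Proof. by rewrite /radix_sum big_ord_recr. Qed.

(** The bound [q] in place of [q - 1] is good enough: binary digits bounded by 2 stay below 3, which
    is what [digit_radix_value] asks for in base 4. *)
Lemma digit_itv q j x : 0 <= digit q j x <= q%:R.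
Proof.
rewrite /digit exprS -mulrA; move: (q%:R ^+ j * x) => y.
have /andP[f1 f2] := floor_itv y; have /andP[g1 g2] := floor_itv (q%:R * y).
rewrite subr_ge0; apply/andP; split.
  have : (q%:Z * Num.floor y)%:~R <= q%:R * y by rewrite intrM ler_wpM2l.
  by move/le_floor; rewrite intrKfloor -(ler_int R) intrM => /le_trans; apply.
rewrite lerBlDl (le_trans g1)// -[X in _ + X]mulr1 -mulrDr ler_wpM2l// ltW//.
by rewrite -intrD1.
Qed.

Lemma digit_int q j x : digit q j x \is a Num.int.
Proof. by rewrite rpredB ?rpredM ?intr_int// natr_int. Qed.

Lemma measurable_digit q j : measurable_fun [set: R] (digit q j).
Proof.
have mf k : measurable_fun [set: R] (fun x => (Num.floor (q%:R ^+ k * x))%:~R : R).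
  apply: (measurableT_comp (@measurable_floor R)); apply: measurable_funM => //.
apply: measurable_funB => //; exact: measurable_funM.
Qed.

Section value.
Variables (q : nat) (a : nat -> R) (m : R).
Hypotheses (q_gt1 : (1 < q)%N) (a_itv : forall j, 0 <= a j <= m).

Let q1_gt0 : 0 < q%:R - 1 :> R. Proof. by rewrite subr_gt0 ltr1n. Qed.

Let q_gt0 : 0 < q%:R :> R. Proof. by rewrite ltr0n ltnW. Qed.

Lemma radix_sum_nondecreasing : nondecreasing_seq (radix_sum q a).
Proof.
apply/nondecreasing_seqP => J; rewrite radix_sumS lerDl divr_ge0 ?exprn_ge0 ?(ltW q_gt0)//.
by have /andP[] := a_itv J.
Qed.

(** [c / q ^ J] is the geometric tail after [J] places when all digits equal [m]. *)
Let c := m / (q%:R - 1).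

Let c_ge0 : 0 <= c.
Proof.
by rewrite divr_ge0 ?(ltW q1_gt0)//; have /andP[/le_trans] := a_itv 0; apply.
Qed.

Let radix_sum_tail J K : (J <= K)%N ->
  radix_sum q a K <= radix_sum q a J + c / q%:R ^+ J.
Proof.
have step L : radix_sum q a L.+1 + c / q%:R ^+ L.+1 <= radix_sum q a L + c / q%:R ^+ L.
  rewrite radix_sumS -addrA lerD2l -mulrDl ler_pdivrMr ?exprn_gt0//.
  rewrite exprSr mulrA divfK ?gt_eqF ?exprn_gt0//.
  have -> : c * q%:R = m + c by rewrite /c; field; rewrite gt_eqF.
  by rewrite lerD2r; have /andP[] := a_itv L.
move=> JK; rewrite (le_trans _ (_ : radix_sum q a K + c / q%:R ^+ K <= _))//.
  by rewrite lerDl divr_ge0// exprn_ge0// ltW.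
have /nonincreasing_seqP := step; exact.
Qed.

Let radix_ub : has_ubound (range (radix_sum q a)).
Proof.
exists c => _ [J _ <-]; have := radix_sum_tail (leq0n J).
by rewrite /radix_sum big_ord0 add0r expr0 divr1.
Qed.

Lemma radix_sum_le J : radix_sum q a J <= radix_value q a.
Proof. by apply: ub_le_sup => //; exists J. Qed.

Lemma radix_value_le J : radix_value q a <= radix_sum q a J + c / q%:R ^+ J.
Proof.
apply: ge_sup; first by exists (radix_sum q a 0), 0%N.
move=> _ [K _ <-]; have [JK|/ltnW KJ] := leqP J K; first exact: radix_sum_tail.
rewrite (le_trans (radix_sum_nondecreasing KJ))// lerDl.
by rewrite divr_ge0// exprn_ge0// ltW.
Qed.

Lemma radix_sum_cvg : radix_sum q a @ \oo --> radix_value q a.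
Proof. exact: nondecreasing_cvgn radix_sum_nondecreasing radix_ub. Qed.

(** Here [c < 1], so the tail after [J] places is smaller than one unit of the last place. Hence the
    floor of [q ^ J] times the value is [q ^ J] times the partial sum, an integer, and consecutive
    floors recover the digit. *)
Lemma digit_radix_value j : m < q%:R - 1 -> (forall k, a k \is a Num.int) ->
  digit q j (radix_value q a) = a j.
Proof.
move=> mq aint.
have floorE J : (Num.floor (q%:R ^+ J * radix_value q a))%:~R = q%:R ^+ J * radix_sum q a J.
  have qJ : 0 < (q%:R : R) ^+ J by rewrite exprn_gt0.
  have int : q%:R ^+ J * radix_sum q a J \is a Num.int.
    elim: J {qJ} => [|J IH]; first by rewrite /radix_sum big_ord0 mulr0.
    rewrite radix_sumS mulrDr mulrCA mulfV ?mulr1 ?expf_neq0 ?gt_eqF//.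
    by rewrite rpredD// exprS -mulrA rpredM// natr_int.
  rewrite -[RHS]floorK//; congr _%:~R; apply: floor_def.
  rewrite intrD1 floorK// ler_pM2l// radix_sum_le/=.
  rewrite (le_lt_trans (ler_wpM2l (ltW qJ) (radix_value_le J)))//.
  rewrite mulrDr ltrD2l mulrCA mulfV ?gt_eqF// mulr1.
  by rewrite ltr_pdivrMr// mul1r.
rewrite /digit !floorE radix_sumS exprS; field.
by rewrite expf_neq0// gt_eqF.
Qed.

End value.

Lemma measurable_radix_value dT (T : measurableType dT) q (m : R) (a : T -> nat -> R) : (1 < q)%N ->
  (forall (z : T) j, 0 <= a z j <= m) -> (forall j, measurable_fun setT (a^~ j)) ->
  measurable_fun setT (fun z => radix_value q (a z)).
Proof.
move=> q1 a_itv ma.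
apply: (@measurable_fun_cvg _ _ _ _ (fun J z => radix_sum q (a z) J)) => [J|z _]; last first.
  exact: radix_sum_cvg q1 (a_itv z).
by apply: measurable_sum => j; apply: measurable_funM.
Qed.

(** The partial sums telescope to the truncations of [x] to [J] places, which are at most [x] and
    within [1 / q ^ J] of it. *)
Lemma radix_value_digits q x : (1 < q)%N -> 0 <= x < 1 -> radix_value q (digit q ^~ x) = x.
Proof.
move=> q1 /andP[x0 x1]; have q0 : 0 < q%:R :> R by rewrite ltr0n ltnW.
have dig j : 0 <= digit q j x <= q%:R by exact: digit_itv.
have sumE J : radix_sum q (digit q ^~ x) J = (Num.floor (q%:R ^+ J * x))%:~R / q%:R ^+ J.
  elim: J => [|J IH].
    rewrite /radix_sum big_ord0 expr0 mul1r divr1 (floor_def (m := 0))//.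
    by rewrite x0 add0r.
  rewrite radix_sumS IH /digit exprS; field.
  by rewrite expf_neq0 gt_eqF.
have sum_itv J : x - (q%:R ^+ J)^-1 < radix_sum q (digit q ^~ x) J <= x.
  have qJ : 0 < (q%:R : R) ^+ J by rewrite exprn_gt0.
  have /andP[f1 f2] := floor_itv (q%:R ^+ J * x).
  rewrite sumE ler_pdivrMr// [x * _]mulrC f1 andbT ltr_pdivlMr// mulrBl mulVf ?gt_eqF//.
  by rewrite ltrBlDr -intrD1 mulrC.
apply/eqP; rewrite eq_le; apply/andP; split.
  apply: ge_sup; first by exists (radix_sum q (digit q ^~ x) 0), 0%N.
  by move=> _ [J _ <-]; have /andP[] := sum_itv J.
rewrite leNgt; apply/negP => /ltr_add_invr[k].
have /andP[h _] := sum_itv k.+1; have := radix_sum_le q1 dig k.+1.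
have : (q%:R ^+ k.+1)^-1 <= (k.+1%:R)^-1 :> R.
  by rewrite lef_pV2 ?posrE ?exprn_gt0// -natrX ler_nat ltnW// ltn_expl.
move: h; move: ((q%:R ^+ k.+1)^-1) (k.+1%:R^-1) (radix_sum _ _ _) (radix_value _ _) => e f S V.
lra.
Qed.

End digits.

(* Interleaves the binary digits of the coordinates and reads them in base 4, where
   the expansion with digits 0 and 1 is unique. *)
Lemma box_code_exists (R : realType) (d n : nat) : (0 < d)%N -> (0 < n)%N ->
  exists phi g, @box_code R d n phi g.
Proof.
move=> d0 n0.
(* Place [j] of the code holds binary digit [j / d] of coordinate [j mod d], so coordinate [i] is
   read back from the places [l * d + i]. *)
pose phi (x : 'rV[R]_d) := radix_value 4 (fun j => digit 2 (j %/ d) (x 0 (Ordinal (ltn_pmod j d0)) / n%:R)).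
pose h (y : R) : 'rV[R]_d := \row_i (n%:R * radix_value 2 (fun l => digit 4 (l * d + i) y)).
(* For [y] outside the range of [phi] the point [h y] can leave the box, and 0 stands in for it. *)
exists phi, (fun y => if h y \in @box R d n then h y else 0).
have itv2 x j : 0 <= digit 2 (j %/ d) ((x : 'rV[R]_d) 0 (Ordinal (ltn_pmod j d0)) / n%:R) <= 2.
  exact: digit_itv.
have itv4 i y j : 0 <= digit 4 (j * d + (i : 'I_d)) (y : R) <= 4 by exact: digit_itv.
have e4 : 4 - 1 = 3 :> R by ring.
have phi_itv x : 0 <= phi x < 1.
  have S0 b : radix_sum 4 b 0 = 0 :> R by rewrite /radix_sum big_ord0.
  have := radix_sum_le (isT : (1 < 4)%N) (itv2 x) 0; rewrite S0 => ->/=.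
  have := radix_value_le (isT : (1 < 4)%N) (itv2 x) 0.
  rewrite S0 -/(phi x) e4 add0r expr0 divr1 => /le_lt_trans; apply.
  by rewrite ltr_pdivrMr// mul1r ltr_nat.
have hphi x : @box R d n x -> h (phi x) = x.
  move=> bx; apply/rowP => i; rewrite mxE.
  have x01 : 0 <= x 0 i / n%:R < 1.
    have /andP[x0 xn] := bx i.
    by rewrite divr_ge0//= ltr_pdivrMr ?ltr0n// mul1r.
  rewrite (_ : (fun l => _) = digit 2 ^~ (x 0 i / n%:R)); last first.
    apply/funext => l; rewrite (digit_radix_value _ (itv2 x))//; last 2 first.
    - by rewrite e4 ltr_nat.
    - by move=> k; exact: digit_int.
    rewrite divnMDl// divn_small// addn0; congr (digit _ _ (x 0 _ / _)).
    by apply/val_inj; rewrite /= modnMDl modn_small.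
  by rewrite radix_value_digits// mulrC divfK// pnatr_eq0 -lt0n.
split.
- by move=> x _; rewrite /= in_itv/=.
- move=> y _; case: ifPn => [/set_mem//|_] i.
  by rewrite mxE lexx ltr0n.
- by move=> x bx; rewrite hphi// mem_set.
split.
  apply: measurable_funTS; apply: (measurable_radix_value (isT : (1 < 4)%N) itv2) => j.
  apply: (measurableT_comp (@measurable_digit R 2 _)).
  by apply: measurable_funM => //; exact: measurable_coord.
have mh : measurable_fun setT h.
  apply: measurable_fun_rV => i.
  rewrite (_ : (fun y => _) = fun y => n%:R * radix_value 2 (fun l => digit 4 (l * d + i) y)).
    apply: measurable_funM => //.
    apply: (measurable_radix_value (isT : (1 < 2)%N) (itv4 i)) => l.
    exact: measurable_digit.
  by apply/funext => y; rewrite mxE.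
apply: measurable_funTS; apply: measurable_fun_ifT => //.
by apply: measurable_fun_mem => //; exact: measurable_box.
Qed.

Theorem theorem7 (R : realType) (d : nat) (hd : (0 < d)%N)
  (dO : measure_display) (O : measurableType dO)
  (P : {measure set O -> \bar R})
  (dE : measure_display) (E : measurableType dE)
  (theta : 'rV[R]_d -> E -> E) (htheta : measurable_action theta)
  (X : O -> E) (mX : measurable_fun setT X)
  (xi : O -> lf_measure R d) (mxi : measurable_fun setT xi)
  (hsupp : {ae P, forall w, msupport (xi w) 0})
  (hsigma : sigma_finite setT (pushforward P (fun w => (X w, xi w))))
  (hdiffuse : {ae P, forall w, diffuse (xi w)}) :
  (mass_stationary P theta X xi <->
     invariant_under_preserving_shifts P theta X xi) /\
  (forall (phi : nat -> 'rV[R]_d -> R) (phi_inv : nat -> R -> 'rV[R]_d)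
      (rc : bool),
    (forall n, (0 < n)%N ->
       borel_isomorphism (@box R d n) (`[0, 1[ : set R) (phi n) (phi_inv n)) ->
    (mass_stationary P theta X xi <->
       forall (n : nat) (r : R), (0 < n)%N -> 0 <= r < 1 ->
         box_shift_invariant n (phi n) (phi_inv n) rc r P theta X xi)).
Proof.
have ms := mass_stationary_mecke htheta mX mxi hsupp hsigma.
have of_mecke := invariant_of_mecke htheta (mX := mX) (mxi := mxi) hsupp hsigma.
have of_boxes := mecke_of_boxes htheta (mX := mX) (mxi := mxi) hsigma.
have of_box n phi g rc := @window_invariant_of_box_shift R d dO O P dE E theta X xi
  htheta mX mxi hsupp hsigma hdiffuse n phi g rc.
have box_of n phi g rc r (n0 : (0 < n)%N) code := @box_shift_invariant_of_general R d n n0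
  phi g rc r code dO O P dE E theta X xi htheta mX mxi hdiffuse.
split.
  split=> [/ms//|inv]; apply/ms/of_boxes => n n0.
  (* This equivalence provides no Borel isomorphism, so the digit code takes its place; either
     generalized inverse can be chosen with it. *)
  have [phi [g code]] := box_code_exists R hd n0.
  by apply: (of_box n phi g false) => // r _; exact: box_of.
move=> phi g rc iso.
have code n (n0 : (0 < n)%N) := borel_isomorphism_code (iso n n0).
split=> [/ms/of_mecke inv n r n0 _|inv]; first exact: box_of (code n n0) inv.
by apply/ms/of_boxes => n n0; apply: of_box (code n n0) _ => // r; exact: inv.
Qed.
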